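(* Let $\beta\in\mathbb R$ and let $(\tau_n^{\beta,231})_{n\ge1}$ be random permutations defined on a common probability space (with an arbitrary coupling), where $\tau_n^{\beta,231}$ is a Mallows random permutation of size $n$ with parameter $e^{\beta/n}$ conditioned to avoid $231$. If $\beta>0$, let $$f_\beta^{231}(x):=1-\frac1\beta\log\big(1+e^\beta-e^{\beta x}\big),\qquad x\in[0,1].$$ Then $\tau_n^{\beta,231}$ converges almost surely, in the sense of permutons, to the deterministic permuton $$\mu_\beta^{231}:=\big(X,f_\beta^{231}(X)\big)_\#\Big[\min\big(1,(f_\beta^{231})'(x)\big)\,\mathrm dx\Big]+\big(X,1-X\big)_\#\Big[\max\big(0,1-(f_\beta^{231})'(x)\big)\,\mathrm dx\Big].$$ If $\beta\le0$, then $\tau_n^{\beta,231}$ converges almost surely, in the sense of permutons, to the diagonal permuton.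
   Context: A permutation $\sigma$ of $\{1,\dots,n\}$ is $231$-avoiding if there are no $i<j<k$ with $\sigma(k)<\sigma(i)<\sigma(j)$; $\mathrm{inv}(\sigma)$ is its number of inversions. The law of $\tau_n^{\beta,231}$ is supported on $231$-avoiding permutations $\sigma$ of size $n$ with $\mathbb P(\tau_n^{\beta,231}=\sigma)=e^{\frac\beta n\mathrm{inv}(\sigma)}/Z_n^{\beta,231}$, where $Z_n^{\beta,231}=\sum_\sigma e^{\frac\beta n\mathrm{inv}(\sigma)}$ (sum over $231$-avoiding permutations of size $n$). A permuton is a Borel probability measure on $[0,1]^2$ with both marginals equal to Lebesgue measure on $[0,1]$. With a permutation $\sigma$ of size $n$ associate the permuton $\mu_\sigma$ that puts mass $1/n$ uniformly on each cell $[\frac{i-1}n,\frac in]\times[\frac{\sigma(i)-1}n,\frac{\sigma(i)}n]$, $1\le i\le n$. A sequence of permutations $\sigma_n$ converges to a permuton $\mu$ if $\mu_{\sigma_n}\to\mu$ weakly. The diagonal permuton is the push-forward of Lebesgue measure on $[0,1]$ by $x\mapsto(x,x)$. For a map $g$ and a measure $m$ on $[0,1]$, $g_\#m(A)=m(g^{-1}(A))$; $(X,h(X))_\#m$ denotes the push-forward of $m$ by $x\mapsto(x,h(x))$. Measures $\rho(x)\,\mathrm dx$ are understood on $[0,1]$. *)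

(* Defs.v *)
From HB Require Import structures.
From mathcomp Require Import all_boot all_order all_algebra all_fingroup.
From mathcomp Require Import all_classical all_reals all_analysis.
From mathcomp Require Import measurable_realfun.

Set Implicit Arguments.
Unset Strict Implicit.
Unset Printing Implicit Defensive.

Import Order.TTheory GRing.Theory Num.Theory.
Import numFieldNormedType.Exports.

Local Open Scope classical_set_scope.
Local Open Scope ring_scope.

Definition inv_num (n : nat) (s : 'S_n) : nat :=
  #|[set p : 'I_n * 'I_n | (p.1 < p.2)%N && (s p.2 < s p.1)%N]|%SET.

Definition avoids231 (n : nat) (s : 'S_n) : bool :=
  ~~ [exists i : 'I_n, exists j : 'I_n, exists k : 'I_n,
        [&& (i < j)%N, (j < k)%N, (s k < s i)%N & (s i < s j)%N]].

Section mallows.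
Context {R : realType}.
Implicit Types (beta : R) (n : nat).

Definition mallows_weight beta n (s : 'S_n) : R :=
  expR (beta / n%:R * (inv_num s)%:R).

Definition mallows231_Z beta n : R :=
  \sum_(s : 'S_n | avoids231 s) mallows_weight beta s.

Definition mallows231_pmf beta n (s : 'S_n) : R :=
  if avoids231 s then mallows_weight beta s / mallows231_Z beta n else 0.

(* X has the law of a Mallows permutation of size n and parameter
   q = exp(beta / n) (weights q ^ inv) conditioned to avoid 231. *)
Definition is_mallows231 d (T : measurableType d) (P : probability T R)
    beta n (X : T -> 'S_n) : Prop :=
  forall s : 'S_n, measurable (X @^-1` [set s]) /\
    P (X @^-1` [set s]) = (mallows231_pmf beta s)%:E.

End mallows.

(* Measures on [0,1] and [0,1]^2 are represented by measures on R and R^2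
   that give mass 0 to the complement. *)
Notation plane R := (measurableTypeR R * measurableTypeR R)%type.

Definition unit_itv {R : realType} : set (measurableTypeR R) := `[0, 1].

Definition unit_square {R : realType} : set (plane R) :=
  unit_itv `*` unit_itv.

Lemma measurable_unit_itv {R : realType} : measurable (@unit_itv R).
Proof. exact: measurable_itv. Qed.

Lemma measurable_unit_square {R : realType} : measurable (@unit_square R).
Proof. by apply: measurableX; exact: measurable_unit_itv. Qed.

Section pushforward_measure.
Context d1 d2 (T1 : measurableType d1) (T2 : measurableType d2) {R : realType}.
Variables (m : {measure set T1 -> \bar R}) (f : T1 -> T2).
Hypothesis mf : measurable_fun setT f.

Lemma semi_sigma_additive_pushforward : semi_sigma_additive (pushforward m f).
Proof.
move=> F mF tF mUF; rewrite /pushforward preimage_bigcup.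
have mp A : measurable A -> measurable (f @^-1` A).
  by move=> mA; rewrite -[X in measurable X]setTI; exact: mf.
apply: measure_semi_sigma_additive => [n||].
- exact/mp/mF.
- apply/trivIsetP => /= i j _ _ ij; rewrite -preimage_setI.
  by move/trivIsetP : tF => /(_ _ _ _ _ ij) ->//; rewrite preimage_set0.
- by rewrite -preimage_bigcup; exact: mp.
Qed.

(* Carries the proof of measurability, so that the measure structure can be
   inferred. *)
Definition mpushforward of measurable_fun setT f : set T2 -> \bar R :=
  pushforward m f.

HB.instance Definition _ := isMeasure.Build _ _ _ (mpushforward mf)
  (measure0 m) (fun A => measure_ge0 m _) semi_sigma_additive_pushforward.

End pushforward_measure.

Section permutons.
Context {R : realType}.
Local Notation leb := (@lebesgue_measure R).

Definition is_permuton (mu : {measure set (plane R) -> \bar R}) : Prop :=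
  [/\ mu setT = 1%E,
      mu (~` unit_square) = 0%E,
      (forall A : set (measurableTypeR R), measurable A ->
         mu (A `*` setT) = leb (A `&` unit_itv)) &
      (forall A : set (measurableTypeR R), measurable A ->
         mu (setT `*` A) = leb (A `&` unit_itv))].

Definition weak_cvg (m : nat -> {measure set (plane R) -> \bar R})
    (mu : {measure set (plane R) -> \bar R}) : Prop :=
  forall f : R * R -> R, {within unit_square, continuous f} ->
    (\int[m n]_(z in unit_square) (f z)%:E @[n --> \oo]
       --> \int[mu]_(z in unit_square) (f z)%:E)%E.

Section perm_permuton.
Variables (n : nat) (s : 'S_n).

(* Elements of 'I_n start at 0: cell i is the square of side 1 / n with lower
   left corner (i / n, s(i) / n). *)
Definition perm_cell (i : 'I_n) : set (plane R) :=
  `[i%:R / n%:R, i.+1%:R / n%:R] `*` `[(s i)%:R / n%:R, (s i).+1%:R / n%:R].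

(* A cell has area 1 / n^2 and mass 1 / n, so the density on it is n. *)
Definition perm_permuton (A : set (plane R)) : \bar R :=
  (\sum_(i < n) n%:R%:E * (leb \x leb) (A `&` perm_cell i))%E.

Lemma measurable_perm_cell i : measurable (perm_cell i).
Proof. by apply: measurableX; exact: measurable_itv. Qed.

Let perm_permuton0 : perm_permuton set0 = 0%E.
Proof. by rewrite /perm_permuton big1// => i _; rewrite set0I measure0 mule0. Qed.

Let perm_permuton_ge0 A : (0 <= perm_permuton A)%E.
Proof. by apply: sume_ge0 => i _; apply: mule_ge0; rewrite ?lee_fin. Qed.

Let perm_permuton_sigma_additive : semi_sigma_additive perm_permuton.
Proof.
pose m (k : nat) : {measure set (plane R) -> \bar R} :=
  if insub k is Some i then
    mscale (NngNum (ler0n R n))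
      (mrestr (leb \x leb)%E (measurable_perm_cell i))
  else mzero.
suff -> : perm_permuton = msum m n by exact: measure_semi_sigma_additive.
by apply/funext => A; apply: eq_bigr => i _; rewrite /m (valK i).
Qed.

HB.instance Definition _ := isMeasure.Build _ _ _ perm_permuton
  perm_permuton0 perm_permuton_ge0 perm_permuton_sigma_additive.

End perm_permuton.

Definition permuton_cvg (s : forall n, 'S_n)
    (mu : {measure set (plane R) -> \bar R}) : Prop :=
  weak_cvg (fun n => perm_permuton (s n)) mu.

Definition diag_permuton : set (plane R) -> \bar R :=
  pushforward (mrestr leb measurable_unit_itv) (fun x => (x, x)).

Let measurable_diag :
  measurable_fun setT (fun x : measurableTypeR R => (x, x) : plane R).
Proof. by apply: measurable_fun_pair. Qed.

HB.instance Definition _ := Measure.copy diag_permuton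
  (mpushforward (mrestr leb measurable_unit_itv) measurable_diag).

(* the measure rho(x) dx on [0,1] *)
Definition density01 (rho : R -> R) (A : set (measurableTypeR R)) : \bar R :=
  (\int[leb]_(x in A `&` unit_itv) (rho x)%:E)%E.

Section density01_measure.
Variables (rho : R -> R).
Hypotheses (mrho : measurable_fun unit_itv rho)
           (rho_ge0 : forall x, unit_itv x -> 0 <= rho x).

Lemma density01_set0 : density01 rho set0 = 0%E.
Proof. by rewrite /density01 set0I integral_set0. Qed.

Lemma density01_ge0 A : (0 <= density01 rho A)%E.
Proof. by apply: integral_ge0 => x [_ x01]; rewrite lee_fin rho_ge0. Qed.

Lemma density01_sigma_additive : semi_sigma_additive (density01 rho).
Proof.
have m01 := @measurable_unit_itv R.
move=> F mF tF mUF; rewrite /density01 setI_bigcupl.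
rewrite ge0_integral_bigcup //=.
- by apply: is_cvg_ereal_nneg_natsum_cond => n _ _; exact: density01_ge0.
- by move=> k; exact: measurableI.
- apply/measurable_EFinP; apply: (measurable_funS m01) => //.
  by apply: bigcup_sub => i _ x [].
- by move=> x [k _ [_ x01]]; rewrite lee_fin rho_ge0.
- apply/trivIsetP => i j _ _ ij; rewrite setIACA setIid.
  by move/trivIsetP : tF => /(_ _ _ _ _ ij) ->//; rewrite set0I.
Qed.

HB.instance Definition _ := isMeasure.Build _ _ _ (density01 rho)
  density01_set0 density01_ge0 density01_sigma_additive.

Definition density01_measure : {measure set (measurableTypeR R) -> \bar R} :=
  density01 rho.

End density01_measure.

Section mu231.
Variable beta : R.

Definition f231 (x : R) : R :=
  1 - beta^-1 * ln (1 + expR beta - expR (beta * x)).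

(* The argument of ln is positive on a neighbourhood of [0,1], so the derivative
   over R agrees on [0,1], endpoints included, with that of f231 on [0,1]. *)
Definition curve_density (x : R) : R := Num.min 1 (f231^`()%classic x).

Definition antidiag_density (x : R) : R := Num.max 0 (1 - f231^`()%classic x).

Definition mu231 (A : set (plane R)) : \bar R :=
  (pushforward (density01 curve_density)
     (fun x : R => (x, f231 x) : plane R) A +
   pushforward (density01 antidiag_density)
     (fun x : R => (x, (1 - x)%R) : plane R) A)%E.

Let f231_arg_gt0 x : unit_itv x -> 0 < 1 + expR beta - expR (beta * x).
Proof.
rewrite /unit_itv/= in_itv/= => /andP[x0 x1].
rewrite subr_gt0; have [b0|b0] := leP beta 0.
  apply: (@le_lt_trans _ _ 1); last by rewrite ltrDl expR_gt0.
  by rewrite -expR0 ler_expR mulr_le0_ge0.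
apply: (@le_lt_trans _ _ (expR beta)); last by rewrite ltrDr.
by rewrite ler_expR ler_piMr// ltW.
Qed.

Lemma derive1_f231 x : unit_itv x ->
  f231^`()%classic x =
  beta^-1 * (1 + expR beta - expR (beta * x))^-1 * (expR (beta * x) * beta).
Proof.
move=> /f231_arg_gt0 pos; rewrite derive1E.
have h0 : is_derive x 1 (fun y : R => beta * y) beta.
  rewrite -[X in is_derive _ _ _ X]mulr1; apply: is_deriveZ.
have h1 : is_derive x 1 (expR \o (fun y : R => beta * y)) (expR (beta * x) * beta).
  exact: is_derive1_comp.
have h2 : is_derive x 1 (cst (1 + expR beta) - (expR \o (fun y : R => beta * y)))
    (0 - expR (beta * x) * beta).
  exact: is_deriveB.
pose g : R -> R := cst (1 + expR beta) - (expR \o (fun y : R => beta * y)).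
have hl : is_derive (g x) 1 (@ln R) (1 + expR beta - expR (beta * x))^-1.
  exact: is_derive1_ln.
have h3 := @is_derive1_comp R (@ln R) g x _ _ hl h2.
have h4 := is_deriveZ beta^-1 h3.
have h5 := is_deriveB (is_derive_cst (1 : R) x 1) h4.
rewrite (_ : f231 = cst 1 - beta^-1 *: (@ln R \o g)); last by apply/funext.
rewrite (@derive_val _ _ _ _ _ _ _ h5).
by rewrite !sub0r mulrN /GRing.scale/= mulrN opprK mulrA.
Qed.

Let measurable_exp_scale D :
  measurable_fun D (fun x : measurableTypeR R => expR (beta * x) : R).
Proof.
apply: measurableT_comp => //; exact: measurable_funM.
Qed.

Let measurable_derive1_f231 : measurable_fun unit_itv (f231^`()%classic).
Proof.
pose g (x : measurableTypeR R) : R :=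
  beta^-1 * expR (- ln (1 + expR beta - expR (beta * x))) *
  (expR (beta * x) * beta).
apply: (@eq_measurable_fun _ _ _ _ _ g).
  move=> x /set_mem x01; rewrite derive1_f231// /g expRN lnK//.
  by rewrite posrE f231_arg_gt0.
apply: measurable_funM; last exact: measurable_funM.
apply: measurable_funM => //; apply: measurableT_comp => //.
apply: measurableT_comp => //; apply: measurableT_comp => //.
exact: measurable_funB.
Qed.

Let derive1_f231_ge0 x : unit_itv x -> 0 <= f231^`()%classic x.
Proof.
move=> x01; rewrite derive1_f231//.
rewrite (_ : _ * _ = (1 + expR beta - expR (beta * x))^-1 *
  expR (beta * x) * (beta^-1 * beta)); last first.
  by rewrite -!mulrA mulrCA; congr (_ * _); rewrite mulrCA.
apply: mulr_ge0.
  by apply: mulr_ge0; rewrite ?expR_ge0// invr_ge0 ltW// f231_arg_gt0.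
by have [->|b0] := eqVneq beta 0; rewrite ?mulr0// mulVf.
Qed.

Let mrho1 : measurable_fun unit_itv curve_density.
Proof. by apply: measurable_minr. Qed.

Let mrho2 : measurable_fun unit_itv antidiag_density.
Proof. by apply: measurable_maxr => //; apply: measurable_funB. Qed.

Let rho1_ge0 x : unit_itv x -> 0 <= curve_density x.
Proof. by move=> x01; rewrite /curve_density le_min ler01 derive1_f231_ge0. Qed.

Let rho2_ge0 x : unit_itv x -> 0 <= antidiag_density x.
Proof. by move=> _; rewrite /antidiag_density le_max lexx. Qed.

Let measurable_f231 : measurable_fun setT f231.
Proof.
apply: measurable_funB => //; apply: measurable_funM => //.
apply: (@measurableT_comp _ _ _ _ _ _ (@ln R)) => //.
apply: measurable_funB => //; exact: measurable_exp_scale.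
Qed.

Let measurable_graph_f231 : measurable_fun setT
  (fun x : measurableTypeR R => (x, f231 x) : plane R).
Proof. by apply: measurable_fun_pair. Qed.

Let measurable_graph_anti : measurable_fun setT
  (fun x : measurableTypeR R => (x, 1 - x) : plane R).
Proof.
apply: measurable_fun_pair => //.
have : measurable_fun setT (fun x : R => 1 - x) by apply: measurable_funB.
by [].
Qed.

Let nu1 := density01_measure mrho1 rho1_ge0.
Let nu2 := density01_measure mrho2 rho2_ge0.

Let mu231E : mu231 = measure_add (mpushforward nu1 measurable_graph_f231)
                                 (mpushforward nu2 measurable_graph_anti).
Proof. by apply/funext => A; rewrite measure_addE. Qed.

Let mu231_0 : mu231 set0 = 0%E.
Proof. by rewrite mu231E /measure_add measure0. Qed.

Let mu231_ge0 A : (0 <= mu231 A)%E.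
Proof. by rewrite mu231E /measure_add measure_ge0. Qed.

Let mu231_sigma_additive : semi_sigma_additive mu231.
Proof. by rewrite mu231E /measure_add; exact: measure_semi_sigma_additive. Qed.

HB.instance Definition _ := isMeasure.Build _ _ _ mu231
  mu231_0 mu231_ge0 mu231_sigma_additive.

End mu231.

End permutons.

(* Main.v *)
Require Import Defs.
From mathcomp Require Import all_boot all_order all_algebra all_fingroup.
From mathcomp Require Import all_classical all_reals all_analysis.
From mathcomp Require Import measurable_realfun.
From mathcomp Require Import zify ring lra.

(** Why the theorem holds. Let [d i] be the number of indices [j < i] with
    [s i < s j]. A permutation is determined by this code, it avoids 231 iff
    [d i.+1 <= (d i).+1] for all [i], and its inversion number is the sum of the code.
    The steps [k i = d i + 1 - d i.+1] of a 231-avoiding permutation thus form an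
    arbitrary Dyck sequence (total [n], partial sums [i - d i] at most [i];
    [sum_avoids231_dyck]), and a summation by parts turns the Mallows weight into a
    product of powers [x j ^+ k j] with [x j = lam * expR (beta * j.+1 / n)], where
    [lam] is free ([mallows231_pmf_sum]). The conditioned Mallows permutation is a
    sequence of independent geometric steps conditioned to be a Dyck sequence.

    Let [beta > 0]. With [lam = 1 / (1 + expR beta)] the mean of the partial sums at
    [i] is a Riemann sum of the integral of [f231^`()], hence close to
    [n * f231 (i / n)] ([drift_f231]). Chernoff's bound makes deviations of order [n]
    exponentially unlikely for independent steps, and the conditioning costs only a
    polynomial factor ([dyck_weight_ge]): the total [n] is nearly the most likely one
    because of the unimodality of complete symmetric polynomials at a geometric
    progression ([hsym_mode]), and the cycle lemma rotates any sequence of total [n]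
    into a Dyck sequence of no smaller weight ([bridge_le_dyck]). So [d i] is
    uniformly close to [n * (x - f231 x)] at [x = i / n], outside of an event of
    exponentially small probability ([far_pmf]). At [beta = 0] all the steps have mean [1],
    so the code is [o(n)]. This passes to [beta < 0], as the change of weights is
    subexponential on permutations with a small code.

    The rest of the proof about permutations is deterministic. In a 231-avoiding
    permutation, [s i + d i + 1] is the first position [e] after [i] with a value
    above [s i], the code stays at least at [d i] between [i] and [e], and
    [d e <= d i] ([icode_next], [icode_gt], [icode_next_leq]). Since [x - f231 x] is
    unimodal, either [e] is close to [i] and the point [(i, s i) / n] is near the
    graph of [f231]; or [e] is the position across the peak at the same height, which
    is [n * (1 - f231 (i / n))], and then [s i] is close to [n - i]. The indices of the
    second kind are those whose next larger value comes after the peak, and they are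
    counted by minima of the code. This is [two_curves_gt0]; if the code is
    [o(n)], all but few points are near the diagonal ([two_curves_flat]).

    Points following two curves with a known proportion on each of them converge to
    the corresponding sum of push-forwards ([two_curves_cvg]), by uniform continuity
    of the test functions. The bounds of [far_pmf] are summable, so by the first
    Borel-Cantelli lemma the code is almost surely close to its profile for all large
    [n], whatever the coupling ([ae_near_profile]). *)

Set Implicit Arguments.
Unset Strict Implicit.
Unset Printing Implicit Defensive.

Import Order.TTheory GRing.Theory Num.Theory.
Import numFieldNormedType.Exports.

Local Open Scope classical_set_scope.
Local Open Scope ring_scope.

(** * Inversion codes of 231-avoiding permutations *)

Section inversion_code.
Local Open Scope nat_scope.
Variable n : nat.
Implicit Types (s t : 'S_n) (i j k m : nat).

(** The sentinel value [n] beyond the last position guarantees that every position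
    is followed by a larger value. *)
Definition pval s i : nat := if insub i is Some j then nat_of_ord (s j) else n.

(** The Lehmer code read from the left; it vanishes at [n] because of the
    sentinel. *)
Definition icode s i : nat := #|[pred j : 'I_n | (j < i) && (pval s i < s j)]|.

Lemma pval_ord s (i : 'I_n) : pval s i = s i.
Proof. by rewrite /pval valK. Qed.

Lemma pval_geq s i : n <= i -> pval s i = n.
Proof. by rewrite /pval => ni; rewrite insubF// ltnNge ni. Qed.

Lemma pval_leq s i : pval s i <= n.
Proof.
case: (ltnP i n) => [i_n|]; last by move=> /pval_geq ->.
by rewrite (pval_ord s (Ordinal i_n)) ltnW.
Qed.

Lemma pval_ltn s i : i < n -> pval s i < n.
Proof. by move=> i_n; rewrite (pval_ord s (Ordinal i_n)). Qed.

Lemma pval_inj s i j : i < n -> pval s i = pval s j -> i = j.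
Proof.
move=> i_n; case: (ltnP j n) => [j_n|nj]; last first.
  by rewrite (pval_geq s nj) => ij; have := pval_ltn s i_n; rewrite ij ltnn.
rewrite (pval_ord s (Ordinal i_n)) (pval_ord s (Ordinal j_n)).
by move=> /val_inj/perm_inj/(congr1 val).
Qed.

Lemma card_ord_ltn i : i <= n -> #|[pred j : 'I_n | j < i]| = i.
Proof.
by move=> i_n; rewrite -sum1_card -(big_ord_widen _ (fun=> 1) i_n) sum1_card card_ord.
Qed.

Lemma icode_leq s i : icode s i <= i.
Proof.
case: (leqP i n) => [i_n|n_i].
  rewrite -[leqRHS](card_ord_ltn i_n); apply/subset_leq_card/fintype.subsetP => j.
  by rewrite !inE => /andP[].
by apply: leq_trans (max_card _) _; rewrite card_ord ltnW.
Qed.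

Lemma icode_n s : icode s n = 0.
Proof.
apply: eq_card0 => j; apply/negbTE; rewrite !inE pval_geq// negb_and -!leqNgt.
by rewrite (ltnW (ltn_ord (s j))) orbT.
Qed.

Lemma inv_num_icode s : inv_num s = \sum_(i < n) icode s i.
Proof.
rewrite /inv_num -sum1_card.
rewrite (eq_bigl (fun p : 'I_n * 'I_n => (p.1 < p.2) && (s p.2 < s p.1))); last first.
  by move=> p; rewrite inE.
rewrite -(pair_big_dep xpredT (fun i j : 'I_n => (i < j) && (s j < s i))
  (fun _ _ => 1)) /=.
rewrite (exchange_big_dep xpredT)//=; apply: eq_bigr => i _.
rewrite sum1_card; apply: eq_card => j.
by rewrite !inE /= pval_ord.
Qed.

(** The sentinel creates no occurrence of the pattern, whose last letter is its
    smallest one. *)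
Lemma avoids231P s : reflect (forall i j k, i < j -> j < k ->
    pval s k < pval s i -> pval s i < pval s j -> False) (avoids231 s).
Proof.
apply: (iffP idP) => [/negP av i j k ij jk ki ij'|h].
  have k_n : k < n.
    rewrite ltnNge; apply/negP => nk; move: ki; rewrite pval_geq// ltnNge.
    by rewrite pval_leq.
  have j_n := ltn_trans jk k_n; have i_n := ltn_trans ij j_n.
  apply: av; apply/existsP; exists (Ordinal i_n).
  apply/existsP; exists (Ordinal j_n).
  apply/existsP; exists (Ordinal k_n).
  by rewrite -!pval_ord /= ij jk ki ij'.
apply/negP => /existsP[i /existsP[j /existsP[k /and4P[ij jk]]]].
by rewrite -!pval_ord => ki; apply: (h _ _ _ ij jk ki).
Qed.

(** An index [j < i] counted at [i.+1] but not at [i] would give an occurrence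
    [j, i, i.+1] of the pattern; only [i] itself can be counted anew. *)
Lemma icode_step s i : avoids231 s -> icode s i.+1 <= (icode s i).+1.
Proof.
move=> /avoids231P av.
case: (ltnP i n) => [i_n|n_i]; last first.
  rewrite /icode (@eq_card0 _ [pred j : 'I_n | _])// => j; apply/negbTE.
  rewrite !inE pval_geq ?(leqW n_i)// negb_and -!leqNgt.
  by rewrite (ltnW (ltn_ord (s j))) orbT.
have -> : (icode s i).+1 = #|[predU1 Ordinal i_n & [pred j : 'I_n |
    (j < i) && (pval s i < s j)]]|.
  by rewrite cardU1 !inE /= ltnn.
apply/subset_leq_card/fintype.subsetP => j; rewrite !inE => /andP[ji sj].
have [->//|ne] /= := eqVneq j (Ordinal i_n).
have ltji : j < i.
  by rewrite ltn_neqAle -ltnS ji andbT; apply: contra_neq ne => /(@val_inj _ _ _ j (Ordinal i_n)).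
rewrite ltji /= ltnNge leq_eqVlt negb_or; apply/andP; split.
  rewrite -pval_ord; apply/eqP => /(pval_inj (ltn_ord j)) e.
  by rewrite e ltnn in ltji.
apply/negP; rewrite -!pval_ord in sj * => h; exact: (av _ _ _ ltji (ltnSn i)).
Qed.

(** Everything counted at [i] is counted at [m], and so is [i]. *)
Lemma icode_gt s i m : i < m -> pval s m < pval s i -> icode s i < icode s m.
Proof.
move=> im smi.
have i_n : i < n.
  rewrite ltnNge; apply/negP => ni; move: smi.
  by rewrite !pval_geq ?ltnn ?(leq_trans ni (ltnW im)).
have -> : (icode s i).+1 = #|[predU1 Ordinal i_n & [pred j : 'I_n |
    (j < i) && (pval s i < s j)]]|.
  by rewrite cardU1 !inE /= ltnn.
apply/subset_leq_card/fintype.subsetP => j; rewrite !inE.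
case/orP => [/eqP -> /=|/andP[ji sj]].
  by rewrite im /= -pval_ord.
by rewrite (ltn_trans ji im) (ltn_trans smi sj).
Qed.

(** In an occurrence [i, j, k] of the pattern the values cross the level of [s i]
    downwards between some [m >= j] and [m.+1 <= k]; then [i] and [m] are both counted
    at [m.+1] on top of everything counted at [m], a jump by two. *)
Lemma icode_avoids231 s :
  (forall i, i.+1 < n -> icode s i.+1 <= (icode s i).+1) -> avoids231 s.
Proof.
move=> step; apply/avoids231P => i j k ij jk ski sij.
have k_n : k < n.
  rewrite ltnNge; apply/negP => nk; move: ski; rewrite pval_geq// ltnNge.
  by rewrite pval_leq.
have [m [jm mk smi smi']] : exists m, [/\ j <= m, m < k, pval s i < pval s m &
    pval s m.+1 < pval s i].
  elim: k jk ski k_n => // k IH; rewrite ltnS => jk ski k_n.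
  have [h|h|h] := ltngtP (pval s k) (pval s i).
  - have jk' : j < k.
      by rewrite ltn_neqAle jk andbT; apply: contraTneq h => <-; rewrite -leqNgt ltnW.
    have [m [? mk ? ?]] := IH jk' h (ltnW k_n).
    by exists m; split=> //; rewrite ltnS ltnW.
  - by exists k.
  - by move: (pval_inj (ltnW k_n) h) => e; move: ij; rewrite -e ltnNge jk.
have m_n : m.+1 < n by apply: leq_ltn_trans mk k_n.
have := step _ m_n; apply/negP; rewrite -ltnNge.
have im : i < m := leq_trans ij jm.
have i_n : i < n := ltn_trans im (ltnW m_n).
have -> : (icode s m).+2 = #|[predU1 Ordinal i_n & [predU1 Ordinal (ltnW m_n) &
    [pred j : 'I_n | (j < m) && (pval s m < s j)]]]|.
  rewrite !cardU1 !inE /= ltnn -pval_ord /= [pval s m < _]ltnNge (ltnW smi) /=.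
  by rewrite andbF orbF eqE /= (ltn_eqF im).
apply/subset_leq_card/fintype.subsetP => l; rewrite !inE.
case/or3P => [/eqP->|/eqP->|/andP[lm sl]] /=; rewrite -?pval_ord /=.
- by rewrite ltnS (ltnW im) smi'.
- by rewrite ltnSn (ltn_trans smi' smi).
- by rewrite ltnS (ltnW lm) (ltn_trans smi') // (ltn_trans smi) // pval_ord.
Qed.

(** Let [e] be the first position after [i] carrying a value above [s i]. Avoiding
    231 keeps all the values after [e] above [s i], so the positions before [e] other
    than [i] split into the [s i] ones with a value below [s i] and the [icode s i]
    ones counted by the code at [i]: this determines [e]. *)
Lemma icode_next s i : avoids231 s -> i < n ->
  let e := (pval s i + icode s i).+1 in
  [/\ i < e, e <= n, forall m, i < m -> m < e -> pval s m < pval s i &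
      forall m, e <= m -> pval s i < pval s m].
Proof.
move=> /avoids231P av i_n.
have ex : exists m, (i < m) && (pval s i < pval s m).
  by exists n; rewrite i_n [pval s n]pval_geq// pval_ltn.
case: (ex_minnP ex) => e /andP[ie se] emin.
have e_n : e <= n by apply: emin; rewrite i_n [pval s n]pval_geq// pval_ltn.
have below m : i < m -> m < e -> pval s m < pval s i.
  move=> im me; rewrite ltn_neqAle leqNgt; apply/andP; split.
    by apply: contraTneq im => /esym /(pval_inj i_n) <-; rewrite ltnn.
  by apply: contraL me => sm; rewrite -leqNgt; apply: emin; rewrite im.
have above m : e <= m -> pval s i < pval s m.
  rewrite leq_eqVlt => /orP[/eqP <-//|em].
  rewrite ltn_neqAle leqNgt; apply/andP; split.
    apply: contraTneq ie => /(pval_inj i_n) ->; rewrite -leqNgt.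
    exact: ltnW.
  by apply/negP => sm; apply: (av _ _ _ ie em).
suff -> : (pval s i + icode s i).+1 = e by [].
have cs : pval s i = #|[pred j : 'I_n | s j < pval s i]|.
  rewrite -[LHS](card_ord_ltn (pval_leq s i)).
  rewrite -(fintype.card_image (@perm_inj _ s) [pred j : 'I_n | s j < pval s i]).
  apply: eq_card => j; apply/idP/fintype.imageP => [|[k]].
    by rewrite inE => h; exists ((s^-1)%g j); rewrite ?inE permKV.
  by rewrite !inE => ? ->.
have -> : pval s i + icode s i = #|[predD1 [pred j : 'I_n | j < e] & Ordinal i_n]|.
  rewrite {1}cs /icode -cardUI addnC (@eq_card0 _ [predI _ & _]); last first.
    by move=> j; rewrite !inE; case: ltngtP; rewrite ?andbF.
  apply: eq_card => j; rewrite !inE -!pval_ord.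
  have -> : (j != Ordinal i_n) = (j != i :> nat) by [].
  case: (ltngtP j i) => [ji|ij|->] /=.
  - rewrite (ltn_trans ji ie); case: ltngtP => // /(pval_inj (ltn_ord _)) h.
    by rewrite h ltnn in ji.
  - rewrite orbF; case: (ltnP j e) => [/(below _ ij) ->//|/above].
    by case: ltngtP.
  - by rewrite ltnn.
have := cardD1 (Ordinal i_n) [pred j : 'I_n | j < e].
by rewrite card_ord_ltn// inE /= ie add1n => <-.
Qed.

(** Nothing between [i] and the next larger value reaches the level of [s i], so
    the indices counted there are already counted at [i]. *)
Lemma icode_next_leq s i m : avoids231 s -> i < n ->
  m = (pval s i + icode s i).+1 -> icode s m <= icode s i.
Proof.
move=> av i_n ->; have := icode_next av i_n.
set e := (pval s i + icode s i).+1 => -[ie en below above].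
apply/subset_leq_card/fintype.subsetP => j; rewrite !inE => /andP[je sj].
have sij := above _ (leqnn e); rewrite (ltn_trans sij sj) andbT.
case: (ltngtP j i) => [//|ij|ji].
- have := below _ ij je; rewrite pval_ord => h.
  by have := ltn_trans (ltn_trans sij sj) h; rewrite ltnn.
- by have := ltn_trans sij sj; rewrite -ji pval_ord ltnn.
Qed.

(** The permutation is decoded from right to left: once the values at the positions
    after [i] are known, [icode s i] is the number of remaining values above [s i]. *)
Lemma icode_inj s t : (forall i, i < n -> icode s i = icode t i) -> s = t.
Proof.
move=> st; suff agree k i : n - k <= i -> pval s i = pval t i.
  apply/permP => i; apply: val_inj => /=; rewrite -!pval_ord.
  by apply: (agree n); rewrite subnn.
elim: k i => [|k IH] i.
  by rewrite subn0 => ni; rewrite !pval_geq.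
move=> ki; case: (ltnP i n) => [i_n|ni]; last by rewrite !pval_geq.
have eqgt m : i < m -> pval s m = pval t m.
  by move=> im; apply: IH; lia.
(* positions up to [i] carry the same set of values in [s] and in [t] *)
pose low (u : 'S_n) (v : 'I_n) := (u^-1)%g v <= i.
have lowE : low s =1 low t.
  move=> v; rewrite /low; apply/idP/idP => h; rewrite leqNgt; apply/negP => lt.
    have := eqgt _ lt; rewrite !pval_ord permKV => /val_inj e.
    by move: h; rewrite -e permK leqNgt lt.
  have := eqgt _ lt; rewrite !pval_ord permKV => /val_inj e.
  by move: h; rewrite e permK leqNgt lt.
have codeE (u : 'S_n) : icode u i = #|[pred v : 'I_n | low u v && (pval u i < v)]|.
  rewrite /icode -(fintype.card_image (@perm_inj _ u)); apply: eq_card => v.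
  apply/fintype.imageP/idP => [[j]|].
    by rewrite !inE => /andP[/ltnW ji sj] ->; rewrite /low permK ji.
  rewrite !inE /low => /andP[h1 h2]; exists ((u^-1)%g v); rewrite ?permKV//.
  rewrite !inE permKV h2 andbT ltn_neqAle h1 andbT.
  by apply: contraTneq h2 => <-; rewrite pval_ord permKV ltnn.
have low_i (u : 'S_n) : low u (u (Ordinal i_n)) by rewrite /low permK /=.
have ne (u w : 'S_n) : low u =1 low w -> pval u i < pval w i ->
    icode w i < icode u i.
  move=> uw lt; rewrite !codeE; apply: proper_card; apply/fintype.properP; split.
    apply/fintype.subsetP => v; rewrite !inE uw => /andP[-> h] /=.
    exact: ltn_trans h.
  exists (w (Ordinal i_n)); rewrite !inE ?uw low_i -pval_ord //=.
  by rewrite ltnn.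
case: (ltngtP (pval s i) (pval t i)) => // lt.
  by have := ne _ _ lowE lt; rewrite st// ltnn.
by have := ne _ _ (fun v => esym (lowE v)) lt; rewrite st// ltnn.
Qed.

(** There are [n`!] functions [c] with [c i <= i], as many as permutations, so the
    injective code reaches them all. *)
Lemma icode_surj (c : 'I_n -> nat) : (forall i : 'I_n, c i <= i) ->
  exists s, forall i : 'I_n, icode s i = c i.
Proof.
move=> ci.
pose code s := [ffun i : 'I_n => inord (icode s i) : 'I_n.+1].
pose F (i : 'I_n) := [pred j : 'I_n.+1 | j < i.+1].
have codeE s (i : 'I_n) : code s i = icode s i :> nat.
  by rewrite ffunE inordK// ltnS (leq_trans (icode_leq s i))// ltnW.
have code_inj : injective code.
  move=> s t /ffunP st; apply: icode_inj => i i_n.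
  by have /(congr1 (@nat_of_ord _)) := st (Ordinal i_n); rewrite /= !codeE.
have code_fam : codom code \subset family F.
  apply/fintype.subsetP => f /codomP[s ->]; apply/familyP => i.
  by rewrite inE codeE ltnS icode_leq.
have card_F : #|family F| = n`!.
  rewrite card_family fact_prod foldrE big_map big_enum /= big_add1 /= big_mkord.
  apply: eq_bigr => i _.
  rewrite -sum1_card -(big_ord_widen _ (fun=> 1)) ?sum1_card ?card_ord//.
  by rewrite ltnS ltnW.
have /subset_leqif_card[_] := code_fam.
rewrite card_codom// card_F card_Sn eqxx => /esym/fintype.subsetP sub.
pose f := [ffun i : 'I_n => inord (c i) : 'I_n.+1].
have fE (i : 'I_n) : f i = c i :> nat.
  by rewrite ffunE inordK// ltnS (leq_trans (ci i))// ltnW.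
have /sub/codomP[s sf] : f \in family F.
  by apply/familyP => i; rewrite inE fE ltnS ci.
by exists s => i; rewrite -codeE -sf fE.
Qed.

End inversion_code.

(** * Weights of integer sequences with a prescribed total *)

Section bridge_weights.
Variable R : realFieldType.
Implicit Types (x : nat -> R) (n m N : nat).

(** Sequences of [n] geometric steps, the step [j] having ratio [x j]; steps are
    truncated at [N] so that the sequences form a finite type. *)
Definition fweight x n N (f : {ffun 'I_n -> 'I_N.+1}) : R := \prod_(j < n) x j ^+ f j.

Definition ftotal n N (f : {ffun 'I_n -> 'I_N.+1}) : nat := (\sum_(j < n) f j)%N.

(** The complete homogeneous symmetric polynomial of degree [m] in the first [n]
    variables, that is, the weight of all untruncated sequences of total [m]. *)
Fixpoint hsym x n m : R := if n is n'.+1 then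
  \sum_(l < m.+1) x n' ^+ l * hsym x n' (m - l) else (m == 0%N)%:R.

Lemma hsym0r x n : hsym x n 0 = 1.
Proof. by elim: n => //= n IH; rewrite big_ord1 expr0 mul1r subnn. Qed.

Lemma hsymS x n m :
  hsym x n.+1 m.+1 = hsym x n m.+1 + x n * hsym x n.+1 m.
Proof.
rewrite /= big_ord_recl expr0 mul1r subn0; congr (_ + _).
rewrite big_distrr /=; apply: eq_bigr => l _.
by rewrite mulrA -exprS.
Qed.

Lemma hsym_ge0 x n m : (forall j, 0 <= x j) -> 0 <= hsym x n m.
Proof.
move=> x0; elim: n m => [|n IH] m /=; first exact: ler0n.
by apply: sumr_ge0 => l _; rewrite mulr_ge0// exprn_ge0.
Qed.

Lemma fweight_sum x n N :
  \sum_(f : {ffun 'I_n -> 'I_N.+1}) fweight x f =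
  \prod_(j < n) \sum_(l < N.+1) x j ^+ l.
Proof. by rewrite bigA_distr_bigA. Qed.

Let gf x n N : {poly R} := \prod_(j < n) \poly_(l < N.+1) x j ^+ l.

Let gf_coef x n N m : \sum_(f : {ffun 'I_n -> 'I_N.+1} | ftotal f == m)
  fweight x f = (gf x n N)`_m.
Proof.
have -> : gf x n N = \prod_(j < n) \sum_(l < N.+1) x j ^+ l *: 'X^l.
  by apply: eq_bigr => j _; rewrite poly_def.
rewrite bigA_distr_bigA coef_sum big_mkcond; apply: eq_bigr => f _.
rewrite scaler_prod prodrXr coefZ coefXn -/(ftotal f) eq_sym.
by case: eqP => _; rewrite (mulr1, mulr0).
Qed.

Let gf_hsym x n N m : (forall j, 0 <= x j) ->
  0 <= (gf x n N)`_m /\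
  if (m <= N)%N then (gf x n N)`_m = hsym x n m else (gf x n N)`_m <= hsym x n m.
Proof.
move=> x0; elim: n m => [|n IH] m.
  by rewrite /gf big_ord0 coef1 /= ler0n; case: ifP.
have E : (gf x n.+1 N)`_m = \sum_(l < m.+1)
    (if (l < N.+1)%N then x n ^+ l else 0) * (gf x n N)`_(m - l).
  rewrite {1}/gf big_ord_recr /= coefMr; apply: eq_bigr => l _.
  by rewrite coef_poly mulrC.
rewrite E; split.
  apply: sumr_ge0 => l _; rewrite mulr_ge0 ?(IH _).1//.
  by case: ifP => _ //; rewrite exprn_ge0.
case: ifP => mN /=.
  apply: eq_bigr => l _; have lm : (l <= m)%N by rewrite -ltnS.
  rewrite ltnS (leq_trans lm mN); congr (_ * _).
  by have [_] := IH (m - l)%N; rewrite (leq_trans (leq_subr _ _) mN).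
apply: ler_sum => l _; case: ifP => lN; last first.
  by rewrite mul0r mulr_ge0 ?exprn_ge0// hsym_ge0.
rewrite ler_wpM2l ?exprn_ge0//.
by have [_] := IH (m - l)%N; case: ifP => _ // ->.
Qed.

Lemma fweight_total_hsym x n N m : (forall j, 0 <= x j) -> (m <= N)%N ->
  \sum_(f : {ffun 'I_n -> 'I_N.+1} | ftotal f == m) fweight x f = hsym x n m.
Proof. by move=> x0 mN; rewrite gf_coef; have [_] := gf_hsym n N m x0; rewrite mN. Qed.

Lemma fweight_total_le_hsym x n N m : (forall j, 0 <= x j) ->
  \sum_(f : {ffun 'I_n -> 'I_N.+1} | ftotal f == m) fweight x f <= hsym x n m.
Proof.
by move=> x0; rewrite gf_coef; have [_] := gf_hsym n N m x0; case: ifP => _ // ->.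
Qed.

Lemma ftotal_le n N (f : {ffun 'I_n -> 'I_N.+1}) : (ftotal f <= n * N)%N.
Proof.
rewrite -[n in (n * N)%N]card_ord -sum_nat_const; apply: leq_sum => j _.
by rewrite -ltnS.
Qed.

(** The total of a truncated sequence takes at most [n * N + 1] values. *)
Lemma fweight_sum_le x n N C : (forall j, 0 <= x j) ->
  (forall m, hsym x n m <= C) ->
  \prod_(j < n) \sum_(l < N.+1) x j ^+ l <= (n * N).+1%:R * C.
Proof.
move=> x0 hC; rewrite -fweight_sum.
rewrite (partition_big (fun f => inord (ftotal f) : 'I_(n * N).+1) xpredT)//=.
rewrite mulr_natl -[X in _ *+ X]card_ord -sumr_const; apply: ler_sum => m _.
apply: le_trans (hC m); apply: le_trans (fweight_total_le_hsym n N m x0).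
rewrite le_eqVlt; apply/orP; left; apply/eqP; apply: eq_bigl => f.
by rewrite -val_eqE /= inordK// ltnS ftotal_le.
Qed.

Section geometric_weights.
Variables (q lam : R).
Let x (j : nat) := lam * q ^+ j.+1.
Let qn m : R := \sum_(i < m) q ^+ i.

(** When the variables form a geometric progression, [hsym] is a monomial times a
    Gaussian binomial coefficient. *)
Lemma hsym_ratio n m :
  qn m.+1 * hsym x n m.+1 = lam * q * qn (n + m) * hsym x n m.
Proof.
have qnS k : qn k.+1 = qn k + q ^+ k by rewrite /qn big_ord_recr.
elim: n m => [|n IHn] m.
  rewrite /= mulr0; case: m => [|m]; last by rewrite mulr0.
  by rewrite /qn big_ord0 mulr0 mul0r.
elim: m => [|m IHm].
  have qn1 : qn 1 = 1 by rewrite /qn big_ord1 expr0.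
  rewrite hsymS mulrDr IHn !hsym0r !mulr1 !addn0 (qnS n) qn1 mul1r /x exprS; ring.
rewrite hsymS mulrDr IHn.
have <- : hsym x n.+1 m.+1 - x n * hsym x n.+1 m = hsym x n m.+1.
  by rewrite hsymS addrK.
rewrite mulrBr.
have -> : lam * q * qn (n + m.+1) * (x n * hsym x n.+1 m) =
    x n * (lam * q * qn (n.+1 + m) * hsym x n.+1 m).
  by rewrite addnS addSn; ring.
rewrite -IHm addSn (qnS (n + m.+1)%N) (qnS m.+1) /x exprD exprS; ring.
Qed.

Hypotheses (q1 : 1 <= q) (n : nat) (n0 : (0 < n)%N) (lamE : lam * (1 + q ^+ n) = 1).

Let q0 : 0 < q. Proof. exact: lt_le_trans q1. Qed.

Let lam0 : 0 < lam.
Proof.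
have h : 0 < 1 + q ^+ n by rewrite addr_gt0// exprn_gt0.
by rewrite -(pmulr_lgt0 _ h) lamE.
Qed.

Let x0 j : 0 <= x j. Proof. by rewrite mulr_ge0 ?exprn_ge0// ltW. Qed.

Let qn_mono i j : (i <= j)%N -> qn i <= qn j.
Proof.
move=> ij; rewrite /qn -!(big_mkord xpredT (fun i => q ^+ i)).
rewrite (big_cat_nat (leq0n i) ij) /= lerDl.
by apply: sumr_ge0 => k _; rewrite exprn_ge0// ltW.
Qed.

Let qn_ge1 i : (0 < i)%N -> 1 <= qn i.
Proof. by move=> /qn_mono; rewrite {1}/qn big_ord1 expr0. Qed.

Let hsym_ratio' m :
  qn m.+1 * hsym x n m.+1 = (qn m.+1 + lam * (qn n - 1 - qn m.+1)) * hsym x n m.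
Proof.
rewrite hsym_ratio; congr (_ * _).
have -> : lam * q * qn (n + m) = lam * (qn (n + m).+1 - 1).
  rewrite -mulrA; congr (_ * _).
  rewrite /qn [in RHS]big_ord_recl expr0 [RHS]addrC addKr big_distrr /=.
  by apply: eq_bigr => i _; rewrite exprS.
have -> : qn (n + m).+1 = qn n + q ^+ n * qn m.+1.
  rewrite -addnS /qn big_split_ord /= big_distrr; congr (_ + _).
  by apply: eq_bigr => i _; rewrite exprD.
have : lam * (1 + q ^+ n) * qn m.+1 = qn m.+1 by rewrite lamE mul1r.
lra.
Qed.

(** For [lam = (1 + q ^+ n)^-1], [hsym_ratio] makes the sequence [hsym x n] increase
    up to the index [n - 1] and decrease afterwards, with a ratio at least [1 / 2]
    between the terms of indices [n] and [n - 1]. Hence the total [n] is nearly the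
    most likely one. *)
Lemma hsym_mode m : hsym x n m <= 2 * hsym x n n.
Proof.
have qp i : 0 < qn i.+1 by rewrite (lt_le_trans ltr01)// qn_ge1.
have h0 i : 0 <= hsym x n i by exact: hsym_ge0.
have down i : (n.-1 <= i)%N -> hsym x n i.+1 <= hsym x n i.
  move=> ni; rewrite -(ler_pM2l (qp i)) hsym_ratio' ler_wpM2r//.
  rewrite gerDl pmulr_rle0// subr_le0 lerBlDr.
  have /qn_mono : (n <= i.+1)%N by lia.
  lra.
have up i : (i.+1 < n)%N -> hsym x n i <= hsym x n i.+1.
  move=> i_n; rewrite -(ler_pM2l (qp i)) hsym_ratio' ler_wpM2r//.
  rewrite lerDl pmulr_rge0// subr_ge0 lerBrDr.
  apply: le_trans (_ : qn i.+2 <= _); last exact: qn_mono.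
  rewrite [leRHS]/qn big_ord_recr /= lerD2l exprn_ege1//.
have mode : hsym x n n.-1 <= 2 * hsym x n n.
  have := hsym_ratio' n.-1; rewrite prednK// => E.
  have qn1 := qn_ge1 n0.
  rewrite -(ler_pM2l (lt_le_trans ltr01 qn1)) mulrCA E mulrA ler_wpM2r//.
  have : lam * 2 <= 1.
    have : 0 <= lam * (q ^+ n - 1) by rewrite mulr_ge0 ?(ltW lam0)// subr_ge0 exprn_ege1.
    move: lamE; lra.
  lra.
apply: le_trans mode.
have [nm|mn] := leqP n.-1 m.
  elim: m nm => [|m IH]; first by rewrite leqn0 => /eqP ->.
  rewrite leq_eqVlt => /orP[/eqP <-//|nm].
  by apply: le_trans (IH nm); apply: down.
suff: forall k, (m <= k)%N -> (k < n)%N -> hsym x n m <= hsym x n k.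
  by apply; [exact: ltnW|rewrite prednK].
elim=> [|k IH]; first by rewrite leqn0 => /eqP ->.
rewrite leq_eqVlt => /orP[/eqP <-//|mk] kn.
exact: le_trans (IH mk (ltnW kn)) (up _ kn).
Qed.

End geometric_weights.
End bridge_weights.

(** * The cycle lemma *)

Section cycle_lemma.
Local Open Scope nat_scope.
Variable n : nat.
Implicit Types (f g : {ffun 'I_n -> 'I_n.+1}).

Definition psum f i : nat := \sum_(j < n | j < i) f j.

Definition dyck f : bool := (ftotal f == n) && [forall i : 'I_n, psum f i <= i].

(** The exponent of [q] in the weight of [f] when [x j = lam * q ^+ j.+1]. *)
Definition moment f : nat := \sum_(j < n) j.+1 * f j.

Lemma psum0 f : psum f 0 = 0.
Proof. by rewrite /psum big_pred0. Qed.

Lemma psumS f (i : 'I_n) : psum f i.+1 = psum f i + f i.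
Proof.
rewrite /psum (bigD1 i) ?ltnSn//= addnC; congr (_ + _); apply: eq_bigl => j.
by rewrite ltnS -(inj_eq val_inj) andbC -ltn_neqAle.
Qed.

Lemma psum_n f : psum f n = ftotal f.
Proof. by apply: eq_bigl => j; rewrite ltn_ord. Qed.

(** Summation by parts. *)
Lemma moment_psum f : moment f + \sum_(i < n) psum f i = n * ftotal f.
Proof.
rewrite /psum (exchange_big_dep xpredT)//= -big_split /= /ftotal big_distrr /=.
apply: eq_bigr => j _; rewrite sum_nat_const -mulnDl; congr (_ * _).
rewrite -[RHS]card_ord -(cardC [pred i : 'I_n | i < j.+1]).
rewrite card_ord_ltn//; congr (_ + _); apply: eq_card => i.
by rewrite !inE -leqNgt.
Qed.

End cycle_lemma.

Section rotation.
Local Open Scope nat_scope.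
Variable n' : nat.
Local Notation n := n'.+1.
Implicit Types (f g : {ffun 'I_n -> 'I_n.+1}) (s : 'I_n).

(** The [n]-periodic extension of [f]; [ksum] are its partial sums. *)
Definition ext f j : nat := f (inord (j %% n)).
Definition ksum f i : nat := \sum_(0 <= j < i) ext f j.

Definition rotf s f : {ffun 'I_n -> 'I_n.+1} :=
  [ffun j : 'I_n => f (inord ((s + j) %% n))].

Let psum_ksum f i : i <= n -> psum f i = ksum f i.
Proof.
move=> i_n; rewrite /ksum big_mkord (big_ord_widen n (ext f) i_n).
by apply: eq_bigr => j _; rewrite /ext modn_small// inord_val.
Qed.

Let ksum_split f i m : ksum f (i + m) = ksum f i + \sum_(0 <= j < m) ext f (i + j).
Proof.
rewrite /ksum (big_cat_nat (leq0n i) (leq_addr m i)) /=; congr (_ + _).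
by rewrite -{1}[i]add0n big_addn addKn; apply: eq_bigr => j _; rewrite addnC.
Qed.

Let ksum_n f i : ksum f (n + i) = ksum f n + ksum f i.
Proof.
by rewrite ksum_split; congr (_ + _); apply: eq_bigr => j _; rewrite /ext modnDl.
Qed.

Let ext_rotf s f j : ext (rotf s f) j = ext f (s + j).
Proof. by rewrite /ext ffunE inordK ?ltn_pmod// modnDmr. Qed.

Let ksum_rotf s f i : ksum f s + ksum (rotf s f) i = ksum f (s + i).
Proof.
by rewrite ksum_split; congr (_ + _); apply: eq_bigr => j _; rewrite ext_rotf.
Qed.

Lemma rotf_inj s : injective (rotf s).
Proof.
move=> f g /ffunP fg; apply/ffunP => j.
have := fg (inord ((j + (n - s)) %% n)); rewrite !ffunE inordK ?ltn_pmod//.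
have -> : (s + (j + (n - s)) %% n) %% n = j.
  rewrite modnDmr addnCA subnKC ?(ltnW (ltn_ord s))// modnDr modn_small//.
by rewrite inord_val.
Qed.

Lemma ftotal_rotf s f : ftotal (rotf s f) = ftotal f.
Proof.
rewrite -!psum_n !psum_ksum//; apply/eqP.
by rewrite -(eqn_add2l (ksum f s)) ksum_rotf addnC ksum_n addnC.
Qed.

(** Let [s] be the index minimising [i - ksum f i]. Read from [s] on, the partial
    sums never exceed their index. They are also smaller on average than those of
    [f], so by summation by parts the moment has not decreased. *)
Lemma dyck_rotf f : ftotal f = n ->
  exists s, dyck (rotf s f) /\ moment f <= moment (rotf s f).
Proof.
move=> fn; have kn : ksum f n = n by rewrite -psum_ksum// psum_n.
have kle i : i <= n -> ksum f i <= n.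
  by move=> i_n; have := ksum_split f i (n - i); rewrite subnKC// kn => ->; rewrite leq_addr.
pose D (i : 'I_n) := i + n - ksum f i.
have [s _ smin] := @arg_minnP _ ord0 xpredT D isT; exists s.
have sle i : i < n -> s + ksum f i <= i + ksum f s.
  move=> i_n; have := smin (Ordinal i_n) isT; rewrite /D /=.
  move: (kle i (ltnW i_n)) (kle s (ltnW (ltn_ord s))).
  lia.
have s_n := ltn_ord s.
split.
  rewrite /dyck ftotal_rotf fn eqxx /=; apply/forallP => i; have i_n := ltn_ord i.
  rewrite (psum_ksum _ (ltnW i_n)); have := ksum_rotf s f i.
  have [lt|ge] := ltnP (s + i) n.
    have := sle _ lt; lia.
  have e : s + i = n + (s + i - n) by lia.
  have lt : s + i - n < n by lia.
  rewrite e ksum_n kn; have := sle _ lt; lia.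
suff : \sum_(i < n) psum (rotf s f) i <= \sum_(i < n) psum f i.
  have := moment_psum f; have := moment_psum (rotf s f); rewrite ftotal_rotf; lia.
have shift m : \sum_(0 <= i < n) ksum f (m + i) =
    \sum_(0 <= i < n) ksum f i + n * m.
  elim: m => [|m IH]; first by rewrite muln0 addn0.
  have e : \sum_(0 <= i < n.+1) ksum f (m + i) =
      \sum_(0 <= i < n) ksum f (m + i) + ksum f (m + n) by rewrite big_nat_recr.
  have e' : \sum_(0 <= i < n.+1) ksum f (m + i) =
      ksum f m + \sum_(0 <= i < n) ksum f (m.+1 + i).
    rewrite big_nat_recl//= addn0; congr (_ + _).
    by apply: eq_bigr => i _; rewrite addnS.
  have := ksum_n f m; rewrite kn [n + m]addnC; lia.
have := shift s; rewrite !big_mkord.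
under eq_bigr do rewrite -ksum_rotf.
rewrite big_split /= sum_nat_const card_ord.
rewrite (eq_bigr (fun i : 'I_n => psum (rotf s f) i)); last first.
  by move=> i _; rewrite psum_ksum// ltnW.
rewrite [in RHS](eq_bigr (fun i : 'I_n => psum f i)); last first.
  by move=> i _; rewrite psum_ksum// ltnW.
have := sle 0 isT; rewrite {1}/ksum big_geq// addn0 add0n => h.
have : n * s <= n * ksum f s by rewrite leq_mul2l h orbT.
lia.
Qed.

End rotation.

Section cycle_lemma_weights.
Variables (R : realFieldType) (q lam : R).
Hypotheses (q1 : 1 <= q) (lam0 : 0 <= lam).
Let x (j : nat) := lam * q ^+ j.+1.

Lemma fweight_moment n (f : {ffun 'I_n -> 'I_n.+1}) :
  fweight x f = lam ^+ ftotal f * q ^+ moment f.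
Proof.
rewrite /fweight /x; under eq_bigr do rewrite exprMn -exprM.
by rewrite big_split /= !prodrXr.
Qed.

(** For [q >= 1] a sequence of total [n] weighs at most as much as one of its Dyck
    rotations, and a Dyck sequence has at most [n] rotations. *)
Lemma bridge_le_dyck n : (0 < n)%N ->
  \sum_(f : {ffun 'I_n -> 'I_n.+1} | ftotal f == n) fweight x f <=
  n%:R * \sum_(f : {ffun 'I_n -> 'I_n.+1} | dyck f) fweight x f.
Proof.
case: n => [//|n] _.
have w0 (f : {ffun 'I_n.+1 -> 'I_n.+2}) : 0 <= fweight x f.
  by apply: prodr_ge0 => j _; rewrite exprn_ge0// mulr_ge0// exprn_ge0// (le_trans ler01).
apply: le_trans (_ : \sum_(f : {ffun 'I_n.+1 -> 'I_n.+2} | ftotal f == n.+1)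
    \sum_(s < n.+1 | dyck (rotf s f)) fweight x (rotf s f) <= _).
  apply: ler_sum => f /eqP fn; have [s [ds ms]] := dyck_rotf fn.
  rewrite (bigD1 s)//= -[leLHS]addr0 lerD ?sumr_ge0//.
  by rewrite !fweight_moment ftotal_rotf ler_wpM2l ?exprn_ge0// ler_weXn2l.
rewrite (exchange_big_dep xpredT)//= mulr_natl -[X in _ *+ X]card_ord -sumr_const.
apply: ler_sum => s _.
rewrite [leRHS](reindex_inj (@rotf_inj _ s)) /= le_eqVlt; apply/orP; left.
apply/eqP/eq_bigl => f; rewrite /dyck ftotal_rotf.
by case: eqP.
Qed.

End cycle_lemma_weights.

Section step_code.
Variable n : nat.
Implicit Types s : 'S_n.

(** The defect of the step of the code at [j] with respect to the maximal increase
    [1]. *)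
Definition steps s : {ffun 'I_n -> 'I_n.+1} :=
  [ffun j : 'I_n => inord ((icode s j).+1 - icode s j.+1)].

Lemma psum_steps s i : avoids231 s -> (i <= n)%N ->
  (psum (steps s) i + icode s i = i)%N.
Proof.
move=> av; elim: i => [|i IH] i_n.
  by rewrite psum0; have := icode_leq s 0; rewrite leqn0 => /eqP ->.
rewrite (psumS (steps s) (Ordinal i_n)) ffunE inordK /=; last first.
  have := icode_leq s i; lia.
have := IH (ltnW i_n); have := icode_step i av; lia.
Qed.

Lemma ftotal_steps s : avoids231 s -> ftotal (steps s) = n.
Proof. by move=> av; have := psum_steps av (leqnn n); rewrite icode_n psum_n addn0. Qed.

Lemma moment_steps s : avoids231 s ->
  (moment (steps s) + \sum_(i < n) i = n * n + inv_num s)%N.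
Proof.
move=> av; have := moment_psum (steps s); rewrite ftotal_steps// => <-.
rewrite -addnA; congr (_ + _)%N; rewrite inv_num_icode -big_split /=.
by apply: eq_bigr => i _; rewrite psum_steps// ltnW.
Qed.

(** The steps are a bijection from 231-avoiding permutations to Dyck sequences: by
    [icode_step] and [icode_avoids231] the codes [d] of these permutations are
    characterised by [0 <= d i.+1 <= (d i).+1], [d 0 = 0] and [d n = 0], and the
    partial sums of the steps are [i - d i]. *)
Lemma sum_avoids231_dyck (R : realFieldType) (G : {ffun 'I_n -> 'I_n.+1} -> R) :
  \sum_(s : 'S_n | avoids231 s) G (steps s) = \sum_(f | dyck f) G f.
Proof.
rewrite (eq_bigl (fun s => s \in [set s : 'S_n | avoids231 s]%SET)); last by move=> s; rewrite inE.
rewrite -(big_imset G) /=; last first.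
  move=> s t; rewrite !inE => avs avt e; apply: icode_inj => i i_n.
  have := psum_steps avs (ltnW i_n); have := psum_steps avt (ltnW i_n).
  rewrite e; lia.
apply: eq_bigl => f; apply/imsetP/idP => [[s]|].
  rewrite inE => av ->; rewrite /dyck ftotal_steps// eqxx; apply/forallP => i.
  by have := psum_steps av (ltnW (ltn_ord i)); lia.
move=> /andP[/eqP fn /forallP fd].
have [s sE] : exists s, forall i : 'I_n, icode s i = (i - psum f i)%N.
  by apply: icode_surj => i; exact: leq_subr.
have sE' i : (i <= n)%N -> (icode s i + psum f i = i)%N.
  rewrite leq_eqVlt => /orP[/eqP ->|i_n]; first by rewrite icode_n psum_n.
  by rewrite (sE (Ordinal i_n)) /= subnK//; exact: (fd (Ordinal i_n)).
have av : avoids231 s.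
  apply: icode_avoids231 => i i_n; have := sE' _ (ltnW i_n).
  have := sE' i (ltnW (ltnW i_n)); rewrite (psumS f (Ordinal (ltnW i_n))) /=; lia.
exists s; first by rewrite inE.
apply/ffunP => j; apply: val_inj => /=.
have := psumS f j; have := psumS (steps s) j.
have jn := ltn_ord j.
have := psum_steps av jn; have := psum_steps av (ltnW jn).
have := sE' _ jn; have := sE' _ (ltnW jn).
lia.
Qed.

End step_code.

(** * Exponential bounds for tilted geometric steps *)

Section exponential_bounds.
Variable R : realType.
Implicit Types (t u x : R).

Lemma expR_le_quad t : t <= 2^-1 -> expR t <= 1 + t + 2 * t ^+ 2.
Proof.
move=> t2; have h : 0 < 1 - t by lra.
rewrite -(ler_pM2l h); apply: (@le_trans _ _ 1).
  rewrite -[leRHS](expRxMexpNx_1 t) mulrC ler_wpM2l ?expR_ge0//.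
  by rewrite -[leLHS]/(1 + - t) expR_ge1Dx.
have : 0 <= t ^+ 2 * (1 - 2 * t) by rewrite mulr_ge0 ?sqr_ge0//; lra.
rewrite !expr2; lra.
Qed.

Lemma inv_1subr_le_expR u : u <= 2^-1 -> (1 - u)^-1 <= expR (u + 2 * u ^+ 2).
Proof.
move=> u2; have h : 0 < 1 - u by lra.
rewrite -(ler_pM2l h) divff ?gt_eqF//.
apply: le_trans (_ : (1 - u) * (1 + (u + 2 * u ^+ 2)) <= _); last first.
  by rewrite ler_wpM2l ?(ltW h)// expR_ge1Dx.
have : 0 <= u ^+ 2 * (1 - 2 * u) by rewrite mulr_ge0 ?sqr_ge0//; lra.
rewrite !expr2; lra.
Qed.

(** The moment generating function of a geometric variable of ratio [x] is
    sub-Gaussian near [0], uniformly in [x <= rho]; here [x / (1 - x)] is the mean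
    and [M] bounds the means. *)
Lemma geometric_mgf_le (rho x t : R) (M := rho / (1 - rho)) :
  0 <= x -> x <= rho -> 0 < rho -> rho < 1 -> `|t| <= 2^-1 -> `|t| <= (4 * M)^-1 ->
  0 < 1 - x * expR t /\
  (1 - x * expR t)^-1 <=
    (1 - x)^-1 * expR (x / (1 - x) * t + (2 * M + 8 * M ^+ 2) * t ^+ 2).
Proof.
move=> x0 xr r0 r1 t2 tM.
have M0 : 0 < M by rewrite divr_gt0// subr_gt0.
have x1 : 0 < 1 - x by lra.
set a := x / (1 - x).
have a0 : 0 <= a by rewrite divr_ge0// ltW.
have aM : a <= M.
  rewrite /a /M ler_pdivrMr// mulrAC ler_pdivlMr ?subr_gt0//; nra.
have tle : t <= `|t| by exact: ler_norm.
have t_half : t <= 2^-1 by lra.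
have ge := expR_ge1Dx t; have le := expR_le_quad t_half.
set u := a * (expR t - 1).
have tt : `|t| ^+ 2 = t ^+ 2 by rewrite real_normK ?num_real.
have absle : `|expR t - 1| <= 2 * `|t|.
  have tn : - t <= `|t| by rewrite -normrN ler_norm.
  have : `|t| ^+ 2 <= `|t| * 2^-1 by rewrite expr2 ler_wpM2l.
  rewrite tt => h; rewrite ler_norml; apply/andP; split; lra.
have t4 : 4 * M * `|t| <= 1.
  have M4 : 0 < 4 * M by rewrite mulr_gt0.
  by move: tM; rewrite -[(4 * M)^-1]mul1r ler_pdivlMr// mulrC.
have absu : `|u| <= 2 * M * `|t|.
  rewrite normrM (ger0_norm a0); apply: le_trans (ler_pM _ _ aM absle) _ => //.
  by rewrite mulrCA mulrA.
have u2 : u <= 2^-1 by have := ler_norm u; lra.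
have E : 1 - x * expR t = (1 - x) * (1 - u).
  by rewrite /u /a; field; rewrite gt_eqF.
split; first by rewrite E mulr_gt0//; lra.
rewrite E invfM ler_wpM2l ?invr_ge0 ?(ltW x1)//.
apply: le_trans (inv_1subr_le_expR u2) _; rewrite ler_expR.
have uu : u ^+ 2 <= 4 * M ^+ 2 * t ^+ 2.
  rewrite -[u ^+ 2]real_normK ?num_real//.
  have : `|u| ^+ 2 <= (2 * M * `|t|) ^+ 2 by rewrite ler_pXn2r ?nnegrE// mulr_ge0// mulr_ge0// ltW.
  by rewrite !exprMn tt; lra.
have : u <= a * t + 2 * M * t ^+ 2.
  apply: le_trans (_ : a * (t + 2 * t ^+ 2) <= _).
    by rewrite ler_wpM2l//; lra.
  by rewrite mulrDr lerD2l mulrCA mulrA ler_wpM2r ?sqr_ge0//; lra.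
lra.
Qed.

Lemma expR_absorb (c : R) (K : R) (k : nat) : 0 < c ->
  exists N : nat, forall n : nat, (N <= n)%N -> K * n%:R ^+ k <= expR (c * n%:R).
Proof.
move=> c0; pose b := c / k.+1%:R.
have b0 : 0 < b by rewrite divr_gt0.
exists (Num.bound (K / b ^+ k.+1)) => n Nn.
have nK : K / b ^+ k.+1 <= n%:R.
  apply: le_trans (_ : (Num.bound (K / b ^+ k.+1))%:R <= _); last by rewrite ler_nat.
  have [h|h] := lerP 0 (K / b ^+ k.+1); first by rewrite ltW// archi_boundP.
  by rewrite (le_trans (ltW h)).
have -> : c * n%:R = k.+1%:R * (b * n%:R).
  by rewrite /b mulrA mulrCA divff ?pnatr_eq0// mulr1.
rewrite expRM_natl.
apply: le_trans (_ : (b * n%:R) ^+ k.+1 <= _); last first.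
  rewrite ler_pXn2r ?nnegrE ?expR_ge0 ?mulr_ge0 ?(ltW b0) ?(ltW c0) ?invr_ge0//.
  by apply: le_trans (expR_ge1Dx _); rewrite lerDr.
rewrite exprMn [n%:R ^+ k.+1]exprS mulrA ler_wpM2r ?exprn_ge0//.
by rewrite mulrC -ler_pdivrMr// exprn_gt0.
Qed.

End exponential_bounds.

Section tilted_weights.
Variables (R : realType).
Implicit Types (beta : R).

(** The weight of a Dyck sequence depends on [lam] only through the constant
    factor [lam ^+ n], so [lam] is free. With this choice the mean partial sums
    of the steps run from [0] to [n], up to a bounded error, and reaching the
    total [n] is a typical event. *)
Definition lam231 beta : R := (1 + expR beta)^-1.

(** The ratio of the geometric step at position [j]. *)
Definition tilt beta (n j : nat) : R := lam231 beta * expR (beta / n%:R) ^+ j.+1.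

Definition tilt_mean beta (n j : nat) : R := tilt beta n j / (1 - tilt beta n j).

Lemma expR_divn beta n k : expR (beta / n%:R) ^+ k = expR (beta * (k%:R / n%:R)).
Proof. by rewrite -expRM_natl; congr expR; rewrite mulrCA. Qed.

Lemma tiltE beta n j : tilt beta n j = lam231 beta * expR (beta * (j.+1%:R / n%:R)).
Proof. by rewrite /tilt expR_divn. Qed.

Lemma lam231_gt0 beta : 0 < lam231 beta.
Proof. by rewrite invr_gt0 addr_gt0 ?expR_gt0. Qed.

Lemma tilt_gt0 beta n j : 0 < tilt beta n j.
Proof. by rewrite mulr_gt0 ?lam231_gt0// exprn_gt0// expR_gt0. Qed.

Definition tilt_max beta : R := lam231 beta * expR beta.

Lemma tilt_max_gt0 beta : 0 < tilt_max beta.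
Proof. by rewrite mulr_gt0 ?lam231_gt0 ?expR_gt0. Qed.

Lemma tilt_max_lt1 beta : tilt_max beta < 1.
Proof.
by rewrite /tilt_max mulrC ltr_pdivrMr ?addr_gt0 ?expR_gt0// mul1r ltrDr.
Qed.

Lemma tilt_le beta n j : 0 <= beta -> (j < n)%N -> tilt beta n j <= tilt_max beta.
Proof.
move=> b0 jn; rewrite tiltE ler_wpM2l ?(ltW (lam231_gt0 _))// ler_expR.
rewrite ler_piMr// ler_pdivrMr ?mul1r ?ler_nat// ltr0n.
exact: leq_trans jn.
Qed.

(** By [moment_steps] the inversion number is, up to a constant, the moment of the
    steps. *)
Lemma mallows_weight_fweight beta n (s : 'S_n) : avoids231 s ->
  mallows_weight beta s = expR (beta / n%:R) ^+ (\sum_(i < n) i)%N /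
    (expR (beta / n%:R) ^+ (n * n) * lam231 beta ^+ n) *
    fweight (tilt beta n) (steps s).
Proof.
move=> av; rewrite fweight_moment ftotal_steps// /mallows_weight.
set q := expR (beta / n%:R).
have -> : expR (beta / n%:R * (inv_num s)%:R) = q ^+ inv_num s.
  by rewrite mulrC expRM_natl.
have q0 : q != 0 by rewrite gt_eqF ?expR_gt0.
have l0 : lam231 beta ^+ n != 0 by rewrite expf_neq0// gt_eqF ?lam231_gt0.
apply: (mulfI (expf_neq0 (n * n) q0)); rewrite -exprD -moment_steps// exprD.
by field; rewrite l0 expf_neq0.
Qed.

(** The conditioned Mallows law is the law of independent tilted geometric steps
    conditioned to form a Dyck sequence. *)
Lemma mallows231_pmf_sum beta n (B : pred 'S_n)
    (G : pred {ffun 'I_n -> 'I_n.+1}) :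
  (forall s, avoids231 s -> B s -> G (steps s)) ->
  \sum_(s | B s) mallows231_pmf beta s <=
  (\sum_(f : {ffun 'I_n -> 'I_n.+1} | dyck f && G f) fweight (tilt beta n) f) /
  \sum_(f : {ffun 'I_n -> 'I_n.+1} | dyck f) fweight (tilt beta n) f.
Proof.
move=> BG; set q := expR (beta / n%:R).
set W := q ^+ (\sum_(i < n) i)%N / (q ^+ (n * n) * lam231 beta ^+ n).
have W0 : 0 < W.
  by rewrite divr_gt0 ?mulr_gt0 ?exprn_gt0 ?expR_gt0// lam231_gt0.
have ZE : mallows231_Z beta n =
    W * \sum_(f : {ffun 'I_n -> 'I_n.+1} | dyck f) fweight (tilt beta n) f.
  rewrite -sum_avoids231_dyck /mallows231_Z big_distrr; apply: eq_bigr => s av.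
  exact: mallows_weight_fweight.
have w0 (f : {ffun 'I_n -> 'I_n.+1}) : 0 <= fweight (tilt beta n) f.
  by apply: prodr_ge0 => j _; rewrite exprn_ge0// ltW// tilt_gt0.
rewrite [X in X / _]big_mkcondr -sum_avoids231_dyck mulr_suml.
rewrite big_mkcond [leRHS]big_mkcond; apply: ler_sum => s _.
rewrite /mallows231_pmf; case: ifP => [Bs|_]; last first.
  case: ifP => // _; rewrite divr_ge0//; first by case: ifP.
  by rewrite sumr_ge0.
case: ifP => // av; rewrite BG// ZE mallows_weight_fweight// -/q -/W.
by rewrite -mulf_div divff ?gt_eqF// mul1r.
Qed.

Lemma geom_sumE (y : R) N : (1 - y) * (\sum_(l < N) y ^+ l) = 1 - y ^+ N.
Proof. by rewrite -[1 - y]opprB mulNr -subrX1 opprB. Qed.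

Lemma geom_sum_le (y : R) N : 0 <= y -> y < 1 ->
  \sum_(l < N.+1) y ^+ l <= (1 - y)^-1.
Proof.
move=> y0 y1; have h : 0 < 1 - y by rewrite subr_gt0.
rewrite -(ler_pM2l h) divff ?gt_eqF// geom_sumE.
by rewrite lerBlDr lerDl exprn_ge0.
Qed.

(** Chernoff's bound: the first [i] ratios are multiplied by [expR t]. *)
Lemma fweight_tail (x : nat -> R) n i t c : (forall j, 0 <= x j) ->
  (forall j, (j < n)%N -> x j < 1) ->
  (forall j, (j < n)%N -> x j * expR t < 1) ->
  \sum_(f : {ffun 'I_n -> 'I_n.+1} | c <= t * (psum f i)%:R) fweight x f <=
  expR (- c) * \prod_(j < n) (1 - (if (j < i)%N then x j * expR t else x j))^-1.
Proof.
move=> x0 x1 xt1.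
pose y j := if (j < i)%N then x j * expR t else x j.
have y0 j : 0 <= y j by rewrite /y; case: ifP; rewrite ?mulr_ge0 ?expR_ge0.
have yE (f : {ffun 'I_n -> 'I_n.+1}) :
    fweight y f = expR (t * (psum f i)%:R) * fweight x f.
  rewrite mulrC [t * _]mulrC expRM_natl /psum -prodrXr [X in _ * X]big_mkcond.
  rewrite -big_split; apply: eq_bigr => j _ /=.
  by rewrite /y; case: ifP => _; rewrite ?mulr1// exprMn.
apply: le_trans (_ : expR (- c) * \sum_(f : {ffun 'I_n -> 'I_n.+1}) fweight y f <= _).
  rewrite big_distrr big_mkcond; apply: ler_sum => f _ /=.
  have w0 : 0 <= fweight x f by apply: prodr_ge0 => j _; rewrite exprn_ge0.
  case: ifP => [h|_]; last first.
    by rewrite yE !mulr_ge0 ?expR_ge0.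
  rewrite yE mulrA -expRD ler_peMl//; apply: le_trans (expR_ge1Dx _); rewrite lerDl addrC subr_ge0; exact: h.
rewrite ler_wpM2l ?expR_ge0// fweight_sum; apply: ler_prod => j _.
rewrite sumr_ge0 => [|l _]; last by rewrite exprn_ge0.
rewrite geom_sum_le// /y; case: ifP => _; first exact: xt1.
exact: x1.
Qed.

(** Being a Dyck sequence has at least polynomial probability under the tilted
    weights: the total [n] does by [hsym_mode], since the total takes polynomially
    many values, and [bridge_le_dyck] loses one more factor [n]. The hypothesis on
    [tilt_max] makes the truncation of the steps at [n] harmless. *)
Lemma dyck_weight_ge beta n : 0 <= beta -> (0 < n)%N ->
  n%:R * tilt_max beta ^+ n.+1 <= 2^-1 ->
  \prod_(j < n) (1 - tilt beta n j)^-1 <=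
  4 * n%:R * ((n * n).+1)%:R *
    \sum_(f : {ffun 'I_n -> 'I_n.+1} | dyck f) fweight (tilt beta n) f.
Proof.
move=> b0 n0 small; set r := tilt_max beta; set D := \sum_(f | _) _.
have q1 : 1 <= expR (beta / n%:R).
  by rewrite -expR0 ler_expR divr_ge0.
have x0 j : 0 <= tilt beta n j by rewrite ltW// tilt_gt0.
have r0 := tilt_max_gt0 beta; have r1 := tilt_max_lt1 beta.
have x1 j : (j < n)%N -> tilt beta n j < 1.
  by move=> jn; apply: le_lt_trans (tilt_le _ _) (tilt_max_lt1 beta).
have lamE : lam231 beta * (1 + expR (beta / n%:R) ^+ n) = 1.
  rewrite expR_divn divff ?pnatr_eq0 -?lt0n// mulr1 mulVf// gt_eqF//.
have h1 : \prod_(j < n) \sum_(l < n.+1) tilt beta n j ^+ l <=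
    ((n * n).+1)%:R * (2 * hsym (tilt beta n) n n).
  by apply: fweight_sum_le => // m; apply: hsym_mode lamE m.
have h2 : hsym (tilt beta n) n n <= n%:R * D.
  rewrite -(@fweight_total_hsym _ _ _ n)//.
  by apply: bridge_le_dyck => //; rewrite ltW// lam231_gt0.
have h3 : \prod_(j < n) (1 - tilt beta n j)^-1 <=
    2 * \prod_(j < n) \sum_(l < n.+1) tilt beta n j ^+ l.
  have ge : \prod_(j < n) ((1 - tilt beta n j)^-1 * (1 - r ^+ n.+1)) <=
      \prod_(j < n) \sum_(l < n.+1) tilt beta n j ^+ l.
    apply: ler_prod => j _; have xj := x1 j (ltn_ord j).
    have h : 0 < 1 - tilt beta n j by rewrite subr_gt0.
    rewrite mulr_ge0 ?invr_ge0 ?(ltW h) ?subr_ge0 ?exprn_ile1 ?(ltW r0) ?(ltW r1)//=.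
    rewrite ler_pdivrMl// geom_sumE lerD2l lerN2.
    by rewrite ler_pXn2r ?nnegrE// ?(ltW r0)// tilt_le.
  apply: le_trans (_ : _ <= 2 * _) (ler_wpM2l _ ge) => //.
  rewrite big_split /= prodr_const card_ord mulrCA ler_peMr//.
    by apply: prodr_ge0 => j _; rewrite invr_ge0 subr_ge0 ltW// x1.
  have : 1 - n%:R * r ^+ n.+1 <= (1 - r ^+ n.+1) ^+ n.
    have : 0 <= r ^+ n.+1 <= 1 by rewrite exprn_ge0 ?exprn_ile1 ?(ltW r0) ?(ltW r1).
    move: (r ^+ n.+1) => z /andP[z0 z1]; elim: (n) => [|k IH].
      by rewrite expr0 mul0r subr0.
    rewrite exprS -natr1.
    apply: le_trans (ler_wpM2l _ IH); last by rewrite subr_ge0.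
    have : 0 <= k%:R * z ^+ 2 by rewrite mulr_ge0 ?sqr_ge0.
    rewrite expr2; lra.
  rewrite -/r in small; lra.
apply: le_trans h3 _.
apply: le_trans (ler_wpM2l _ h1) _ => //.
apply: le_trans (_ : 2 * ((n * n).+1%:R * (2 * (n%:R * D))) <= _).
  by rewrite !ler_wpM2l.
by rewrite le_eqVlt; apply/orP; left; apply/eqP; ring.
Qed.

End tilted_weights.

(** * Concentration of the partial sums *)

Section concentration.
Variables (R : realType).
Implicit Types (beta : R).

(** The mean of the [i]-th partial sum of the tilted steps. *)
Definition drift beta n i : R := \sum_(j < n | (j < i)%N) tilt_mean beta n j.

Definition deviates beta n (eps : R) (f : {ffun 'I_n -> 'I_n.+1}) : bool :=
  [exists i : 'I_n, eps * n%:R < `|(psum f i)%:R - drift beta n i|].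

(** One-sided deviations, upwards for [t > 0] and downwards for [t < 0]. *)
Let sdev t beta n (eps : R) i (f : {ffun 'I_n -> 'I_n.+1}) : bool :=
  t * drift beta n i + `|t| * eps * n%:R <= t * (psum f i)%:R.

Let sdev_weight beta (M := tilt_max beta / (1 - tilt_max beta))
    (C := 2 * M + 8 * M ^+ 2) n (t eps : R) i :
  0 <= beta -> `|t| <= 2^-1 -> `|t| <= (4 * M)^-1 ->
  \sum_(f : {ffun 'I_n -> 'I_n.+1} | sdev t beta eps i f) fweight (tilt beta n) f <=
  expR (- (`|t| * (eps - C * `|t|) * n%:R)) * \prod_(j < n) (1 - tilt beta n j)^-1.
Proof.
move=> b0 t2 tM.
have r0 := tilt_max_gt0 beta; have r1 := tilt_max_lt1 beta.
have M0 : 0 < M by rewrite divr_gt0// subr_gt0.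
have C0 : 0 <= C by have := sqr_ge0 M; rewrite /C; lra.
have x0 j : 0 <= tilt beta n j by rewrite ltW// tilt_gt0.
have mgf j : (j < n)%N -> 0 < 1 - tilt beta n j * expR t /\
    (1 - tilt beta n j * expR t)^-1 <=
    (1 - tilt beta n j)^-1 * expR (tilt_mean beta n j * t + C * t ^+ 2).
  by move=> jn; apply: geometric_mgf_le => //; exact: tilt_le.
have x1 j : (j < n)%N -> tilt beta n j < 1.
  by move=> jn; exact: le_lt_trans (tilt_le _ _) r1.
apply: le_trans (fweight_tail _ _ x0 x1 _) _.
  by move=> j /mgf[]; rewrite subr_gt0.
have prodle : \prod_(j < n)
    (1 - (if (j < i)%N then tilt beta n j * expR t else tilt beta n j))^-1 <=
    \prod_(j < n) (1 - tilt beta n j)^-1 *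
    expR (t * drift beta n i + C * t ^+ 2 * n%:R).
  apply: le_trans (_ : \prod_(j < n) ((1 - tilt beta n j)^-1 *
      expR ((if (j < i)%N then tilt_mean beta n j * t else 0) + C * t ^+ 2)) <= _).
    apply: ler_prod => j _; have [p h] := mgf j (ltn_ord j).
    have p' : 0 < 1 - tilt beta n j by rewrite subr_gt0 x1.
    case: ifP => _; first by rewrite h invr_ge0 ltW.
    rewrite invr_ge0 (ltW p') /= add0r ler_peMr ?invr_ge0 ?(ltW p')//.
    by apply: le_trans (expR_ge1Dx _); rewrite lerDl mulr_ge0 ?sqr_ge0.
  rewrite big_split /= -expR_sum big_split /= sumr_const card_ord mulr_natr.
  have -> : \sum_(j < n) (if (j < i)%N then tilt_mean beta n j * t else 0) =
      t * drift beta n i by rewrite -big_mkcond /= -mulr_suml mulrC.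
  by [].
apply: le_trans (ler_wpM2l (expR_ge0 _) prodle) _.
rewrite mulrCA mulrC ler_wpM2r//.
  by apply: prodr_ge0 => j _; rewrite invr_ge0 subr_ge0 ltW// x1.
rewrite -expRD ler_expR.
have tt : `|t| * `|t| = t * t by rewrite -!expr2 real_normK ?num_real.
rewrite mulrBr mulrA.
have -> : `|t| * (C * `|t|) = C * t ^+ 2 by rewrite expr2 -tt; ring.
lra.
Qed.

(** A union bound over the position and the side of the deviation. The exponential
    bound of [sdev_weight] absorbs the polynomial cost of being a Dyck sequence. *)
Lemma deviates_weight beta (eps : R) : 0 <= beta -> 0 < eps ->
  exists c : R, 0 < c /\ exists N : nat, forall n : nat, (N <= n)%N -> (0 < n)%N ->
    \sum_(f : {ffun 'I_n -> 'I_n.+1} | dyck f && deviates beta eps f)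
      fweight (tilt beta n) f <=
    expR (- (c * n%:R)) *
    \sum_(f : {ffun 'I_n -> 'I_n.+1} | dyck f) fweight (tilt beta n) f.
Proof.
move=> b0 e0; set r := tilt_max beta.
have r0 : 0 < r := tilt_max_gt0 beta; have r1 : r < 1 := tilt_max_lt1 beta.
set M := r / (1 - r); have M0 : 0 < M by rewrite divr_gt0// subr_gt0.
set C := 2 * M + 8 * M ^+ 2.
have C0 : 0 < C by have := sqr_ge0 M; rewrite /C; lra.
(* the last bound gives [eps - C * t >= eps / 2] in [sdev_weight] *)
pose t := Num.min (Num.min 2^-1 (4 * M)^-1) (eps / (2 * C)).
have t0 : 0 < t by rewrite /t !lt_min !invr_gt0 (ltr0n _ 2) /= mulr_gt0//= divr_gt0// mulr_gt0.
have t2 : t <= 2^-1 by rewrite !ge_min lexx.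
have tM : t <= (4 * M)^-1 by rewrite !ge_min lexx orbT.
have tC : C * t <= eps / 2.
  have : t <= eps / (2 * C) by rewrite !ge_min lexx orbT.
  by rewrite invfM mulrA ler_pdivlMr// mulrC.
set c := t * (eps / 2); have c0 : 0 < c by rewrite mulr_gt0// divr_gt0.
exists (c / 2); split; first by rewrite divr_gt0.
have c2 : 0 < c / 2 by rewrite divr_gt0.
have lr : 0 < - ln r by rewrite oppr_gt0 ln_lt0// r0.
have [N1 h1] := expR_absorb (16 : R) 4 c2.
have [N2 h2] := expR_absorb (2 : R) 1 lr.
exists (maxn N1 N2) => n; rewrite geq_max => /andP[/h1 n1 /h2 n2] n0.
have small : n%:R * r ^+ n.+1 <= 2^-1.
  have rn : r ^+ n = (expR (- ln r * n%:R))^-1.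
    by rewrite mulNr expRN invrK mulrC expRM_natl lnK ?posrE.
  have E0 := expR_gt0 (- ln r * n%:R).
  apply: le_trans (_ : n%:R * r ^+ n <= _).
    by rewrite ler_wpM2l// exprS ler_piMl ?(ltW r1)// exprn_ge0// ltW.
  by rewrite rn ler_pdivrMr//; move: n2; rewrite expr1; lra.
have := dyck_weight_ge b0 n0 small; set P := \prod_(j < n) _; set D := \sum_(f | dyck f) _ => PD.
have P0 : 0 <= P.
  apply: prodr_ge0 => j _; rewrite invr_ge0 subr_ge0.
  by rewrite (le_trans (tilt_le _ _) (ltW r1)).
have w0 (f : {ffun 'I_n -> 'I_n.+1}) : 0 <= fweight (tilt beta n) f.
  by apply: prodr_ge0 => j _; rewrite exprn_ge0// ltW// tilt_gt0.
have D0 : 0 <= D by apply: sumr_ge0.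
have union : \sum_(f : {ffun 'I_n -> 'I_n.+1} | dyck f && deviates beta eps f)
      fweight (tilt beta n) f <=
    \sum_(i < n)
     (\sum_(f : {ffun 'I_n -> 'I_n.+1} | sdev t beta eps i f) fweight (tilt beta n) f +
      \sum_(f : {ffun 'I_n -> 'I_n.+1} | sdev (- t) beta eps i f) fweight (tilt beta n) f).
  under [leRHS]eq_bigr do rewrite 2!(big_mkcond (sdev _ _ _ _)) -big_split /=.
  rewrite exchange_big big_mkcond; apply: ler_sum => f _ /=.
  have s0 (i : 'I_n) : 0 <= (if sdev t beta eps i f then fweight (tilt beta n) f else 0) +
       (if sdev (- t) beta eps i f then fweight (tilt beta n) f else 0).
    by rewrite addr_ge0//; case: ifP.
  case: ifP => [/andP[_ /existsP[i]]|_]; last by apply: sumr_ge0.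
  move=> dev; rewrite (bigD1 i)//= -[leLHS]addr0 lerD ?sumr_ge0//.
  move: dev; rewrite lter_normr => /orP[dev|dev].
    have -> : sdev t beta eps i f.
      rewrite /sdev gtr0_norm// -mulrA -mulrDr ler_wpM2l ?(ltW t0)//; lra.
    by rewrite lerDl; case: ifP.
  have -> : sdev (- t) beta eps i f.
    rewrite /sdev normrN gtr0_norm// -mulrA !mulNr -mulrN -mulrDr -mulrN.
    by rewrite ler_wpM2l ?(ltW t0)//; lra.
  by rewrite lerDr; case: ifP.
apply: le_trans union _.
apply: le_trans (_ : \sum_(i < n) 2 * (expR (- (c * n%:R)) * P) <= _).
  apply: ler_sum => i _.
  have key s : `|s| = t -> \sum_(f : {ffun 'I_n -> 'I_n.+1} | sdev s beta eps i f)
      fweight (tilt beta n) f <= expR (- (c * n%:R)) * P.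
    move=> st; have := @sdev_weight beta n s eps i b0; rewrite st => /(_ t2 tM) h.
    apply: le_trans h _.
    rewrite ler_wpM2r// ler_expR lerN2 ler_wpM2r// ler_wpM2l ?(ltW t0)//.
    by rewrite -/r -/M -/C; lra.
  have := key t (gtr0_norm t0); have := key (- t); rewrite normrN gtr0_norm// => /(_ erefl).
  lra.
rewrite sumr_const card_ord -[leLHS]mulr_natl.
apply: le_trans (_ : n%:R * (2 * (expR (- (c * n%:R)) *
   (4 * n%:R * (n * n).+1%:R * D))) <= _).
  by rewrite !ler_wpM2l ?expR_ge0.
have -> : n%:R * (2 * (expR (- (c * n%:R)) * (4 * n%:R * (n * n).+1%:R * D))) =
   8 * n%:R ^+ 2 * (n * n).+1%:R * expR (- (c * n%:R)) * D by ring.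
rewrite ler_wpM2r//.
have -> : - (c / 2 * n%:R) = c / 2 * n%:R + - (c * n%:R) by field.
rewrite expRD ler_wpM2r ?expR_ge0//; apply: le_trans n1.
rewrite -[(n * n).+1%:R]natr1 natrM.
have n1' : 1 <= n%:R :> R by rewrite ler1n.
have : 1 <= n%:R ^+ 2 :> R by rewrite expr_ge1 ?ler0n.
have -> : 16 * n%:R ^+ 4 = 8 * n%:R ^+ 2 * (n%:R ^+ 2 + n%:R ^+ 2) :> R by ring.
move=> h; rewrite ler_wpM2l ?mulr_ge0 ?sqr_ge0// -expr2.
lra.
Qed.

End concentration.

(** * The profile of the inversion code *)

Section curve.
Variables (R : realType) (beta : R).
Hypothesis beta0 : 0 < beta.
Implicit Types x y : R.

Local Notation f := (f231 beta).

(** The argument of the logarithm in [f231]; the derivative of [f231] is [slope]. *)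
Definition gap x : R := 1 + expR beta - expR (beta * x).

Definition slope x : R := expR (beta * x) / gap x.

Lemma f231E x : f x = 1 - beta^-1 * ln (gap x).
Proof. by []. Qed.

Lemma gap_ge1 x : x <= 1 -> 1 <= gap x.
Proof.
move=> x1; rewrite /gap -addrA lerDl subr_ge0 ler_expR ler_piMr//.
exact: ltW.
Qed.

Lemma gap_gt0 x : x <= 1 -> 0 < gap x.
Proof. by move=> /gap_ge1; exact: lt_le_trans. Qed.

Lemma gap_mono x y : x <= y -> gap y <= gap x.
Proof. by move=> xy; rewrite /gap lerD2l lerN2 ler_expR ler_pM2l. Qed.

Lemma slope_mono x y : x <= y -> y <= 1 -> slope x <= slope y.
Proof.
move=> xy y1; rewrite /slope; apply: ler_pM; rewrite ?expR_ge0//.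
- by rewrite invr_ge0 ltW// gap_gt0// (le_trans xy).
- by rewrite ler_expR ler_pM2l.
- by rewrite lef_pV2 ?posrE ?gap_gt0 ?gap_mono// (le_trans xy).
Qed.

Lemma slope_ge0 x : x <= 1 -> 0 <= slope x.
Proof. by move=> x1; rewrite divr_ge0 ?expR_ge0// ltW// gap_gt0. Qed.

Lemma slope_le x : x <= 1 -> slope x <= expR beta.
Proof.
move=> x1; apply: le_trans (slope_mono x1 (lexx 1)) _.
by rewrite /slope /gap mulr1 addrK divr1.
Qed.

Lemma ln_le_sub1 x : 0 < x -> ln x <= x - 1.
Proof.
by move=> x0; have := @le_ln1Dx _ (x - 1); rewrite addrCA subrr addr0; apply; lra.
Qed.

(** A mean value inequality for the convex function [f231]: apply [ln u <= u - 1] to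
    both quotients of the values of [gap] at [x] and [y]. *)
Lemma f231_incr x y : x <= y -> y <= 1 ->
  (y - x) * slope x <= f y - f x <= (y - x) * slope y.
Proof.
move=> xy y1; have x1 := le_trans xy y1.
have gx := gap_gt0 x1; have gy := gap_gt0 y1.
have -> : f y - f x = beta^-1 * (ln (gap x) - ln (gap y)) by rewrite !f231E; ring.
have bE z : z = beta^-1 * (beta * z) by rewrite mulrA mulVf ?mul1r// gt_eqF.
rewrite [leLHS]bE [X in _ <= _ <= X]bE !ler_pM2l ?invr_gt0//.
have low : 1 - gap y / gap x <= ln (gap x) - ln (gap y).
  have := @ln_le_sub1 (gap y / gap x); rewrite divr_gt0// => /(_ isT).
  by rewrite ln_div ?posrE//; lra.
have up : ln (gap x) - ln (gap y) <= gap x / gap y - 1.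
  have := @ln_le_sub1 (gap x / gap y); rewrite divr_gt0// => /(_ isT).
  by rewrite ln_div ?posrE//; lra.
apply/andP; split.
  apply: le_trans low; rewrite -[1](@divff _ (gap x)) ?gt_eqF// -mulrBl.
  rewrite /slope !mulrA ler_pM2r ?invr_gt0//.
  have -> : gap x - gap y = expR (beta * x) * (expR (beta * (y - x)) - 1).
    rewrite mulrBr -expRD mulr1 /gap.
    have -> : beta * x + beta * (y - x) = beta * y by ring.
    ring.
  rewrite mulrC ler_pM2l ?expR_gt0//; have := expR_ge1Dx (beta * (y - x)).
  lra.
apply: le_trans up _; rewrite -[1](@divff _ (gap y)) ?gt_eqF// -mulrBl.
rewrite /slope !mulrA ler_pM2r ?invr_gt0//.
have -> : gap x - gap y = expR (beta * y) * (1 - expR (- (beta * (y - x)))).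
  rewrite mulrBr -expRD mulr1 /gap.
  have -> : beta * y + - (beta * (y - x)) = beta * x by ring.
  ring.
rewrite mulrC ler_pM2r ?expR_gt0//; have := expR_ge1Dx (- (beta * (y - x))).
lra.
Qed.

Lemma f231_0 : f 0 = 0.
Proof. by rewrite f231E /gap mulr0 expR0 addrAC subrr add0r expRK mulVf ?subrr// gt_eqF. Qed.

Lemma f231_1 : f 1 = 1.
Proof. by rewrite f231E /gap mulr1 addrK ln1 mulr0 subr0. Qed.

Lemma tilt_mean_slope n j : (j < n)%N -> tilt_mean beta n j = slope (j.+1%:R / n%:R).
Proof.
move=> jn; rewrite /tilt_mean tiltE /slope /gap /lam231.
set e := expR (beta * _).
have g0 : 1 + expR beta - e != 0.
  rewrite gt_eqF//; apply: gap_gt0.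
  by rewrite ler_pdivrMr ?mul1r ?ler_nat// ltr0n (leq_trans _ jn).
have s0 : 1 + expR beta != 0 by rewrite gt_eqF// addr_gt0 ?expR_gt0.
field; rewrite s0 /=.
by rewrite g0.
Qed.

Lemma driftS n i : (i < n)%N -> drift beta n i.+1 = drift beta n i + tilt_mean beta n i.
Proof.
move=> i_n; rewrite /drift (bigD1 (Ordinal i_n)) ?ltnSn//= addrC; congr (_ + _).
apply: eq_bigl => j; rewrite ltnS -(inj_eq val_inj) /=.
by rewrite andbC -ltn_neqAle.
Qed.

(** By [tilt_mean_slope], [drift beta n i / n] is a Riemann sum for the integral of
    the nondecreasing function [slope], so the error is at most the total variation
    of [slope]. *)
Lemma drift_f231 n i : (i <= n)%N -> (0 < n)%N ->
  `|drift beta n i - n%:R * f (i%:R / n%:R)| <= expR beta.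
Proof.
move=> i_n n0; have nR : 0 < n%:R :> R by rewrite ltr0n.
have le1 k : (k <= n)%N -> k%:R / n%:R <= 1 :> R.
  by move=> kn; rewrite ler_pdivrMr// mul1r ler_nat.
suff : n%:R * f (i%:R / n%:R) <= drift beta n i <=
    n%:R * f (i%:R / n%:R) + slope (i%:R / n%:R) - slope 0.
  have := slope_le (le1 _ i_n); have := slope_ge0 (@ler01 R).
  rewrite ler_norml => ? ?; have := expR_ge0 beta => ? /andP[? ?].
  by apply/andP; split; lra.
elim: i i_n => [|i IH] i_n.
  by rewrite mul0r f231_0 mulr0 add0r subrr /drift big_pred0// lexx.
have /andP[IH1 IH2] := IH (ltnW i_n).
have xy : i%:R / n%:R <= i.+1%:R / n%:R :> R.
  by rewrite ler_pM2r ?invr_gt0// ler_nat.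
have := f231_incr xy (le1 _ i_n).
have -> : i.+1%:R / n%:R - i%:R / n%:R = n%:R^-1 :> R.
  by rewrite -mulrBl -natrB// subSnn mul1r.
rewrite ler_pdivrMl// ler_pdivlMl// driftS// tilt_mean_slope// => /andP[h1 h2].
by apply/andP; split; lra.
Qed.

End curve.

Section profile.
Variable R : realType.
Implicit Types (beta eps : R) (delta : R -> R).

Definition far delta eps n (s : 'S_n) : bool :=
  [exists i : 'I_n, eps * n%:R < `|(icode s i)%:R - n%:R * delta (i%:R / n%:R)|].

(** The limit of the rescaled code: by [psum_steps] the code at [i] is [i] minus a
    partial sum of the steps. *)
Definition depth231 beta (x : R) : R := if 0 < beta then x - f231 beta x else 0.

Let far_pmf_of_deviates beta eps delta : 0 <= beta -> 0 < eps ->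
  (exists N : nat, forall n (s : 'S_n), (N <= n)%N -> (0 < n)%N -> avoids231 s ->
     far delta eps s -> deviates beta (eps / 2) (steps s)) ->
  exists c : R, 0 < c /\ exists N : nat, forall n : nat, (N <= n)%N -> (0 < n)%N ->
    \sum_(s : 'S_n | far delta eps s) mallows231_pmf beta s <= expR (- (c * n%:R)).
Proof.
move=> b0 e0 [N1 h1]; have e2 : 0 < eps / 2 by rewrite divr_gt0.
have [c [c0 [N2 h2]]] := deviates_weight b0 e2.
exists c; split => //; exists (maxn N1 N2) => n; rewrite geq_max => /andP[n1 n2] n0.
have := @mallows231_pmf_sum _ beta n (@far delta eps n) (@deviates _ beta n (eps / 2)).
move=> /(_ (fun s av fs => h1 n s n1 n0 av fs)) le.
apply: le_trans le _; have := h2 n n2 n0.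
set D := \sum_(f | dyck f) _ => h.
have D0 : 0 <= D.
  by apply: sumr_ge0 => f _; apply: prodr_ge0 => j _; rewrite exprn_ge0// ltW// tilt_gt0.
move: D0; rewrite le_eqVlt => /orP[/eqP <-|D0]; first by rewrite invr0 mulr0 expR_ge0.
by rewrite ler_pdivrMr.
Qed.

Let icode_psum n (s : 'S_n) (i : 'I_n) : avoids231 s ->
  (icode s i)%:R = i%:R - (psum (steps s) i)%:R :> R.
Proof.
by move=> av; rewrite -[X in X%:R - _](psum_steps av (ltnW (ltn_ord i))) natrD addrC addKr.
Qed.

Let far_pmf_gt0 beta eps : 0 < beta -> 0 < eps ->
  exists c : R, 0 < c /\ exists N : nat, forall n : nat, (N <= n)%N -> (0 < n)%N ->
    \sum_(s : 'S_n | far (depth231 beta) eps s) mallows231_pmf beta s <=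
    expR (- (c * n%:R)).
Proof.
move=> b0 e0; apply: far_pmf_of_deviates => //; first exact: ltW.
exists (Num.bound (expR beta * 2 / eps)) => n s Nn n0 av /existsP[i far_i].
apply/existsP; exists i.
have nE : expR beta <= eps / 2 * n%:R.
  have : expR beta * 2 / eps <= n%:R.
    apply: le_trans (_ : (Num.bound (expR beta * 2 / eps))%:R <= _).
      by rewrite ltW// archi_boundP// divr_ge0 ?(ltW e0)// mulr_ge0 ?expR_ge0.
    by rewrite ler_nat.
  rewrite ler_pdivrMr// mulrC; lra.
have nR : n%:R != 0 :> R by rewrite pnatr_eq0 -lt0n.
move: far_i; rewrite /depth231 b0 icode_psum// mulrBr mulrCA divff// mulr1.
have := drift_f231 b0 (ltnW (ltn_ord i)) n0.
set F := drift _ _ _; set G := n%:R * _; set p := (psum _ _)%:R.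
have -> : i%:R - p - (i%:R - G) = - (p - F) - (F - G) by ring.
move=> h1 h2; have := ler_normB (- (p - F)) (F - G); rewrite normrN.
lra.
Qed.

(** For [beta = 0] the tilted steps all have mean [1]. *)
Let far_pmf_eq0 eps : 0 < eps ->
  exists c : R, 0 < c /\ exists N : nat, forall n : nat, (N <= n)%N -> (0 < n)%N ->
    \sum_(s : 'S_n | far (fun=> 0) eps s) mallows231_pmf 0 s <= expR (- (c * n%:R)).
Proof.
move=> e0; apply: far_pmf_of_deviates => //.
exists 0%N => n s _ n0 av /existsP[i far_i]; apply/existsP; exists i.
have -> : drift 0 n i = i%:R :> R.
  rewrite /drift (eq_bigr (fun=> 1)) => [|j _].
    by rewrite sumr_const card_ord_ltn// ltnW.
  rewrite /tilt_mean tiltE mul0r expR0 mulr1 /lam231 expR0.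
  by rewrite (_ : 1 - (1 + 1)^-1 = (1 + 1)^-1) ?divff ?invr_eq0 ?pnatr_eq0//; field.
move: far_i; rewrite icode_psum// mulr0 subr0 distrC => h; apply: le_lt_trans h.
by rewrite ler_wpM2r//; lra.
Qed.

(** Comparison with [beta = 0]. There, for any [eta] and all large [n], at
    least half of the 231-avoiding permutations have a code bounded by [eta * n],
    hence at most [eta * n ^+ 2] inversions and a weight at least
    [expR (beta * eta * n)]. As all weights are at most [1], passing from [0] to [beta] multiplies probabilities by
    at most [2 * expR (- (beta * eta * n))], and [eta] can be chosen so small that
    the exponential bound at [0] survives. *)
Let far_pmf_le0 beta eps : beta <= 0 -> 0 < eps ->
  exists c : R, 0 < c /\ exists N : nat, forall n : nat, (N <= n)%N -> (0 < n)%N ->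
    \sum_(s : 'S_n | far (fun=> 0) eps s) mallows231_pmf beta s <= expR (- (c * n%:R)).
Proof.
move=> b0 e0; have [c0 [c0_gt0 [N0 h0]]] := far_pmf_eq0 e0.
pose eta := c0 / (4 * (1 - beta)).
have b1 : 0 < 1 - beta by lra.
have eta0 : 0 < eta by rewrite divr_gt0// mulr_gt0.
have beta_eta : - beta * eta <= c0 / 4.
  have : eta * (1 - beta) = c0 / 4 by rewrite /eta; field; rewrite gt_eqF.
  lra.
have [c1 [c1_gt0 [N1 h1]]] := far_pmf_eq0 eta0.
have [N2 h2] := expR_absorb (2 : R) 0 c1_gt0.
have c4 : 0 < c0 / 4 by rewrite divr_gt0.
have [N3 h3] := expR_absorb (2 : R) 0 c4.
exists (c0 / 2); split; first by rewrite divr_gt0.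
exists (maxn (maxn N0 N1) (maxn N2 N3)) => n; rewrite !geq_max.
move=> /andP[/andP[/h0 {}h0 /h1 {}h1] /andP[/h2 {}h2 /h3 {}h3]] n0.
move: (h0 n0) (h1 n0) h2 h3; rewrite !expr0 !mulr1 => {}h0 {}h1 h2 h3.
have w1 (s : 'S_n) : mallows_weight (0 : R) s = 1.
  by rewrite /mallows_weight !mul0r expR0.
pose Z0 := mallows231_Z (0 : R) n; pose Z := mallows231_Z beta n.
have Z0_gt0 : 0 < Z0.
  have av1 : avoids231 (1%g : 'S_n).
    apply/negP => /existsP[i /existsP[j /existsP[k /and4P[ij jk]]]].
    by rewrite !perm1 ltnNge (ltnW (ltn_trans ij jk)).
  rewrite /Z0 /mallows231_Z (bigD1 1%g)//= w1 ltr_pwDl// sumr_ge0// => s _.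
  by rewrite w1.
have cntE e : \sum_(s : 'S_n | far (fun=> 0) e s) mallows231_pmf 0 s =
    (\sum_(s : 'S_n | far (fun=> 0) e s && avoids231 s) 1) / Z0.
  rewrite mulr_suml big_mkcondr; apply: eq_bigr => s _.
  by rewrite /mallows231_pmf w1.
have half : \sum_(s : 'S_n | far (fun=> 0) eta s && avoids231 s) 1 <= Z0 / 2.
  rewrite mulrC -ler_pdivrMr// -cntE; apply: le_trans h1 _.
  by rewrite expRN -[2^-1]mul1r ler_pdivlMr// mulrC ler_pdivrMr ?expR_gt0// mul1r.
have Zle : expR (beta * eta * n%:R) * (Z0 / 2) <= Z.
  apply: le_trans (_ : \sum_(s : 'S_n | avoids231 s && ~~ far (fun=> 0) eta s)
      mallows_weight beta s <= _); last first.
    rewrite /Z /mallows231_Z big_mkcondr; apply: ler_sum => s _.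
    by case: ifP => // _; exact: expR_ge0.
  apply: le_trans (_ : \sum_(s : 'S_n | avoids231 s && ~~ far (fun=> 0) eta s)
      expR (beta * eta * n%:R) <= _).
    rewrite -[X in X <= _]mulr1 -mulrA -[X in _ <= \sum_(_ | _) X]mulr1 -big_distrr /=.
    rewrite ler_wpM2l ?expR_ge0// mulr1.
    have : Z0 = \sum_(s : 'S_n | avoids231 s && far (fun=> 0) eta s) 1 +
        \sum_(s : 'S_n | avoids231 s && ~~ far (fun=> 0) eta s) 1.
      by rewrite -bigID; apply: eq_bigr => s _; rewrite w1.
    rewrite (eq_bigl (fun s : 'S_n => far (fun=> 0) eta s && avoids231 s)); last first.
      by move=> s; rewrite andbC.
    move: half; lra.
  apply: ler_sum => s /andP[_ nf]; rewrite ler_expR -[leRHS]mulrA -[leLHS]mulrA.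
  rewrite ler_wnM2l// mulrC ler_pdivrMr ?ltr0n// inv_num_icode natr_sum.
  apply: le_trans (_ : \sum_(i < n) eta * n%:R <= _).
    apply: ler_sum => i _; rewrite leNgt; apply: contra nf => h.
    by apply/existsP; exists i; rewrite mulr0 subr0 ger0_norm.
  by rewrite sumr_const card_ord [leRHS]mulr_natr.
apply: le_trans (_ : \sum_(s : 'S_n | far (fun=> 0) eps s)
    2 * expR (- (beta * eta * n%:R)) * mallows231_pmf 0 s <= _).
  apply: ler_sum => s _; rewrite /mallows231_pmf; case: ifP => [av|_]; last by rewrite mulr0.
  rewrite w1 -/Z -/Z0.
  have E0 := expR_gt0 (beta * eta * n%:R).
  have Zgt : 0 < Z by apply: lt_le_trans Zle; rewrite mulr_gt0// divr_gt0.
  rewrite ler_pdivrMr//; apply: (@le_trans _ _ 1).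
    rewrite -expR0 ler_expR mulr_le0_ge0 ?mulr_le0_ge0 ?invr_ge0//.
  have E : 2 * expR (- (beta * eta * n%:R)) * (1 / Z0) *
      (expR (beta * eta * n%:R) * (Z0 / 2)) = 1.
    by rewrite expRN; field; rewrite !gt_eqF.
  rewrite -[leLHS]E ler_wpM2l// mulr_ge0 ?divr_ge0 ?mulr_ge0 ?expR_ge0//.
  exact: ltW.
rewrite -big_distrr /=.
apply: le_trans (ler_wpM2l _ h0) _; first by rewrite mulr_ge0 ?expR_ge0.
apply: le_trans (ler_wpM2r (expR_ge0 _) (ler_wpM2r (expR_ge0 _) h3)) _.
rewrite -!expRD ler_expR.
have : - beta * eta * n%:R <= c0 / 4 * n%:R by rewrite ler_wpM2r.
lra.
Qed.

Lemma far_pmf beta eps : 0 < eps ->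
  exists c : R, 0 < c /\ exists N : nat, forall n : nat, (N <= n)%N -> (0 < n)%N ->
    \sum_(s : 'S_n | far (depth231 beta) eps s) mallows231_pmf beta s <=
    expR (- (c * n%:R)).
Proof.
move=> e0; have [b0|b0] := ltP 0 beta; first exact: far_pmf_gt0.
have -> : depth231 beta = fun=> 0.
  by apply/funext => x; rewrite /depth231 ltNge b0.
exact: far_pmf_le0.
Qed.

End profile.

(** * Permutations with a given profile *)

Section ancestors.
Local Open Scope nat_scope.
Variable n : nat.
Implicit Types (s : 'S_n) (i j k m p : nat).

(** By [ancestor_next] these are the indices before [p] whose next larger value comes
    after [p]. *)
Definition ancestor s p : pred 'I_n := [pred j : 'I_n | (j < p) && (pval s p < s j)].

Lemma ancestor_next s p (i : 'I_n) : avoids231 s -> i < p ->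
  ancestor s p i = (p < (pval s i + icode s i).+1).
Proof.
move=> av ip; rewrite /ancestor /= ip -pval_ord.
have [_ _ below above] := icode_next av (ltn_ord i).
case: (ltnP p (pval s i + icode s i).+1) => [h|h].
  by rewrite below.
by apply/negbTE; rewrite -leqNgt ltnW// above.
Qed.

(** Together with [card_ancestor_ge], this says that the number of ancestors of [p]
    before [k] is the minimum of the code over the positions from [k] to [p]. Here,
    an ancestor [j < k] of [p] has a value above [s k], or [j, k, p] would be an
    occurrence of 231. *)
Lemma card_ancestor_le s p k : avoids231 s -> k <= p ->
  #|[pred j : 'I_n | (j < k) && ancestor s p j]| <= icode s k.
Proof.
move=> /avoids231P av; rewrite leq_eqVlt => /orP[/eqP <-|kp].
  by apply/subset_leq_card/fintype.subsetP => j; rewrite !inE => /and3P[-> _ ->].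
apply/subset_leq_card/fintype.subsetP => j; rewrite !inE => /and3P[jk _ pj].
rewrite jk /= ltnNge leq_eqVlt negb_or; apply/andP; split.
  rewrite -pval_ord; apply/eqP => /(pval_inj (ltn_ord j)) e.
  by rewrite e ltnn in jk.
apply/negP; rewrite -!pval_ord in pj * => h; exact: (av _ _ _ jk kp).
Qed.

(** Take for [m] the first position from [k] on which is [p] or an ancestor of [p]:
    any index counted at [m] is an ancestor of [p], and comes before [k] by
    minimality. *)
Lemma card_ancestor_ge s p k : k <= p -> p < n ->
  exists m, [/\ k <= m, m <= p &
    icode s m <= #|[pred j : 'I_n | (j < k) && ancestor s p j]|].
Proof.
move=> kp pn.
have ex : exists m, (k <= m) && ((m == p) || (m < p) && (pval s p < pval s m)).
  by exists p; rewrite kp eqxx.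
case: (ex_minnP ex) => m /andP[km mp] mmin; exists m.
have m_p : m <= p by case/orP: mp => [/eqP ->|/andP[/ltnW]].
have sm : pval s p <= pval s m by case/orP: mp => [/eqP ->|/andP[_ /ltnW]].
split => //; apply/subset_leq_card/fintype.subsetP => j.
rewrite !inE => /andP[jm sj].
have pj := leq_ltn_trans sm sj; have jp := leq_trans jm m_p.
rewrite /ancestor /= jp pj !andbT ltnNge; apply/negP => kj.
by have := mmin j; rewrite kj jp pval_ord pj orbT => /(_ isT); rewrite leqNgt jm.
Qed.

Lemma card_ancestor s p k : p <= k ->
  #|[pred j : 'I_n | (j < k) && ancestor s p j]| = icode s p.
Proof.
move=> pk; apply: eq_card => j; rewrite !inE.
rewrite /ancestor /=.
by case: (ltnP j p) => [jp|jp]; [rewrite (leq_trans jp pk)|rewrite andbF].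
Qed.

End ancestors.

Section two_curves.
Variable R : realType.
Implicit Types (phi psi Phi : R -> R) (eps : R).

(** The points [(i / n, s i / n)] follow the graph of [psi] for [i] in [A], a set of
    asymptotic counting function [Phi], and the graph of [phi] otherwise, up to an
    error [eps] and a set [E] of exceptional indices. *)
Definition two_curves phi psi Phi eps n (s : 'S_n) : Prop :=
  exists A E : pred 'I_n,
  [/\ forall k, (k <= n)%N ->
        `|#|[pred i : 'I_n | (i < k)%N && A i]|%:R - n%:R * Phi (k%:R / n%:R)| <=
        eps * n%:R,
      #|E|%:R <= eps * n%:R,
      forall i : 'I_n, ~~ E i -> A i -> `|(s i)%:R / n%:R - psi (i%:R / n%:R)| <= eps &
      forall i : 'I_n, ~~ E i -> ~~ A i -> `|(s i)%:R / n%:R - phi (i%:R / n%:R)| <= eps].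

End two_curves.

Section peak.
Variables (R : realType) (beta : R).
Hypothesis beta0 : 0 < beta.
Implicit Types x y : R.

Local Notation f := (f231 beta).
Local Notation S := (1 + expR beta).
Local Notation delta x := (x - f x).

(** The maximum of [x - f x], reached by [expR_delta] when [expR (beta * x)] is half
    of [S]. *)
Definition peak231 : R := beta^-1 * ln (S / 2).

(** The asymptotic proportion of the indices before [x * n] whose points lie near
    the antidiagonal. *)
Definition spine_mass x : R := Num.min x peak231 - f (Num.min x peak231).

Lemma expR_peak : expR (beta * peak231) = S / 2.
Proof.
by rewrite /peak231 mulrA divff ?gt_eqF// mul1r lnK// posrE divr_gt0.
Qed.

Lemma peak_gt0 : 0 < peak231.
Proof.
rewrite -(pmulr_rgt0 _ beta0) -ltr_expR expR0 expR_peak; have : 1 < expR beta by rewrite expR_gt1.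
lra.
Qed.

Lemma peak_lt1 : peak231 < 1.
Proof.
rewrite -(ltr_pM2l beta0) -ltr_expR expR_peak mulr1; have : 1 < expR beta by rewrite expR_gt1.
lra.
Qed.

Lemma expR_le_peak x : (expR (beta * x) <= S / 2) = (x <= peak231).
Proof. by rewrite -expR_peak ler_expR ler_pM2l. Qed.

Lemma expR_ge_peak x : (S / 2 <= expR (beta * x)) = (peak231 <= x).
Proof. by rewrite -expR_peak ler_expR ler_pM2l. Qed.

Lemma f231_ge0 x : 0 <= x -> x <= 1 -> 0 <= f x.
Proof.
move=> x0 x1; have := f231_incr beta0 x0 x1; rewrite f231_0// !subr0 => /andP[h _].
by apply: le_trans h; rewrite mulr_ge0// slope_ge0.
Qed.

Lemma f231_le1 x : 0 <= x -> x <= 1 -> f x <= 1.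
Proof.
move=> x0 x1; have := f231_incr beta0 x1 (lexx 1); rewrite f231_1// => /andP[h _].
by rewrite -subr_ge0; apply: le_trans h; rewrite mulr_ge0 ?slope_ge0 ?subr_ge0.
Qed.

Lemma slope_le1 x : x <= peak231 -> slope beta x <= 1.
Proof.
move=> xp; have x1 : x <= 1 by rewrite (le_trans xp)// ltW// peak_lt1.
rewrite /slope ler_pdivrMr ?gap_gt0// mul1r /gap.
by move: xp; rewrite -expR_le_peak; lra.
Qed.

Lemma delta_mono x y : x <= y -> y <= peak231 -> delta x <= delta y.
Proof.
move=> xy yp; have y1 : y <= 1 by rewrite (le_trans yp)// ltW// peak_lt1.
have /andP[_ h] := f231_incr beta0 xy y1.
have : (y - x) * slope beta y <= (y - x) * 1.
  by rewrite ler_wpM2l ?subr_ge0// slope_le1.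
lra.
Qed.

Lemma gap_f231 x : x <= 1 -> gap beta x = expR (beta * (1 - f x)).
Proof.
move=> x1; rewrite f231E opprB addrCA subrr addr0 mulrA divff ?gt_eqF// mul1r.
by rewrite lnK// posrE gap_gt0.
Qed.

(** In the variable [u = expR (beta * x)] the exponential of [x - f x] is the
    parabola [u * (S - u)], up to scaling. The level sets of [x - f x] are thus
    explicit. *)
Lemma expR_delta x : x <= 1 ->
  expR (beta * x) * (S - expR (beta * x)) = expR beta * expR (beta * delta x).
Proof.
move=> x1; rewrite -[S - _]/(gap beta x) gap_f231// -!expRD; congr expR; ring.
Qed.

Let K : R := beta * expR beta ^+ 2.

Lemma parabola_le x y (eta : R) : 0 <= x -> x <= 1 -> 0 <= y -> y <= 1 ->
  0 <= eta -> delta y <= delta x + eta ->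
  expR (beta * y) * (S - expR (beta * y)) <=
  expR (beta * x) * (S - expR (beta * x)) + K * eta.
Proof.
move=> x0 x1 y0 y1 e0 h; rewrite (expR_delta x1) (expR_delta y1).
have -> : K * eta = expR beta * (expR beta * (beta * eta)) by rewrite /K; ring.
rewrite -mulrDr ler_pM2l ?expR_gt0// -lerBlDl.
have -> : expR (beta * delta y) - expR (beta * delta x) =
    expR (beta * delta y) * (1 - expR (- (beta * (delta y - delta x)))).
  rewrite [RHS]mulrBr mulr1 -expRD; congr (_ - expR _); ring.
have d1 : expR (beta * delta y) <= expR beta.
  rewrite ler_expR ler_piMr ?(ltW beta0)//; have := f231_ge0 y0 y1; lra.
apply: le_trans (_ : expR (beta * delta y) * (beta * eta) <= _); last first.
  by rewrite ler_wpM2r// mulr_ge0// ltW.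
rewrite ler_pM2l ?expR_gt0//.
have := expR_ge1Dx (- (beta * (delta y - delta x))).
have : beta * (delta y - delta x) <= beta * eta by rewrite ler_pM2l//; lra.
lra.
Qed.

Lemma expR_scale_ge x y : 0 <= x -> x <= y ->
  beta * (y - x) <= expR (beta * y) - expR (beta * x).
Proof.
move=> x0 xy.
have -> : expR (beta * y) - expR (beta * x) =
    expR (beta * x) * (expR (beta * (y - x)) - 1).
  rewrite mulrBr mulr1 -expRD; congr (expR _ - _); ring.
have e1 : 1 <= expR (beta * x).
  by apply: le_trans (expR_ge1Dx _); rewrite lerDl mulr_ge0// ltW.
have h : beta * (y - x) <= expR (beta * (y - x)) - 1.
  by have := expR_ge1Dx (beta * (y - x)); lra.
apply: (le_trans h); rewrite ler_peMl//.
by apply: le_trans h; rewrite mulr_ge0 ?subr_ge0// ltW.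
Qed.

(** Two points on the same side of the vertex of a parabola and at almost the same
    height are close: away from the vertex the parabola falls at least as fast as
    the square of the distance. The same holds on the right in [right_of_peak]. *)
Lemma left_of_peak x y (theta eta : R) : 0 <= x -> x <= y -> y <= peak231 ->
  0 <= theta -> 0 <= eta -> K * eta <= theta ^+ 2 -> delta y <= delta x + eta ->
  y - x <= theta / beta.
Proof.
move=> x0 xy yp t0 e0 Kt h.
have p1 := ltW peak_lt1; have y1 := le_trans yp p1.
have uv : expR (beta * x) <= expR (beta * y) by rewrite ler_expR ler_pM2l.
rewrite ler_pdivlMr// mulrC; have := expR_scale_ge x0 xy.
have := parabola_le x0 (le_trans xy y1) (le_trans x0 xy) y1 e0 h.
move: yp uv; rewrite -expR_le_peak.
set u := expR (beta * x); set v := expR (beta * y) => vp uv h2 h1.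
apply: (le_trans h1); rewrite -(@ler_pXn2r _ 2) ?nnegrE ?subr_ge0//.
apply: le_trans Kt.
have : 0 <= (v - u) * (S / 2 - v) by rewrite mulr_ge0 ?subr_ge0.
have : K * eta >= v * (S - v) - u * (S - u) by lra.
rewrite expr2; lra.
Qed.

Lemma right_of_peak x y (theta eta : R) : peak231 <= x -> x <= y -> y <= 1 ->
  0 <= theta -> 0 <= eta -> K * eta <= theta ^+ 2 -> delta x <= delta y + eta ->
  y - x <= theta / beta.
Proof.
move=> px xy y1 t0 e0 Kt h; have x0 := le_trans (ltW peak_gt0) px.
have uv : expR (beta * x) <= expR (beta * y) by rewrite ler_expR ler_pM2l.
rewrite ler_pdivlMr// mulrC; have := expR_scale_ge x0 xy.
have := parabola_le (le_trans x0 xy) y1 x0 (le_trans xy y1) e0 h.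
move: px uv; rewrite -expR_ge_peak.
set u := expR (beta * x); set v := expR (beta * y) => up uv h2 h1.
apply: (le_trans h1); rewrite -(@ler_pXn2r _ 2) ?nnegrE ?subr_ge0//.
apply: le_trans Kt.
have : 0 <= (v - u) * (u - S / 2) by rewrite mulr_ge0 ?subr_ge0.
have : K * eta >= u * (S - u) - v * (S - v) by lra.
rewrite expr2; lra.
Qed.

(** The point of the parabola across the vertex at the height of [u] is [S - u],
    which is [expR (beta * (1 - f x))] for [u = expR (beta * x)]. *)
Lemma across_peak x y (theta eta : R) : 0 <= x -> x <= peak231 -> peak231 <= y ->
  y <= 1 -> 0 <= theta -> 0 <= eta -> K * eta <= theta ^+ 2 ->
  delta x <= delta y + eta -> delta y <= delta x + eta ->
  `|y - (1 - f x)| <= theta / beta.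
Proof.
move=> x0 xp py y1 t0 e0 Kt h1 h2.
have x1 := le_trans xp (ltW peak_lt1); have y0 := le_trans (ltW peak_gt0) py.
have := parabola_le x0 x1 y0 y1 e0 h2.
have := parabola_le y0 y1 x0 x1 e0 h1.
have sandwich : `|expR (beta * y) - expR (beta * (1 - f x))| <= theta ->
    `|y - (1 - f x)| <= theta / beta.
  move=> h; rewrite ler_pdivlMr// mulrC.
  have c0 : 0 <= 1 - f x by rewrite subr_ge0 f231_le1.
  have [yx|xy] := leP y (1 - f x).
    rewrite distrC ger0_norm ?subr_ge0//; apply: le_trans (expR_scale_ge y0 yx) _.
    by apply: le_trans h; rewrite distrC ler_norm.
  rewrite ger0_norm; last by rewrite subr_ge0 ltW.
  apply: (le_trans (expR_scale_ge c0 (ltW xy))).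
  by apply: le_trans h; rewrite ler_norm.
rewrite -gap_f231// in sandwich => g1 g2; apply: sandwich.
move: xp py; rewrite -expR_le_peak -expR_ge_peak /gap.
move: g1 g2; set u := expR (beta * x); set v := expR (beta * y) => g1 g2 up vp.
have [vu|vu] := leP (v - u) theta.
  by rewrite ler_norml; apply/andP; split; lra.
have tt : `|v - (S - u)| * (v - u) <= theta ^+ 2.
  have -> : `|v - (S - u)| * (v - u) = `|v * (S - v) - u * (S - u)|.
    rewrite -[in LHS](@ger0_norm _ (v - u)); last lra.
    rewrite -normrM -normrN; congr (`|_|); ring.
  by rewrite ler_norml; apply/andP; split; lra.
have vu0 : 0 < v - u := le_lt_trans t0 vu.
rewrite -(ler_pM2r vu0); apply: le_trans tt _.
by rewrite expr2 ler_wpM2l// ltW.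
Qed.

End peak.

Section classification.
Variable R : realType.
Implicit Types (beta eps : R).

Let next_code n (s : 'S_n) (i : 'I_n) :
  (s i)%:R = ((s i + icode s i).+1)%:R - 1 - (icode s i)%:R :> R.
Proof. by rewrite -natr1 natrD; ring. Qed.

(** By [icode_next] the first position [e] after [i] with a value above [s i] is
    [s i + icode s i + 1], and the code at [i] is at most the code at any position
    between them and at least the code at [e]. The code being close to
    the unimodal profile [x - f x], either [e] is close to [i], and then [s i] is
    close to [i - icode s i], that is to [n * f (i / n)]; or [i] and [e] are on both
    sides of the peak at almost the same height, and then [e] is close to
    [n * (1 - f (i / n))] by [across_peak] and [s i] to [n - i]. The second case is
    that of the ancestors of the peak position [p], whose number before [k] is a
    minimum of the code, hence close to [n * (k / n - f (k / n))] for [k <= p], and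
    constant afterwards. *)
Lemma two_curves_gt0 beta eps : 0 < beta -> 0 < eps ->
  exists e : R, 0 < e /\ exists N : nat, forall n (s : 'S_n), (N <= n)%N -> (0 < n)%N ->
    avoids231 s -> ~~ far (depth231 beta) e s ->
    two_curves (f231 beta) (fun x => 1 - x) (spine_mass beta) eps s.
Proof.
move=> b0 e0; pose theta := beta * eps / 3.
have t0 : 0 < theta by rewrite divr_gt0// mulr_gt0.
have tb : theta / beta = eps / 3 by rewrite /theta; field; rewrite gt_eqF.
pose K := beta * expR beta ^+ 2.
have K0 : 0 < K by rewrite mulr_gt0// exprn_gt0// expR_gt0.
pose L := 1 + expR beta; have L0 : 0 < L by rewrite addr_gt0 ?expR_gt0.
(* the errors below are at most [2 * e + L / n] *)
pose e := Num.min (eps / 6) (theta ^+ 2 / (4 * K)).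
have e_gt0 : 0 < e by rewrite lt_min divr_gt0//= divr_gt0 ?exprn_gt0// mulr_gt0.
exists e; split => //.
exists (Num.bound (L / e)) => n s Nn n0 av nfar.
have nR : 0 < n%:R :> R by rewrite ltr0n.
have Ln : L / n%:R <= e.
  rewrite ler_pdivrMr// mulrC -ler_pdivrMr//.
  apply: le_trans (_ : (Num.bound (L / e))%:R <= _); last by rewrite ler_nat.
  by rewrite ltW// archi_boundP// divr_ge0// ltW.
have n1 : n%:R^-1 <= e.
  apply: le_trans Ln; rewrite ler_peMl ?invr_ge0// /L lerDl expR_ge0 //.
have ee : e <= eps / 6 by rewrite ge_min lexx.
have Ke : K * (3 * e) <= theta ^+ 2.
  have : e <= theta ^+ 2 / (4 * K) by rewrite ge_min lexx orbT.
  rewrite ler_pdivlMr ?(mulr_gt0 _ K0)//; have : 0 < e * K := mulr_gt0 e_gt0 K0.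
  lra.
have le1 k : (k <= n)%N -> k%:R / n%:R <= 1 :> R.
  by move=> kn; rewrite ler_pdivrMr// mul1r ler_nat.
have ge0 k : 0 <= k%:R / n%:R :> R by rewrite divr_ge0.
pose dl (x : R) := x - f231 beta x.
have close k : (k <= n)%N -> `|(icode s k)%:R / n%:R - dl (k%:R / n%:R)| <= e.
  rewrite leq_eqVlt => /orP[/eqP ->|kn].
    by rewrite icode_n /dl divff ?gt_eqF// f231_1 !(subrr, mul0r) normr0 ltW.
  move/existsPn: nfar => /(_ (Ordinal kn)); rewrite -leNgt /depth231 b0 /= => h.
  rewrite -(ler_pM2r nR) -[X in _ * X](@gtr0_norm _ n%:R)// -normrM mulrBl.
  by rewrite divfK ?gt_eqF// [X in _ - X]mulrC.
have dlB k m : (k <= n)%N -> (m <= n)%N -> (icode s m <= icode s k)%N ->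
    dl (m%:R / n%:R) <= dl (k%:R / n%:R) + 2 * e.
  move=> kn mn h.
  have : (icode s m)%:R / n%:R <= (icode s k)%:R / n%:R :> R.
    by rewrite ler_pM2r ?invr_gt0// ler_nat.
  have := close k kn; have := close m mn; rewrite !ler_norml => /andP[? ?] /andP[? ?].
  lra.
pose xs := peak231 beta.
have xs0 := peak_gt0 b0; have xs1 := peak_lt1 b0.
pose p := Num.truncn (xs * n%:R).
have /truncn_itv/andP[] : 0 <= xs * n%:R by rewrite mulr_ge0// ltW.
rewrite -/p => p_le p_lt.
have p_xs : p%:R / n%:R <= xs by rewrite ler_pdivrMr.
have xs_p k : (p < k)%N -> xs < k%:R / n%:R.
  by move=> pk; rewrite ltr_pdivlMr//; apply: lt_le_trans p_lt _; rewrite ler_nat.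
have xs_k k : (k <= p)%N -> k%:R / n%:R <= xs.
  by move=> kp; apply: le_trans p_xs; rewrite ler_pM2r ?invr_gt0// ler_nat.
have pn : (p < n)%N.
  by rewrite -(ltr_nat R); apply: le_lt_trans p_le _; rewrite gtr_pMl.
have step1 k : k.+1%:R / n%:R - k%:R / n%:R = n%:R^-1 :> R.
  by rewrite -mulrBl -natrB// subSnn mul1r.
exists (ancestor s p), (pred1 (Ordinal pn)); split.
- move=> k kn; rewrite [X in _ - X]mulrC -[X in X - _](divfK (negbT (gt_eqF nR))) -mulrBl.
  rewrite normrM (gtr0_norm nR) ler_pM2r//.
  have [kp|pk] := leqP k p.
    rewrite /spine_mass min_l ?xs_k//.
    have up := card_ancestor_le av kp.
    have [m [km mp lo]] := card_ancestor_ge s kp pn.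
    have mn : (m <= n)%N by rewrite (leq_trans mp)// ltnW.
    move: up lo; set c := #|_| => up lo.
    have up' : c%:R / n%:R <= (icode s k)%:R / n%:R :> R by rewrite ler_pM2r ?invr_gt0// ler_nat.
    have lo' : (icode s m)%:R / n%:R <= c%:R / n%:R :> R by rewrite ler_pM2r ?invr_gt0// ler_nat.
    have := close k kn; have := close m mn; rewrite !ler_norml => /andP[? ?] /andP[? ?].
    have : dl (k%:R / n%:R) <= dl (m%:R / n%:R).
      by apply: delta_mono => //; rewrite ?xs_k// ler_pM2r ?invr_gt0// ler_nat.
    by rewrite -/(dl (k%:R / n%:R)) => ?; apply/andP; split; lra.
  rewrite card_ancestor ?(ltnW pk)// /spine_mass min_r ?(ltW (xs_p _ pk))//.
  have := close p (ltnW pn); rewrite /dl !ler_norml => /andP[? ?].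
  have : dl (p%:R / n%:R) <= dl xs by apply: delta_mono.
  have : dl xs <= dl (p%:R / n%:R) + n%:R^-1.
    have : xs - p%:R / n%:R <= n%:R^-1.
      by rewrite -[leRHS](step1 p) lerD2r ler_pdivlMr// ltW.
    have /andP[+ _] := f231_incr b0 p_xs (ltW xs1).
    have : 0 <= (xs - p%:R / n%:R) * slope beta (p%:R / n%:R).
      by rewrite mulr_ge0 ?subr_ge0// slope_ge0// le1// ltnW.
    rewrite /dl; lra.
  rewrite /dl -/xs => ? ?; apply/andP; split; lra.
- rewrite card1; move: n1; rewrite -ler_pdivrMr// div1r; lra.
- move=> i _ Ai.
  have ip : (i < p)%N by case/andP: Ai.
  move: Ai; rewrite ancestor_next// pval_ord; set q := (s i + icode s i)%N => pe.
  have := icode_next av (ltn_ord i); rewrite pval_ord -/q => -[ie en below above].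
  have e1n : (q <= n)%N by rewrite ltnW.
  (* the codes at [i] and just before [q.+1] are compared by [icode_gt], the codes
     at [q.+1] and [i] by [icode_next_leq] *)
  have h1 : dl (q.+1%:R / n%:R) <= dl (i%:R / n%:R) + 2 * e.
    apply: dlB => //; first exact: ltnW.
    by apply: icode_next_leq => //; rewrite pval_ord.
  have h2 : dl (i%:R / n%:R) <= dl (q%:R / n%:R) + 2 * e.
    apply: dlB => //; first exact: ltnW.
    have ie1 : (i < q)%N by apply: leq_trans ip _.
    by apply/ltnW/icode_gt => //; rewrite pval_ord; apply: below.
  have h3 : dl (q%:R / n%:R) <= dl (q.+1%:R / n%:R) + expR beta / n%:R.
    have step : q%:R / n%:R <= q.+1%:R / n%:R :> R by rewrite ler_pM2r ?invr_gt0// ler_nat.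
    have /andP[_ h] := f231_incr b0 step (le1 _ en).
    have : (q.+1%:R / n%:R - q%:R / n%:R) * slope beta (q.+1%:R / n%:R) <=
        n%:R^-1 * expR beta.
      by rewrite step1 ler_wpM2l ?invr_ge0// slope_le// le1.
    rewrite /dl [expR beta / _]mulrC; lra.
  have Lb : expR beta / n%:R <= e.
    by apply: le_trans Ln; rewrite ler_pM2r ?invr_gt0// /L lerDr.
  have e3 : 0 <= 3 * e by rewrite mulr_ge0// ltW.
  have : `|q.+1%:R / n%:R - (1 - f231 beta (i%:R / n%:R))| <= eps / 3.
    rewrite -tb; apply: (@across_peak _ _ b0 _ _ theta (3 * e)) => //.
    - exact: xs_k (ltnW ip).
    - exact/ltW/xs_p.
    - exact: le1.
    - exact: ltW.
    - by rewrite -/(dl (i%:R / n%:R)) -/(dl (q.+1%:R / n%:R)); lra.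
    - by rewrite -/(dl (i%:R / n%:R)) -/(dl (q.+1%:R / n%:R)); lra.
  have ni0 : 0 <= n%:R^-1 :> R by rewrite invr_ge0.
  have := close i (ltnW (ltn_ord i)); rewrite (next_code s i) -/q !mulrBl mul1r.
  rewrite /dl !ler_norml => /andP[? ?] /andP[? ?]; apply/andP; split; lra.
- move=> i Ei Ai; set q := (s i + icode s i)%N.
  have := icode_next av (ltn_ord i); rewrite pval_ord -/q => -[ie en below above].
  have i_n := ltnW (ltn_ord i).
  have e2 : 0 <= 2 * e by rewrite mulr_ge0// ltW.
  have Ke2 : K * (2 * e) <= theta ^+ 2.
    by apply: le_trans Ke; rewrite ler_pM2l// ler_pM2r//; lra.
  suff : `|q.+1%:R / n%:R - i%:R / n%:R| <= eps / 3 + n%:R^-1.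
    have := close i i_n; rewrite (next_code s i) -/q !mulrBl mul1r.
    rewrite /dl !ler_norml => /andP[? ?] /andP[? ?]; apply/andP; split; lra.
  have ile k : (i <= k)%N -> i%:R / n%:R <= k%:R / n%:R :> R.
    by move=> ik; rewrite ler_pM2r ?invr_gt0// ler_nat.
  rewrite ger0_norm ?subr_ge0 ?ile 1?ltnW//.
  case: (ltngtP i p) => [ip|pi|ip]; last first.
  + by move: Ei; rewrite /= -val_eqE /= ip eqxx.
  + have E : q.+1%:R / n%:R = q%:R / n%:R + n%:R^-1 :> R by rewrite -[X in _ = _ + X](step1 q) addrC subrK.
    rewrite E addrAC lerD2r -tb.
    have ie1 : (i <= q)%N by rewrite -ltnS.
    have e1n : (q <= n)%N by rewrite ltnW.
    apply: (@right_of_peak _ _ b0 _ _ theta (2 * e)) => //; rewrite ?ile ?le1 ?(ltW t0)//.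
      exact/ltW/xs_p.
    apply: dlB => //; move: ie1; rewrite leq_eqVlt => /orP[/eqP <-//|ie1].
    by apply/ltnW/icode_gt => //; rewrite pval_ord; apply: below.
  + apply: (@le_trans _ _ (eps / 3)); last by rewrite lerDl invr_ge0.
    rewrite -tb.
    have ep : (q.+1 <= p)%N.
      by move: Ai; rewrite ancestor_next// pval_ord -leqNgt.
    apply: (@left_of_peak _ _ b0 _ _ theta (2 * e)) => //;
      rewrite ?ile ?xs_k ?(ltW t0) ?(ltnW ie)//.
    apply: dlB => //.
    by apply: icode_next_leq => //; rewrite pval_ord.
Qed.

(** The distance [c i] from [i] to the next larger value, minus one, is
    [s i + icode s i - i]. As [s] is a permutation, these have the same sum as the
    code, which is small, so that few of them are large; for the others [s i] is close
    to [i]. *)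
Lemma two_curves_flat eps : 0 < eps ->
  exists e : R, 0 < e /\ forall n (s : 'S_n), (0 < n)%N ->
    avoids231 s -> ~~ far (fun=> 0) e s ->
    two_curves id id (fun=> 0) eps s.
Proof.
move=> e0; pose e := Num.min eps (eps ^+ 2).
exists e; split; first by rewrite lt_min e0 exprn_gt0.
move=> n s n0 av nfar; have nR : 0 < n%:R :> R by rewrite ltr0n.
have e1 : e <= eps by rewrite ge_min lexx.
have e2 : e <= eps ^+ 2 by rewrite ge_min lexx orbT.
have dle (i : 'I_n) : (icode s i)%:R <= e * n%:R.
  move/existsPn: nfar => /(_ i); rewrite -leNgt mulr0 subr0 ger0_norm//.
pose c (i : 'I_n) := (s i + icode s i - i)%N.
have cE (i : 'I_n) : (i + c i = s i + icode s i)%N.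
  have := icode_next av (ltn_ord i); rewrite pval_ord /= ltnS => -[? _ _ _].
  by rewrite /c subnKC.
have csum : (\sum_(i < n) c i = \sum_(i < n) icode s i)%N.
  apply/eqP; rewrite -(eqn_add2l (\sum_(i < n) i)) -big_split /=.
  rewrite (eq_bigr _ (fun i _ => cE i)) big_split /= eqn_add2r.
  by rewrite [X in _ == X](reindex_inj (@perm_inj _ s)).
pose E := [pred i : 'I_n | eps * n%:R < (c i)%:R].
exists pred0, E; split => //.
- move=> k _; rewrite (@eq_card0 _ [pred i : 'I_n | _]).
    by rewrite mulr0 subrr normr0 mulr_ge0// ltW.
  by move=> i; rewrite !inE andbF.
- have : #|E|%:R * (eps * n%:R) <= (\sum_(i < n) c i)%:R.
    rewrite natr_sum mulr_natl -sumr_const big_mkcond; apply: ler_sum => i _.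
    by rewrite inE; case: ifP => // /ltW.
  rewrite csum natr_sum => h.
  have h2 : \sum_(i < n) (icode s i)%:R <= n%:R * (e * n%:R).
    rewrite mulr_natl -[X in _ *+ X]card_ord -sumr_const; exact: ler_sum.
  have en : 0 < eps * n%:R by rewrite mulr_gt0.
  rewrite -(ler_pM2r en); apply: (le_trans h); apply: (le_trans h2).
  have : e * (n%:R * n%:R) <= eps ^+ 2 * (n%:R * n%:R) by rewrite ler_wpM2r// mulr_ge0.
  rewrite expr2; lra.
- move=> i; rewrite /E /= -leNgt => ci _.
  rewrite -mulrBl normrM (gtr0_norm (_ : 0 < n%:R^-1)) ?invr_gt0// ler_pdivrMr//.
  have -> : (s i)%:R - i%:R = (c i)%:R - (icode s i)%:R :> R.
    have := congr1 (fun k => k%:R : R) (cE i); rewrite /= !natrD; lra.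
  have := dle i; have : e * n%:R <= eps * n%:R by rewrite ler_wpM2r.
  have : 0 <= (c i)%:R :> R by []. have : 0 <= (icode s i)%:R :> R by [].
  by rewrite ler_norml => ? ? ? ?; apply/andP; split; lra.
Qed.

End classification.

(** * Uniformly continuous functions on the unit square *)

Section uniform_continuity.
Variable R : realType.
Implicit Types (g : R * R -> R) (z w : R * R).

Definition ucont_square g : Prop := forall e : R, 0 < e -> exists2 dl : R, 0 < dl &
  forall z w, unit_square z -> unit_square w ->
    `|z.1 - w.1| <= dl -> `|z.2 - w.2| <= dl -> `|g z - g w| <= e.

Lemma unit_itvE (x : R) : unit_itv x <-> (0 <= x) && (x <= 1).
Proof. by rewrite /unit_itv /= in_itv. Qed.

Lemma compact_unit_square : compact (@unit_square R : set (R * R)).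
Proof. by apply: compact_setX; exact: segment_compact. Qed.

(** The Heine-Cantor theorem, with the distance of the plane spelled out on
    coordinates. *)
Lemma continuous_ucont_square g :
  {within unit_square, continuous g} -> ucont_square g.
Proof.
move=> /subspace_continuousP cg e e0.
pose P (dl : R) z := forall w, unit_square w ->
  `|z.1 - w.1| <= dl -> `|z.2 - w.2| <= dl -> `|g z - g w| <= e.
have : \forall dl \near 0^'+, @unit_square R `<=` P dl.
  move/compact_near_coveringP/near_covering_withinP: compact_unit_square.
  apply => x Kx; have e2 : 0 < e / 2 by rewrite divr_gt0.
  have /cvgrPdist_lt/(_ _ e2) := cg x Kx.
  rewrite near_withinE => /nbhs_ballP[r /= r0 hr].
  have r2 : 0 < r / 2 by rewrite divr_gt0.
  exists (ball x (r / 2), [set dl | dl < r / 2]).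
    split; first exact: nbhsx_ballx.
    by apply: nbhs_right_lt.
  move=> [z dl] /= [[xz1 xz2] dlr] Kz w Kw zw1 zw2.
  have gz : `|g x - g z| < e / 2.
    apply: hr Kz; split => /=; first by apply: le_ball xz1; lra.
    by apply: le_ball xz2; lra.
  have gw : `|g x - g w| < e / 2.
    have tri (a b c : R) : `|a - b| < r / 2 -> `|b - c| <= dl -> `|a - c| < r.
      by move=> h1 h2; have := ler_distD b a c; lra.
    by apply: hr Kw; split => /=; rewrite /ball /=; [apply: tri xz1 zw1|apply: tri xz2 zw2].
  have -> : g z - g w = (g x - g w) - (g x - g z) by ring.
  by have := ler_normB (g x - g w) (g x - g z); lra.
move=> near_dl.
have : \forall dl \near 0^'+, 0 < dl /\ @unit_square R `<=` P dl.
  exact: (filterI (nbhs_right_gt 0) near_dl).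
move=> /filter_ex[dl [dl0 hdl]]; exists dl => // z w Kz Kw.
exact: hdl.
Unshelve. all: by end_near. Qed.

Lemma inv_bound_le (dl : R) : 0 < dl -> (Num.bound dl^-1).+1%:R^-1 <= dl.
Proof.
move=> dl0; rewrite invf_ple ?posrE// ltW//.
have i0 : 0 <= dl^-1 by rewrite invr_ge0 ltW.
by apply: lt_le_trans (archi_boundP i0) _; rewrite ler_nat.
Qed.

(** Walk from the origin to [z] in [N] equal steps, each changing [g] by at most
    [1]. *)
Lemma ucont_square_bounded g : ucont_square g ->
  exists C : R, 0 <= C /\ forall z, unit_square z -> `|g z| <= C.
Proof.
move=> /(_ 1 ltr01)[dl dl0 hdl].
pose N := (Num.bound dl^-1).+1.
have N0 : 0 < N%:R :> R by rewrite ltr0n.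
have Ndl : N%:R^-1 <= dl.
  exact: inv_bound_le.
exists (`|g (0, 0)| + N%:R); split; first by rewrite addr_ge0.
move=> z [/unit_itvE/andP[z10 z11] /unit_itvE/andP[z20 z21]].
pose y (k : nat) : R * R := (k%:R / N%:R * z.1, k%:R / N%:R * z.2).
have ysq k : (k <= N)%N -> unit_square (y k).
  move=> kN; have k0 : 0 <= k%:R / N%:R :> R by rewrite divr_ge0.
  have k1 : k%:R / N%:R <= 1 :> R by rewrite ler_pdivrMr// mul1r ler_nat.
  by split; apply/unit_itvE; rewrite mulr_ge0//= mulr_ile1.
have chain k : (k <= N)%N -> `|g (y k)| <= `|g (0, 0)| + k%:R.
  elim: k => [|k IH] kN; first by rewrite /y !mul0r addr0.
  have step (x : R) : 0 <= x -> x <= 1 -> `|k.+1%:R / N%:R * x - k%:R / N%:R * x| <= dl.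
    move=> x0 x1; rewrite -mulrBl -mulrBl -natrB// subSnn mul1r.
    by rewrite ger0_norm ?mulr_ge0 ?invr_ge0//; apply: le_trans Ndl; rewrite ler_piMr ?invr_ge0.
  have := hdl (y k.+1) (y k) (ysq _ kN) (ysq _ (ltnW kN)) (step _ z10 z11) (step _ z20 z21).
  have := IH (ltnW kN); have := ler_distD 0 (g (y k.+1)) (g (y k)).
  have := ler_normD (g (y k.+1) - g (y k)) (g (y k)); rewrite subrK -natr1; lra.
have := chain N (leqnn N); rewrite /y divff ?gt_eqF// !mul1r.
by case: z {z10 z11 z20 z21 y ysq chain}.
Qed.

(** A superlevel set is the union of the grid cells contained in it. *)
Lemma ucont_square_measurable g : ucont_square g ->
  measurable_fun (@unit_square R) (g : plane R -> measurableTypeR R).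
Proof.
move=> ug mD; apply: (measurability _ (RGenOInfty.measurableE R)) => //.
move=> _ [_ [x ->] <-].
pose cell N a b : set (plane R) :=
  `[a%:R / N.+1%:R, a.+1%:R / N.+1%:R] `*` `[b%:R / N.+1%:R, b.+1%:R / N.+1%:R].
pose C N a b : set (plane R) := [set z | [/\ cell N a b z, unit_square z &
  forall w, cell N a b w -> unit_square w -> x < g w]].
have -> : @unit_square R `&` g @^-1` `]x, +oo[ =
    \bigcup_N \bigcup_a \bigcup_b C N a b.
  apply/seteqP; split => z; last first.
    move=> [N _ [a _ [b _ [cz sz h]]]]; split => //=.
    by rewrite in_itv /= andbT h.
  move=> [sz]; rewrite /= in_itv /= andbT => xg.
  have e0 : 0 < (g z - x) / 2 by rewrite divr_gt0// subr_gt0.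
  have [dl dl0 hdl] := ug _ e0.
  pose N := Num.bound dl^-1.
  have N0 : 0 < N.+1%:R :> R by rewrite ltr0n.
  have Ndl : N.+1%:R^-1 <= dl.
    exact: inv_bound_le.
  have [/unit_itvE/andP[z10 z11] /unit_itvE/andP[z20 z21]] := sz.
  have tr (t : R) : 0 <= t -> (Num.truncn (t * N.+1%:R))%:R / N.+1%:R <= t /\
      t <= (Num.truncn (t * N.+1%:R)).+1%:R / N.+1%:R.
    move=> t0; have : 0 <= t * N.+1%:R by rewrite mulr_ge0.
    move=> /truncn_itv/andP[h1 h2].
    by split; [rewrite ler_pdivrMr|rewrite ler_pdivlMr// ltW].
  have width (a : nat) : a.+1%:R / N.+1%:R - a%:R / N.+1%:R <= dl.
    by rewrite -mulrBl -natrB// subSnn mul1r.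
  have diff (A B s t : R) : A - B <= dl -> B <= s -> s <= A -> B <= t -> t <= A ->
      `|s - t| <= dl.
    by move=> *; rewrite ler_norml; apply/andP; split; lra.
  have [a1 a2] := tr _ z10; have [b1 b2] := tr _ z20.
  exists N => //; exists (Num.truncn (z.1 * N.+1%:R)) => //.
  exists (Num.truncn (z.2 * N.+1%:R)) => //; split => //.
    by split => /=; rewrite in_itv /=; apply/andP.
  move=> w [/=]; rewrite !in_itv /= => /andP[w1 w2] /andP[w3 w4] sw.
  have := hdl z w sz sw (diff _ _ _ _ (width _) a1 a2 w1 w2)
    (diff _ _ _ _ (width _) b1 b2 w3 w4).
  by have := ler_norm (g z - g w); lra.
apply: bigcupT_measurable => N; apply: bigcupT_measurable => a.
apply: bigcupT_measurable => b.
have [h|h] := pselect (forall w, cell N a b w -> unit_square w -> x < g w).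
  have -> : C N a b = cell N a b `&` unit_square.
    by apply/seteqP; split => z; [case|case].
  apply: measurableI => //.
  by apply: measurableX; exact: measurable_itv.
by have -> : C N a b = set0; [apply/seteqP; split => z // [_ _]|].
Qed.

End uniform_continuity.

(** * Integrals of slowly varying functions *)

Section integral_estimates.
Variable R : realType.
Local Notation leb := (@lebesgue_measure R).

Lemma integral_near_cst d (T : measurableType d) (nu : {measure set T -> \bar R})
    (D E : set T) (h : T -> R) (c w m : R) :
  measurable D -> measurable E -> measurable_fun D h ->
  (forall x, D x -> 0 <= h x) -> nu (D `\` E) = 0%E -> nu (D `&` E) = m%:E ->
  (forall x, D x -> E x -> `|h x - c| <= w) -> 0 <= c -> 0 <= w ->
  exists r, (\int[nu]_(x in D) (h x)%:E)%E = r%:E /\ `|r - c * m| <= w * m.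
Proof.
move=> mD mE mh h0 nuDE nuI hc c0 w0.
have mI : measurable (D `&` E) by exact: measurableI.
have mhE : measurable_fun D (EFin \o h) by exact/measurable_EFinP.
have mhI : measurable_fun (D `&` E) (EFin \o h).
  by apply: measurable_funS mhE => // x [].
have m0 : 0 <= m by rewrite -lee_fin -nuI measure_ge0.
have -> : (\int[nu]_(x in D) (h x)%:E = \int[nu]_(x in D `&` E) (h x)%:E)%E.
  rewrite (@ge0_negligible_integral _ _ _ _ D (D `\` E))//; first by rewrite setDD.
  exact: measurableD.
have up : (\int[nu]_(x in D `&` E) (h x)%:E <= ((c + w) * m)%:E)%E.
  rewrite EFinM -nuI -integral_cst//; apply: ge0_le_integral => //.
  - by move=> x [Dx _]; rewrite lee_fin h0.
  - by move=> x [Dx Ex]; rewrite lee_fin; have := hc x Dx Ex; rewrite ler_norml; lra.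
have low : ((Num.max (c - w) 0 * m)%:E <= \int[nu]_(x in D `&` E) (h x)%:E)%E.
  rewrite EFinM -nuI -integral_cst//; apply: ge0_le_integral => //.
  - by move=> x _; rewrite lee_fin le_max lexx orbT.
  - move=> x [Dx Ex]; rewrite lee_fin ge_max h0// andbT.
    by have := hc x Dx Ex; rewrite ler_norml; lra.
have fin : (\int[nu]_(x in D `&` E) (h x)%:E)%E \is a fin_num.
  rewrite ge0_fin_numE; first by rewrite (le_lt_trans up) ?ltry.
  by apply: integral_ge0 => x [Dx _]; rewrite lee_fin h0.
move: up low; rewrite -(fineK fin) !lee_fin => up low.
eexists; split; first by reflexivity.
have : (c - w) * m <= Num.max (c - w) 0 * m by rewrite ler_wpM2r// le_max lexx.
rewrite ler_norml => ?; apply/andP; split; lra.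
Qed.

(** Each cell has mass [1 / n], and [G] varies by at most [w] on it. *)
Lemma perm_permuton_integral n (s : 'S_n) (G : R * R -> R) (w : R) :
  (0 < n)%N -> measurable_fun (@unit_square R) (G : plane R -> measurableTypeR R) ->
  (forall z, unit_square z -> 0 <= G z) -> 0 <= w ->
  (forall z z', unit_square z -> unit_square z' ->
     `|z.1 - z'.1| <= n%:R^-1 -> `|z.2 - z'.2| <= n%:R^-1 -> `|G z - G z'| <= w) ->
  exists r, (\int[perm_permuton s]_(z in unit_square) (G z)%:E)%E = r%:E /\
    `|r - n%:R^-1 * \sum_(i < n) G (i%:R / n%:R, (s i)%:R / n%:R)| <= w.
Proof.
move=> n0 mG G0 w0 Gw; have nR : 0 < n%:R :> R by rewrite ltr0n.
pose mi (i : 'I_n) : {measure set (plane R) -> \bar R} :=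
  mscale (NngNum (ler0n R n)) (mrestr (leb \x leb)%E (measurable_perm_cell s i)).
pose m (k : nat) : {measure set (plane R) -> \bar R} :=
  if insub k is Some i then mi i else mzero.
have msq := @measurable_unit_square R.
have -> : (\int[perm_permuton s]_(z in unit_square) (G z)%:E =
    \sum_(i < n) \int[mi i]_(z in unit_square) (G z)%:E)%E.
  rewrite (@eq_measure_integral _ _ _ _ (msum m n)); last first.
    move=> A _ _; rewrite /perm_permuton /= /msum.
    by apply: eq_bigr => i _; rewrite /m (valK i).
  rewrite ge0_integral_measure_sum//.
  - by apply: eq_bigr => i _; rewrite /m (valK i).
  - exact/measurable_EFinP.
have in01 k : (k <= n)%N -> unit_itv (k%:R / n%:R : R).
  move=> kn; apply/unit_itvE; rewrite divr_ge0//=.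
  by rewrite ler_pdivrMr// mul1r ler_nat.
have cell_sub i : perm_cell s i `<=` @unit_square R.
  move=> z [] /=; rewrite !in_itv /= => /andP[a1 a2] /andP[b1 b2].
  have := in01 i.+1 (ltn_ord i) => /unit_itvE/andP[_ h1].
  have := in01 (s i).+1 (ltn_ord (s i)) => /unit_itvE/andP[_ h2].
  split; apply/unit_itvE; apply/andP; split.
  - by apply: le_trans a1; rewrite divr_ge0.
  - exact: le_trans h1.
  - by apply: le_trans b1; rewrite divr_ge0.
  - exact: le_trans h2.
have leb_cell k : leb `[(k%:R / n%:R : R), (k.+1%:R / n%:R)] = (n%:R^-1)%:E.
  rewrite lebesgue_measure_itv /= lte_fin ltr_pM2r ?invr_gt0// ltr_nat ltnSn.
  by rewrite -EFinD -mulrBl -natrB// subSnn mul1r.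
have miE i A : mi i A = (n%:R%:E * (leb \x leb)%E (A `&` perm_cell s i))%E by [].
have each i : exists r, (\int[mi i]_(z in unit_square) (G z)%:E)%E = r%:E /\
    `|r - G (i%:R / n%:R, (s i)%:R / n%:R) * n%:R^-1| <= w * n%:R^-1.
  have pt_sq : unit_square ((i%:R / n%:R, (s i)%:R / n%:R) : plane R).
    by split => /=; apply: in01; apply: ltnW; exact: ltn_ord.
  apply: (@integral_near_cst _ _ _ _ (perm_cell s i)) => //.
  - exact: measurable_perm_cell.
  - by rewrite miE setDE -setIA setICl setI0 measure0 mule0.
  - rewrite miE -setIA setIid (setIidr (cell_sub i)).
    rewrite /perm_cell product_measure1E; try exact: measurable_itv.
    transitivity (n%:R%:E * ((n%:R^-1)%:E * (n%:R^-1)%:E) : \bar R)%E.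
      by congr (_ * (_ * _))%E; exact: leb_cell.
    by rewrite -!EFinM mulrA divff ?mul1r// gt_eqF.
  - move=> z sz [] /=; rewrite !in_itv /= => /andP[a1 a2] /andP[b1 b2].
    have width k : k.+1%:R / n%:R - k%:R / n%:R = n%:R^-1 :> R.
      by rewrite -mulrBl -natrB// subSnn mul1r.
    have close k (x : R) : k%:R / n%:R <= x -> x <= k.+1%:R / n%:R ->
        `|x - k%:R / n%:R| <= n%:R^-1.
      move=> h1 h2; rewrite -[leRHS](width k) ger0_norm ?subr_ge0//.
      by rewrite lerD2r.
    by apply: Gw => //=; apply: close.
  - by apply: G0.
pose r i := projT1 (cid (each i)).
have rP i : (\int[mi i]_(z in unit_square) (G z)%:E)%E = (r i)%:E /\
    `|r i - G (i%:R / n%:R, (s i)%:R / n%:R) * n%:R^-1| <= w * n%:R^-1.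
  exact: (projT2 (cid (each i))).
exists (\sum_(i < n) r i); split.
  by rewrite -sumEFin; apply: eq_bigr => i _; have [] := rP i.
rewrite mulr_sumr -sumrB; apply: le_trans (ler_norm_sum _ _ _) _.
apply: (@le_trans _ _ (\sum_(i < n) w * n%:R^-1)).
  by apply: ler_sum => i _; rewrite [n%:R^-1 * _]mulrC; have [] := rP i.
by rewrite sumr_const card_ord -[leLHS]mulr_natr divfK ?gt_eqF.
Qed.

(** Cut the interval into [M] strips, on which [h] varies by at most [w]; [Phi] is the
    distribution function of [nu]. *)
Lemma strips_integral (nu : {measure set (measurableTypeR R) -> \bar R})
    (h Phi : R -> R) (w : R) (M : nat) :
  (0 < M)%N -> measurable_fun (@unit_itv R) (h : measurableTypeR R -> measurableTypeR R) ->
  (forall x, unit_itv x -> 0 <= h x) -> 0 <= w ->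
  (forall x y, unit_itv x -> unit_itv y -> `|x - y| <= M%:R^-1 -> `|h x - h y| <= w) ->
  nu [set 0] = 0%E ->
  (forall x y : R, 0 <= x -> x <= y -> y <= 1 -> nu `]x, y]%classic = (Phi y - Phi x)%:E) ->
  exists r, (\int[nu]_(x in unit_itv) (h x)%:E)%E = r%:E /\
    `|r - \sum_(m < M) h (m%:R / M%:R) *
        (Phi (m.+1%:R / M%:R) - Phi (m%:R / M%:R))| <= w * (Phi 1 - Phi 0).
Proof.
move=> M0 mh h0 w0 hw nu0 nuPhi; have MR : 0 < M%:R :> R by rewrite ltr0n.
have le1 k : (k <= M)%N -> k%:R / M%:R <= 1 :> R.
  by move=> kM; rewrite ler_pdivrMr// mul1r ler_nat.
have ge0 k : 0 <= k%:R / M%:R :> R by rewrite divr_ge0.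
have mono k : k%:R / M%:R <= k.+1%:R / M%:R :> R.
  by rewrite ler_pM2r ?invr_gt0// ler_nat.
have width k : k.+1%:R / M%:R - k%:R / M%:R = M%:R^-1 :> R.
  by rewrite -mulrBl -natrB// subSnn mul1r.
have mhE D : measurable D -> D `<=` unit_itv -> measurable_fun D (EFin \o h).
  move=> mD Ds; apply/measurable_EFinP; apply: measurable_funS mh => //.
  exact: measurable_unit_itv.
have sub01 (x y : R) : 0 <= x -> y <= 1 -> `]x, y] `<=` (@unit_itv R).
  move=> x0 y1 z; rewrite /= in_itv /= => /andP[xz zy]; apply/unit_itvE.
  by rewrite (le_trans x0 (ltW xz)) (le_trans zy).
have -> : (\int[nu]_(x in unit_itv) (h x)%:E = \int[nu]_(x in `]0%R, 1%R]) (h x)%:E)%E.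
  rewrite (@ge0_negligible_integral _ _ _ _ unit_itv [set 0])//.
  - congr (integral _ _ _); apply/seteqP; split => z /=.
      move=> [/unit_itvE/andP[z0 z1] /eqP nz]; rewrite in_itv /= z1 andbT.
      by rewrite lt_neqAle eq_sym nz.
    rewrite in_itv /= => /andP[z0 z1]; split.
      by apply/unit_itvE; rewrite z1 ltW.
    by move=> z00; rewrite z00 ltxx in z0.
  - exact: measurable_unit_itv.
  - by apply: mhE => //; exact: measurable_unit_itv.
suff H k : (k <= M)%N ->
    exists r, (\int[nu]_(x in `]0%R, (k%:R / M%:R)%R]) (h x)%:E)%E = r%:E /\
    `|r - \sum_(m < k) h (m%:R / M%:R) *
        (Phi (m.+1%:R / M%:R) - Phi (m%:R / M%:R))| <= w * (Phi (k%:R / M%:R) - Phi 0).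
  by have := H M (leqnn M); rewrite divff ?gt_eqF.
elim: k => [|k IH] kM.
  exists 0; rewrite mul0r set_itv_ge ?bnd_simp ?ltxx// integral_set0.
  by rewrite big_ord0 !subrr mulr0 normr0.
have [r [rE rle]] := IH (ltnW kM).
have [t [tE tle]] : exists t,
    (\int[nu]_(x in `](k%:R / M%:R)%R, (k.+1%:R / M%:R)%R]) (h x)%:E)%E = t%:E /\
    `|t - h (k%:R / M%:R) * (Phi (k.+1%:R / M%:R) - Phi (k%:R / M%:R))| <=
    w * (Phi (k.+1%:R / M%:R) - Phi (k%:R / M%:R)).
  have kin : unit_itv (k%:R / M%:R : R).
    by apply/unit_itvE; rewrite ge0 le1// ltnW.
  apply: (@integral_near_cst _ _ _ _ setT) => //.
  - apply: measurable_funS mh; first exact: measurable_unit_itv.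
    exact: (sub01 _ _ (ge0 _) (le1 _ kM)).
  - by move=> x /(sub01 _ _ (ge0 _) (le1 _ kM)); exact: h0.
  - by rewrite setDT measure0.
  - by rewrite setIT nuPhi// le1.
  - move=> x xin _; apply: hw => //; first exact: sub01 (ge0 _) (le1 _ kM) _ xin.
    move: xin; rewrite /= in_itv /= => /andP[x1 x2].
    by rewrite -[leRHS](width k) ger0_norm ?subr_ge0 ?(ltW x1)// lerD2r.
  - exact: h0.
exists (r + t); split; last first.
  rewrite big_ord_recr /=; move: rle tle; set S := \sum_(_ < _) _.
  by rewrite !ler_norml => /andP[? ?] /andP[? ?]; apply/andP; split; lra.
rewrite EFinD -rE -tE -ge0_integral_setU//.
- congr (integral _ _ _); by rewrite -itv_bndbnd_setU ?bnd_simp ?ge0 ?mono.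
- by apply: mhE; [exact: measurableU|rewrite subUset; split; apply: sub01 => //; rewrite le1// ltnW].
- move=> x [|] xin; rewrite lee_fin h0//.
    by move: xin; apply: sub01 => //; rewrite le1// ltnW.
  by move: xin; apply: sub01 => //; rewrite le1.
- apply/disj_setPS => x [/=]; rewrite !in_itv /= => /andP[_ h1] /andP[h2 _].
  by have := lt_le_trans h2 h1; rewrite ltxx.
Qed.

End integral_estimates.

(** * Weak convergence of permutations following two curves *)

Section strips.
Variable R : realType.

Lemma ratio_between (M n i m : nat) : (0 < n)%N -> (0 < M)%N ->
  (i * M %/ n = m)%N -> m%:R / M%:R <= i%:R / n%:R :> R /\ i%:R / n%:R <= m.+1%:R / M%:R :> R.
Proof.
move=> n0 M0 im; have nR : 0 < n%:R :> R by rewrite ltr0n.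
have MR : 0 < M%:R :> R by rewrite ltr0n.
have := divn_eq (i * M) n; rewrite im => e.
have lt := ltn_pmod (i * M) n0.
split.
  rewrite ler_pdivrMr// mulrAC ler_pdivlMr// -!natrM ler_nat; lia.
rewrite ler_pdivlMr// mulrAC ler_pdivrMr// -!natrM ler_nat mulSn; lia.
Qed.

Lemma ceil_between (M n m : nat) (K := ((m * n + M.-1) %/ M)%N) : (0 < n)%N -> (0 < M)%N ->
  `|K%:R / n%:R - m%:R / M%:R| <= n%:R^-1 :> R.
Proof.
move=> n0 M0; have nR : 0 < n%:R :> R by rewrite ltr0n.
have MR : 0 < M%:R :> R by rewrite ltr0n.
have e := divn_eq (m * n + M.-1) M; have lt := ltn_pmod (m * n + M.-1) M0.
have h1 : m%:R / M%:R <= K%:R / n%:R :> R.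
  rewrite ler_pdivrMr// mulrAC ler_pdivlMr// -!natrM ler_nat /K; lia.
have h2 : K%:R / n%:R - n%:R^-1 <= m%:R / M%:R :> R.
  rewrite lerBlDr ler_pdivrMr// mulrDl mulVf ?gt_eqF// -lerBlDr.
  rewrite mulrAC ler_pdivlMr// mulrBl mul1r lerBlDr -!natrM -natrD ler_nat /K; lia.
by rewrite ger0_norm ?subr_ge0//; lra.
Qed.

(** The discrete counterpart of [strips_integral]: [h] is almost constant on the [M]
    strips, and the counting function of [A] gives the number of its indices in each
    of them. *)
Lemma strips_sum n M (A : pred 'I_n) (h Phi : R -> R) (w C e : R) :
  (0 < n)%N -> (0 < M)%N -> 0 <= w -> 0 <= C ->
  (forall x y, 0 <= x <= 1 -> 0 <= y <= 1 -> `|x - y| <= M%:R^-1 -> `|h x - h y| <= w) ->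
  (forall x, 0 <= x <= 1 -> `|h x| <= C) ->
  (forall x y, 0 <= x -> x <= y -> y <= 1 -> 0 <= Phi y - Phi x <= y - x) ->
  (forall k, (k <= n)%N -> `|#|[pred i : 'I_n | (i < k)%N && A i]|%:R -
     n%:R * Phi (k%:R / n%:R)| <= e * n%:R) ->
  `|n%:R^-1 * \sum_(i < n | A i) h (i%:R / n%:R) -
    \sum_(m < M) h (m%:R / M%:R) * (Phi (m.+1%:R / M%:R) - Phi (m%:R / M%:R))|
  <= w + M%:R * (C * (2 * e + 2 * n%:R^-1)).
Proof.
move=> n0 M0 w0 C0 hw hC PhiL cnt.
have nR : 0 < n%:R :> R by rewrite ltr0n.
have MR : 0 < M%:R :> R by rewrite ltr0n.
have in01 (k l : nat) : (0 < l)%N -> (k <= l)%N -> 0 <= (k%:R / l%:R : R) <= 1.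
  by move=> l0 kl; rewrite divr_ge0//= ler_pdivrMr ?ltr0n// mul1r ler_nat.
have strip_lt (i : 'I_n) : (i * M %/ n < M)%N.
  by rewrite ltn_divLR// mulnC ltn_pmul2l.
pose strip (i : 'I_n) : 'I_M := Ordinal (strip_lt i).
pose S (m : 'I_M) := [pred i : 'I_n | A i && (strip i == m)].
pose K m := ((m * n + M.-1) %/ M)%N.
have Kn m : (m <= M)%N -> (K m <= n)%N.
  move=> mM; rewrite /K -ltnS ltn_divLR// mulSn.
  have := leq_mul mM (leqnn n); lia.
have ltK (i : 'I_n) m : (i < K m)%N = (i * M %/ n < m)%N.
  rewrite ltn_divLR// /K.
  have e1 := divn_eq (m * n + M.-1) M; have lt := ltn_pmod (m * n + M.-1) M0.
  move: e1 lt; move: (_ %/ _)%N (_ %% _)%N => a b e1 lt.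
  by apply/idP/idP => lt'; nia.
pose c m := #|[pred i : 'I_n | (i < K m)%N && A i]|.
have cS (m : 'I_M) : c m.+1 = (c m + #|S m|)%N.
  rewrite /c -(cardID [pred i : 'I_n | (i < K m)%N] [pred i : 'I_n | (i < K m.+1)%N && A i]).
  congr (_ + _)%N; apply: eq_card => i; rewrite !inE !ltK.
    by rewrite ltnS; case: ltnP => [lt'|]; rewrite ?andbF// (ltnW lt') andbT.
  rewrite -leqNgt ltnS -val_eqE /= eqn_leq; case: (A i); rewrite ?andbF//= andbT.
  by rewrite andbC.
have c_close m : (m <= M)%N -> `|(c m)%:R - n%:R * Phi (m%:R / M%:R)| <= e * n%:R + 1.
  move=> mM; have := cnt _ (Kn _ mM); rewrite -/(c m).
  have PhiK : `|Phi ((K m)%:R / n%:R) - Phi (m%:R / M%:R)| <= n%:R^-1.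
    have := ceil_between m n0 M0; rewrite -/(K m).
    have /andP[x0 x1] := in01 _ _ n0 (Kn m mM); have /andP[y0 y1] := in01 _ _ M0 mM.
    have [xy|/ltW yx] := leP ((K m)%:R / n%:R : R) (m%:R / M%:R).
      have := PhiL _ _ x0 xy y1; rewrite !ler_norml => /andP[? ?] /andP[? ?].
      by apply/andP; split; lra.
    have := PhiL _ _ y0 yx x1; rewrite !ler_norml => /andP[? ?] /andP[? ?].
    by apply/andP; split; lra.
  have : `|n%:R * Phi ((K m)%:R / n%:R) - n%:R * Phi (m%:R / M%:R)| <= 1.
    rewrite -mulrBr normrM gtr0_norm//; apply: le_trans (ler_wpM2l (ltW nR) PhiK) _.
    by rewrite divff ?gt_eqF.
  move=> h1 h2.
  have := ler_distD (n%:R * Phi ((K m)%:R / n%:R)) (c m)%:R (n%:R * Phi (m%:R / M%:R)).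
  lra.
have S_close (m : 'I_M) :
    `|n%:R^-1 * #|S m|%:R - (Phi (m.+1%:R / M%:R) - Phi (m%:R / M%:R))| <=
    2 * e + 2 * n%:R^-1.
  rewrite -(ler_pM2l nR) -[X in X * `|_|](gtr0_norm nR) -normrM.
  set d := Phi _ - Phi _.
  have -> : n%:R * (n%:R^-1 * #|S m|%:R - d) = #|S m|%:R - n%:R * d.
    by field; rewrite gt_eqF.
  have -> : n%:R * (2 * e + 2 * n%:R^-1) = 2 * (e * n%:R) + 2.
    by field; rewrite gt_eqF.
  have := c_close m (ltnW (ltn_ord m)); have := c_close m.+1 (ltn_ord m).
  rewrite cS natrD /d !ler_norml => /andP[? ?] /andP[? ?]; apply/andP; split; lra.
rewrite (partition_big strip xpredT)//= mulr_sumr -sumrB.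
apply: le_trans (ler_norm_sum _ _ _) _.
apply: (@le_trans _ _ (\sum_(m < M) (n%:R^-1 * (w * #|S m|%:R) +
    C * (2 * e + 2 * n%:R^-1)))).
  apply: ler_sum => m _.
  set hm := h (m%:R / M%:R); set d := Phi _ - Phi _; set s := \sum_(_ < _ | _) _.
  have sE : `|s - hm * #|S m|%:R| <= w * #|S m|%:R.
    rewrite /s mulr_natr -sumr_const -sumrB; apply: le_trans (ler_norm_sum _ _ _) _.
    rewrite mulr_natr -sumr_const; apply: ler_sum => i /andP[_ /eqP im].
    have := @ratio_between M n i (strip i) n0 M0 erefl; rewrite im => -[r1 r2].
    apply: hw; [exact: in01 (ltnW (ltn_ord i))|exact: in01 (ltnW (ltn_ord _))|].
    rewrite ger0_norm ?subr_ge0//.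
    by apply: le_trans (lerD r2 (lexx _)) _; rewrite -mulrBl -natrB// subSnn mul1r.
  have -> : n%:R^-1 * s - hm * d =
      n%:R^-1 * (s - hm * #|S m|%:R) + hm * (n%:R^-1 * #|S m|%:R - d) by ring.
  apply: le_trans (ler_normD _ _) _; rewrite !normrM; apply: lerD.
    by rewrite ger0_norm ?invr_ge0// ler_wpM2l ?invr_ge0.
  apply: ler_pM => //.
  by apply: hC; apply: in01 => //; exact: ltnW.
rewrite big_split /= sumr_const card_ord -[X in _ + X]mulr_natl lerD2r.
rewrite -mulr_sumr -mulr_sumr mulrCA ler_piMr// ler_pdivrMl// mulr1.
rewrite -natr_sum ler_nat.
apply: (@leq_trans #|A|); last by rewrite -[leqRHS]card_ord max_card.
rewrite -sum1_card (partition_big strip xpredT)//=.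
by apply: leq_sum => m _; rewrite sum1_card.
Qed.

End strips.

Section two_curves_convergence.
Variable R : realType.
Implicit Types (phi psi Phi : R -> R).

(** Reduces the integration of bounded functions to nonnegative ones. *)
Let int_shift d (T : measurableType d) (m : {measure set T -> \bar R}) (D : set T)
    (f : T -> R) (C r : R) : measurable D -> measurable_fun D f -> m D = 1%E ->
  (forall x, D x -> 0 <= f x + C) -> (\int[m]_(x in D) (f x + C)%:E)%E = r%:E ->
  (\int[m]_(x in D) (f x)%:E)%E = (r - C)%:E.
Proof.
move=> mD mf mD1 f0 fr.
have mfC : measurable_fun D (fun x => f x + C) by apply: measurable_funD.
have i1 : m.-integrable D (EFin \o (fun x => f x + C)).
  apply/integrableP; split; first exact/measurable_EFinP.
  rewrite (eq_integral (fun x => (f x + C)%:E)) ?fr ?ltry// => x /set_mem Dx /=.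
  by rewrite ger0_norm ?f0.
have i2 : m.-integrable D (EFin \o (fun _ : T => C)).
  apply/integrableP; split; first exact/measurable_EFinP.
  by rewrite /= integral_cst// mD1 mule1 ltry.
rewrite (eq_integral (fun x => ((f x + C)%:E - C%:E)%E)); last first.
  by move=> x _; rewrite -EFinB addrK.
rewrite (integralB_EFin mD i1 i2) fr integral_cst// mD1 mule1.
by rewrite EFinB.
Qed.

Variables (phi psi Phi : R -> R) (L : R).
Variables (nu1 nu2 : {measure set (measurableTypeR R) -> \bar R})
  (mu : {measure set (plane R) -> \bar R}).
Hypothesis L0 : 0 <= L.
Hypothesis phi01 : forall x, unit_itv x -> unit_itv (phi x).
Hypothesis psi01 : forall x, unit_itv x -> unit_itv (psi x).
Hypothesis phiL : forall x y, unit_itv x -> unit_itv y -> `|phi x - phi y| <= L * `|x - y|.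
Hypothesis psiL : forall x y, unit_itv x -> unit_itv y -> `|psi x - psi y| <= L * `|x - y|.
Hypothesis mphi : measurable_fun setT (fun x : measurableTypeR R => (x, phi x) : plane R).
Hypothesis mpsi : measurable_fun setT (fun x : measurableTypeR R => (x, psi x) : plane R).
Hypothesis PhiL : forall x y, 0 <= x -> x <= y -> y <= 1 -> 0 <= Phi y - Phi x <= y - x.
Hypothesis nu1_0 : nu1 [set 0] = 0%E.
Hypothesis nu2_0 : nu2 [set 0] = 0%E.
Hypothesis nu1E : forall x y : R, 0 <= x -> x <= y -> y <= 1 ->
  nu1 `]x, y]%classic = ((y - Phi y) - (x - Phi x))%:E.
Hypothesis nu2E : forall x y : R, 0 <= x -> x <= y -> y <= 1 ->
  nu2 `]x, y]%classic = (Phi y - Phi x)%:E.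
Hypothesis mu1 : mu unit_square = 1%E.
Hypothesis muE : forall G : R * R -> R,
  measurable_fun unit_square (G : plane R -> measurableTypeR R) ->
  (forall z, unit_square z -> 0 <= G z) ->
  (\int[mu]_(z in unit_square) (G z)%:E =
   \int[nu1]_(x in unit_itv) (G (x, phi x))%:E +
   \int[nu2]_(x in unit_itv) (G (x, psi x))%:E)%E.

(** At every scale [1 / M], [perm_permuton_integral] replaces the integral against
    the permuton of [s n] by an average over the points of [s n], [two_curves] moves
    these points onto the two graphs, and [strips_sum] and [strips_integral] compare
    the average along each graph with the integral against [nu1] or [nu2]. A constant
    [C] is added to [f] to integrate nonnegative functions. *)
Lemma two_curves_cvg (s : forall n, 'S_n) :
  (forall e : R, 0 < e -> exists N, forall n, (N <= n)%N -> (0 < n)%N ->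
     two_curves phi psi Phi e (s n)) ->
  permuton_cvg s mu.
Proof.
move=> tc f /continuous_ucont_square uf.
have PhiL' (x y : R) : 0 <= x -> x <= y -> y <= 1 ->
    0 <= (y - Phi y) - (x - Phi x) <= y - x.
  by move=> x0 xy y1; have /andP[? ?] := PhiL x0 xy y1; apply/andP; split; lra.
have dist_complement (x y z u v : R) : x + y = z -> `|x - u| <= v ->
    `|y - (z - u)| <= v.
  by rewrite !ler_norml => ? /andP[? ?]; apply/andP; split; lra.
have dist_le_add (x y v c : R) : 0 <= v -> 0 <= x -> x <= c -> 0 <= y -> y <= c ->
    `|x - y| <= v + c.
  by move=> *; rewrite ler_norml; apply/andP; split; lra.
have mf := ucont_square_measurable uf.
have [C [C0 fC]] := ucont_square_bounded uf.
have msq := @measurable_unit_square R.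
pose G z := f z + C.
have G0 z : unit_square z -> 0 <= G z.
  by move=> /fC; rewrite /G ler_norml; lra.
have G2 z : unit_square z -> G z <= 2 * C.
  by move=> /fC; rewrite /G ler_norml; lra.
have mG : measurable_fun unit_square (G : plane R -> measurableTypeR R).
  by apply: measurable_funD.
have GB z w : G z - G w = f z - f w by rewrite /G; ring.
have sqx (chi : R -> R) (x : R) : (forall x, unit_itv x -> unit_itv (chi x)) ->
    unit_itv x -> @unit_square R (x, chi x).
  by move=> chi01 x01; split => //=; exact: chi01.
have mh (chi : R -> R) : (forall x, unit_itv x -> unit_itv (chi x)) ->
    measurable_fun setT (fun x : measurableTypeR R => (x, chi x) : plane R) ->
    measurable_fun (@unit_itv R)
      ((fun x => G (x, chi x)) : measurableTypeR R -> measurableTypeR R).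
  move=> chi01 mchi; apply: (measurable_comp msq _ mG (measurable_funTS mchi)).
  by move=> _ [x x01 <-]; exact: sqx.
have main eta : 0 < eta -> exists t, (\int[mu]_(z in unit_square) (G z)%:E)%E = t%:E /\
    exists N, forall n, (N <= n)%N -> (0 < n)%N ->
    exists r, (\int[perm_permuton (s n)]_(z in unit_square) (G z)%:E)%E = r%:E /\
      `|r - t| <= eta.
  move=> eta0; pose w := eta / 12; have w0 : 0 < w by rewrite divr_gt0.
  have [dl dl0 hdl] := uf _ w0.
  pose dl' := dl / (1 + L); have L1 : 0 < 1 + L by move: L0; lra.
  have dl'0 : 0 < dl' by rewrite divr_gt0.
  have dl'E : dl' + L * dl' = dl by rewrite /dl'; field; rewrite gt_eqF.
  pose M := (Num.bound dl'^-1).+1.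
  have Mdl : M%:R^-1 <= dl' := inv_bound_le dl'0.
  have Ldl' : 0 <= L * dl' by rewrite mulr_ge0// ltW.
  have hmod (chi : R -> R) : (forall x, unit_itv x -> unit_itv (chi x)) ->
      (forall x y, unit_itv x -> unit_itv y -> `|chi x - chi y| <= L * `|x - y|) ->
      forall x y, unit_itv x -> unit_itv y -> `|x - y| <= M%:R^-1 ->
      `|G (x, chi x) - G (y, chi y)| <= w.
    move=> chi01 chiL x y x01 y01 xy; rewrite GB.
    have xy' := le_trans xy Mdl.
    apply: hdl; rewrite /=; [exact: sqx|exact: sqx|lra|].
    apply: le_trans (chiL _ _ x01 y01) _.
    by have := ler_wpM2l L0 xy'; lra.
  have [t1 [t1E t1le]] := @strips_integral _ nu1 (fun x => G (x, phi x))
    (fun x => x - Phi x) w M isT (mh _ phi01 mphi)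
    (fun x x01 => G0 _ (sqx _ _ phi01 x01)) (ltW w0) (hmod _ phi01 phiL) nu1_0 nu1E.
  have [t2 [t2E t2le]] := @strips_integral _ nu2 (fun x => G (x, psi x))
    Phi w M isT (mh _ psi01 mpsi)
    (fun x x01 => G0 _ (sqx _ _ psi01 x01)) (ltW w0) (hmod _ psi01 psiL) nu2_0 nu2E.
  exists (t1 + t2); split; first by rewrite muE// t1E t2E.
  pose B := 1 + 2 * C + 16 * C * M%:R.
  have CM0 : 0 <= C * M%:R by rewrite mulr_ge0.
  have B0 : 0 < B by rewrite /B; lra.
  pose e := Num.min dl (eta / (2 * B)).
  have e0 : 0 < e by rewrite lt_min dl0 divr_gt0// mulr_gt0.
  have [N hN] := tc e e0.
  exists (maxn N (Num.bound e^-1).+1) => n; rewrite geq_max => /andP[Nn en] n0.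
  have nR : 0 < n%:R :> R by rewrite ltr0n.
  have n_e : n%:R^-1 <= e.
    apply: le_trans (inv_bound_le e0); rewrite lef_pV2 ?posrE ?ltr0n// ler_nat//.
  have e_dl : e <= dl by rewrite ge_min lexx.
  have eB : e * B <= eta / 2.
    have : e <= eta / (2 * B) by rewrite ge_min lexx orbT.
    by rewrite invfM mulrA ler_pdivlMr.
  have n_dl := le_trans n_e e_dl.
  have Gmod z z' : unit_square z -> unit_square z' ->
      `|z.1 - z'.1| <= dl -> `|z.2 - z'.2| <= dl -> `|G z - G z'| <= w.
    by move=> *; rewrite GB; exact: hdl.
  have [r [rE rle]] := @perm_permuton_integral _ n (s n) G w n0 mG G0 (ltW w0)
    (fun z z' sz sz' h1 h2 => Gmod z z' sz sz' (le_trans h1 n_dl) (le_trans h2 n_dl)).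
  exists r; split => //.
  have [A [E [cnt Ecard psi_close phi_close]]] := hN n Nn n0.
  have in01 (i : 'I_n) (j : nat) : (j < n)%N -> unit_itv (j%:R / n%:R : R).
    move=> jn; apply/unit_itvE; rewrite divr_ge0//= ler_pdivrMr// mul1r ler_nat.
    exact: ltnW.
  pose chi (i : 'I_n) := if A i then psi else phi.
  pose a (i : 'I_n) := G (i%:R / n%:R, (s n i)%:R / n%:R).
  pose b (i : 'I_n) := G (i%:R / n%:R, chi i (i%:R / n%:R)).
  have ab_le (i : 'I_n) : `|a i - b i| <= w + (if E i then 2 * C else 0).
    have i01 := in01 i i (ltn_ord i); have si01 := in01 i (s n i) (ltn_ord _).
    have chi01 : unit_itv (chi i (i%:R / n%:R)).
      by rewrite /chi; case: ifP => _; [exact: psi01|exact: phi01].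
    have sa : @unit_square R (i%:R / n%:R, (s n i)%:R / n%:R) by [].
    have sb : @unit_square R (i%:R / n%:R, chi i (i%:R / n%:R)) by [].
    case: ifP => Ei.
      by apply: dist_le_add; rewrite ?G0 ?G2// ltW.
    rewrite addr0; apply: Gmod => //=; first by rewrite subrr normr0 ltW.
    apply: le_trans e_dl; rewrite /chi; case: ifPn => Ai.
      by apply: psi_close => //; rewrite Ei.
    by apply: phi_close => //; rewrite Ei.
  have ab : `|n%:R^-1 * \sum_(i < n) a i - n%:R^-1 * \sum_(i < n) b i| <= w + 2 * C * e.
    rewrite -mulrBr -sumrB normrM (gtr0_norm (_ : 0 < n%:R^-1)) ?invr_gt0//.
    rewrite ler_pdivrMl//; apply: le_trans (ler_norm_sum _ _ _) _.
    apply: le_trans (ler_sum _ (fun i _ => ab_le i)) _.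
    rewrite big_split /= sumr_const card_ord -[X in X + _]mulr_natl mulrDr lerD2l.
    rewrite -big_mkcond sumr_const -[leLHS]mulr_natr mulrCA ler_wpM2l ?mulr_ge0//.
    by rewrite mulrC; apply: le_trans Ecard; rewrite ler_nat.
  have c01 (x : R) : 0 <= x <= 1 -> unit_itv x by move=> ?; apply/unit_itvE.
  have GC (x : R) (kappa : R -> R) : (forall x, unit_itv x -> unit_itv (kappa x)) ->
      0 <= x <= 1 -> `|G (x, kappa x)| <= 2 * C.
    move=> k01 x01; have sx := sqx _ _ k01 (c01 x x01).
    by rewrite ger0_norm ?G0// G2.
  have C2 : 0 <= 2 * C by rewrite mulr_ge0.
  have s2 := @strips_sum _ n M A (fun x => G (x, psi x)) Phi w (2 * C) e n0 isT (ltW w0)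
    C2 (fun x y x01 y01 => hmod _ psi01 psiL _ _ (c01 _ x01) (c01 _ y01))
    (fun x => GC x _ psi01) PhiL cnt.
  have cnt' k : (k <= n)%N ->
      `|#|[pred i : 'I_n | (i < k)%N && ~~ A i]|%:R -
        n%:R * (k%:R / n%:R - Phi (k%:R / n%:R))| <= e * n%:R.
    move=> kn; have := cnt k kn; rewrite mulrBr mulrCA divff ?gt_eqF// mulr1.
    have : (#|[pred i : 'I_n | (i < k)%N && A i]| +
        #|[pred i : 'I_n | (i < k)%N && ~~ A i]| = k)%N.
      rewrite -[RHS](card_ord_ltn kn) -(cardID A [pred i : 'I_n | (i < k)%N]).
      congr (_ + _)%N; apply: eq_card => i; rewrite !inE //.
      by rewrite andbC.
    move=> /(congr1 (fun m => m%:R : R)); rewrite /= natrD => Ek.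
    exact: dist_complement Ek.
  have s1 := @strips_sum _ n M (fun i => ~~ A i) (fun x => G (x, phi x))
    (fun x => x - Phi x) w (2 * C) e n0 isT (ltW w0)
    C2 (fun x y x01 y01 => hmod _ phi01 phiL _ _ (c01 _ x01) (c01 _ y01))
    (fun x => GC x _ phi01) PhiL' cnt'.
  have Phi01 : 0 <= Phi 1 - Phi 0 <= 1.
    by have := PhiL (lexx 0) ler01 (lexx 1); rewrite subr0.
  have bE : n%:R^-1 * \sum_(i < n) b i =
      n%:R^-1 * \sum_(i < n | A i) G (i%:R / n%:R, psi (i%:R / n%:R)) +
      n%:R^-1 * \sum_(i < n | ~~ A i) G (i%:R / n%:R, phi (i%:R / n%:R)).
    rewrite -mulrDr (bigID A) /=; congr (_ * (_ + _)).
      by apply: eq_bigr => i Ai; rewrite /b /chi Ai.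
    by apply: eq_bigr => i /negbTE Ai; rewrite /b /chi Ai.
  rewrite bE in ab.
  have wPhi1 : w * (Phi 1 - Phi 0) <= w by rewrite ler_piMr ?(ltW w0)//; case/andP: Phi01.
  have wPhi2 : w * (1 - Phi 1 - (0 - Phi 0)) <= w.
    by rewrite ler_piMr ?(ltW w0)//; case/andP: Phi01 => *; lra.
  have fac : M%:R * (2 * C * (2 * e + 2 * n%:R^-1)) <= 8 * (C * M%:R) * e.
    have : (C * M%:R) * (4 * n%:R^-1) <= (C * M%:R) * (4 * e).
      by rewrite ler_wpM2l// ler_pM2l.
    lra.
  have wE : eta = 12 * w by rewrite /w; field.
  have eB' : e + 2 * C * e + 16 * (C * M%:R) * e <= 6 * w.
    move: eB; rewrite wE /B; lra.
  move: rle ab s1 s2 t1le t2le; rewrite -/(a _).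
  set X := n%:R^-1 * \sum_(i < n) G _; rewrite -/X.
  set X1 := n%:R^-1 * \sum_(_ < _ | ~~ _) _.
  set X2 := n%:R^-1 * \sum_(_ < _ | A _) _.
  set S1 := \sum_(m < M) _ * (_ - _ - _); set S2 := \sum_(m < M) _.
  rewrite !ler_norml => /andP[? ?] /andP[? ?] /andP[? ?] /andP[? ?] /andP[? ?] /andP[? ?].
  by apply/andP; split; lra.
have [t [tE _]] := main 1 ltr01.
have tG : (\int[mu]_(z in unit_square) (f z)%:E)%E = (t - C)%:E.
  exact: (int_shift msq mf mu1 G0 tE).
rewrite tG; apply/fine_cvgP.
have mass n : (0 < n)%N -> perm_permuton (s n) (@unit_square R) = 1%E.
  move=> n0; have [r [rE]] : exists r : R,
      (\int[perm_permuton (s n)]_(z in unit_square) (1%R)%:E)%E = r%:E /\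
      `|r - n%:R^-1 * \sum_(i < n) 1| <= 0.
    apply: (@perm_permuton_integral _ n (s n) (fun=> 1) 0 n0) => //.
    by move=> *; rewrite subrr normr0.
  rewrite sumr_const card_ord mulVf ?pnatr_eq0 -?lt0n// normr_le0 subr_eq0 => /eqP r1.
  by move: rE; rewrite r1 integral_cst// mul1e.
have fn n : (0 < n)%N -> forall r,
    (\int[perm_permuton (s n)]_(z in unit_square) (G z)%:E)%E = r%:E ->
    (\int[perm_permuton (s n)]_(z in unit_square) (f z)%:E)%E = (r - C)%:E.
  by move=> n0 r; apply: int_shift => //; exact: mass.
split.
  have [t1 [_ [N hN]]] := main 1 ltr01.
  exists (maxn N 1) => // n /=; rewrite geq_max => /andP[Nn n0].
  have [r [rE _]] := hN n Nn n0.
  by rewrite (fn n n0 r rE).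
apply/cvgrPdist_le => eta eta0.
have [t' [t'E [N hN]]] := main eta eta0.
have tt' : t' = t by move: t'E; rewrite tE => -[].
exists (maxn N 1) => // n /=; rewrite geq_max => /andP[Nn n0].
have [r [rE]] := hN n Nn n0; rewrite (fn n n0 r rE) /= tt'.
by rewrite distrC; congr (`|_| <= _); ring.
Qed.

End two_curves_convergence.

(** * The limit permuton for positive beta *)

Lemma ge0_integral_mpushforward d1 d2 (T1 : measurableType d1)
    (T2 : measurableType d2) (R : realType) (m : {measure set T1 -> \bar R})
    (g : T1 -> T2) (mg : measurable_fun setT g) (D : set T2) (h : T2 -> R) :
  measurable D -> measurable_fun D (EFin \o h) -> (forall y, D y -> 0 <= h y) ->
  (\int[mpushforward m mg]_(y in D) (h y)%:E =
   \int[m]_(x in g @^-1` D) (h (g x))%:E)%E.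
Proof.
move=> mD mh h0; transitivity (\int[m]_(x in g @^-1` D) ((EFin \o h) \o g) x)%E => //.
rewrite -(ge0_integral_pushforward mg m mD mh); last first.
  by move=> y /set_mem Dy; rewrite lee_fin h0.
exact: eq_measure_integral.
Qed.

Lemma leb_unit_itv (R : realType) : lebesgue_measure (@unit_itv R) = 1%E.
Proof. by rewrite lebesgue_measure_itv /= lte_fin ltr01 oppr0 adde0. Qed.

Section limit_measures.
Variables (R : realType) (beta : R).
Hypothesis beta0 : 0 < beta.
Implicit Types x y : R.
Local Notation leb := (@lebesgue_measure R).
Local Notation f := (f231 beta).
Local Notation slope := (slope beta).
Local Notation xs := (peak231 beta).

Local Notation Phi := (spine_mass beta).

Lemma is_derive_f231 x : x <= 1 -> is_derive x 1 f (slope x).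
Proof.
move=> x1; have gx := gap_gt0 beta0 x1.
have h0 : is_derive x 1 (fun y : R => beta * y) beta.
  by rewrite -[X in is_derive _ _ _ X]mulr1; apply: is_deriveZ.
have h1 : is_derive x 1 (expR \o (fun y : R => beta * y)) (expR (beta * x) * beta).
  exact: is_derive1_comp.
have h2 : is_derive x 1 (cst (1 + expR beta) - (expR \o (fun y : R => beta * y)))
    (0 - expR (beta * x) * beta) by exact: is_deriveB.
pose g : R -> R := cst (1 + expR beta) - (expR \o (fun y : R => beta * y)).
have hl : is_derive (g x) 1 (@ln R) (gap beta x)^-1 by exact: is_derive1_ln.
have h3 := @is_derive1_comp R (@ln R) g x _ _ hl h2.
have h4 := is_deriveZ beta^-1 h3.
have h5 := is_deriveB (is_derive_cst (1 : R) x 1) h4.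
apply: (is_derive_eq (f := f) _ _).
rewrite /GRing.scale /= /Defs.f231 /slope; field.
by rewrite !gt_eqF.
Qed.

Lemma derive1_slope x : x <= 1 -> f^`()%classic x = slope x.
Proof. by move=> x1; rewrite derive1E; have := is_derive_f231 x1 => /@derive_val. Qed.

Lemma continuous_f231 x : x <= 1 -> {for x, continuous f}.
Proof.
move=> x1; apply: differentiable_continuous; apply/derivable1_diffP.
exact: (@ex_derive _ _ _ _ _ _ _ (is_derive_f231 x1)).
Qed.

Lemma continuous_slope x : x <= 1 -> {for x, continuous slope}.
Proof.
move=> x1; have ce : {for x, continuous (fun y : R => expR (beta * y))}.
  apply: continuous_comp; last exact: continuous_expR.
  exact: cvgMr.
apply: cvgM => //; apply: cvgV; first by rewrite gt_eqF// gap_gt0.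
by apply: cvgB => //; exact: cvg_cst.
Qed.

Lemma f231_le x y : x <= y -> y <= 1 -> f x <= f y.
Proof.
move=> xy y1; rewrite -subr_ge0; have /andP[h _] := f231_incr beta0 xy y1.
by apply: le_trans h; rewrite mulr_ge0 ?subr_ge0// slope_ge0// (le_trans xy).
Qed.

Lemma f231_lt x y : x < y -> y <= 1 -> f x < f y.
Proof.
move=> xy y1; rewrite -subr_gt0; have /andP[h _] := f231_incr beta0 (ltW xy) y1.
apply: lt_le_trans h; rewrite mulr_gt0 ?subr_gt0// divr_gt0 ?expR_gt0//.
by rewrite gap_gt0// (le_trans (ltW xy)).
Qed.

Lemma f231_lipschitz x y : unit_itv x -> unit_itv y ->
  `|f x - f y| <= expR beta * `|x - y|.
Proof.
move=> /unit_itvE/andP[x0 x1] /unit_itvE/andP[y0 y1].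
wlog xy : x y x0 x1 y0 y1 / x <= y.
  by move=> h; have [|/ltW] := leP x y; [exact: h|rewrite distrC [`|x - y|]distrC; exact: h].
rewrite distrC [`|x - y|]distrC !ger0_norm ?subr_ge0 ?f231_le//.
have /andP[_ h] := f231_incr beta0 xy y1; apply: (le_trans h).
by rewrite mulrC ler_wpM2r ?subr_ge0// slope_le.
Qed.

Lemma f231_itv x : unit_itv x -> unit_itv (f x).
Proof.
move=> /unit_itvE/andP[x0 x1]; apply/unit_itvE.
by rewrite f231_ge0// f231_le1.
Qed.

Lemma spine_mass_incr x y : 0 <= x -> x <= y -> y <= 1 ->
  0 <= Phi y - Phi x <= y - x.
Proof.
move=> x0 xy y1; rewrite /spine_mass.
have xy' : Num.min x xs <= Num.min y xs by rewrite le_min !ge_min xy lexx orbT.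
have yxs : Num.min y xs <= xs by rewrite ge_min lexx orbT.
have := delta_mono beta0 xy' yxs.
have y1' : Num.min y xs <= 1 by rewrite ge_min y1.
have fxy := f231_le xy' y1'.
have : Num.min y xs - Num.min x xs <= y - x.
  have [hx|hx] := leP x xs; have [hy|hy] := leP y xs; lra.
by move=> *; apply/andP; split; lra.
Qed.

Lemma measurable_slope : measurable_fun (@unit_itv R)
  (slope : measurableTypeR R -> measurableTypeR R).
Proof.
apply: subspace_continuous_measurable_fun; first exact: measurable_unit_itv.
apply: continuous_in_subspaceT => x /set_mem/unit_itvE/andP[_ x1].
exact: continuous_slope.
Qed.

Lemma measurable_derive1 : measurable_fun (@unit_itv R)
  (f^`()%classic : measurableTypeR R -> measurableTypeR R).
Proof.
apply: eq_measurable_fun measurable_slope => x /set_mem/unit_itvE/andP[_ x1].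
by rewrite derive1_slope.
Qed.

Lemma measurable_curve_density : measurable_fun (@unit_itv R)
  (curve_density beta : measurableTypeR R -> measurableTypeR R).
Proof. by apply: measurable_minr => //; exact: measurable_derive1. Qed.

Lemma measurable_antidiag_density : measurable_fun (@unit_itv R)
  (antidiag_density beta : measurableTypeR R -> measurableTypeR R).
Proof.
by apply: measurable_maxr => //; apply: measurable_funB => //; exact: measurable_derive1.
Qed.

Lemma curve_density_ge0 x : unit_itv x -> 0 <= curve_density beta x.
Proof.
move=> /unit_itvE/andP[_ x1].
by rewrite /curve_density le_min ler01 derive1_slope// slope_ge0.
Qed.

Lemma antidiag_density_ge0 x : unit_itv x -> 0 <= antidiag_density beta x.
Proof. by move=> _; rewrite /antidiag_density le_max lexx. Qed.

(** Bundled as measures, so that their sum and their null sets can be reasoned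
    about. *)
Definition curve_measure : {measure set (measurableTypeR R) -> \bar R} :=
  density01_measure measurable_curve_density curve_density_ge0.

Definition antidiag_measure : {measure set (measurableTypeR R) -> \bar R} :=
  density01_measure measurable_antidiag_density antidiag_density_ge0.

Lemma curve_antidiag_measure (A : set (measurableTypeR R)) : measurable A ->
  (curve_measure A + antidiag_measure A = leb (A `&` unit_itv))%E.
Proof.
move=> mA; have mAI : measurable (A `&` @unit_itv R).
  by apply: measurableI => //; exact: measurable_unit_itv.
rewrite /curve_measure /antidiag_measure /= /density01 -ge0_integralD//=.
- rewrite -[RHS]mul1e -integral_cst//; apply: eq_integral => x _.
  rewrite -EFinD; congr EFin; rewrite /curve_density /antidiag_density /=.
  by have [h|h] := leP 1 (f^`()%classic x); [rewrite max_l ?addr0|rewrite max_r]; lra.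
- by move=> x [_ x01]; rewrite lee_fin curve_density_ge0.
- apply/measurable_EFinP; apply: measurable_funS measurable_curve_density => //.
  exact: measurable_unit_itv.
- by move=> x [_ x01]; rewrite lee_fin antidiag_density_ge0.
- apply/measurable_EFinP; apply: measurable_funS measurable_antidiag_density => //.
  exact: measurable_unit_itv.
Qed.

Lemma itv_oc_sub x y : 0 <= x -> y <= 1 -> `]x, y]%classic `<=` @unit_itv R.
Proof.
move=> x0 y1 z; rewrite /= in_itv /= => /andP[xz zy]; apply/unit_itvE.
by rewrite (le_trans x0 (ltW xz)) (le_trans zy).
Qed.

(** Before the peak [f' <= 1], and [1 - f'] is the derivative of [x - f x]. *)
Lemma antidiag_measure_left x y : 0 <= x -> x <= y -> y <= xs ->
  antidiag_measure `]x, y]%classic = ((y - f y) - (x - f x))%:E.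
Proof.
move=> x0 + yxs; rewrite le_eqVlt => /orP[/eqP ->|xy].
  by rewrite set_itv_ge ?bnd_simp ?ltxx// measure0 subrr.
have xs1 := peak_lt1 beta0; have y1 : y <= 1 by rewrite (le_trans yxs)// ltW.
have sub := @itv_oc_sub x y x0 y1.
have msl : measurable_fun `]x, y]%classic (fun z : R => (1 - slope z)%:E).
  apply/measurable_EFinP; apply: measurable_funB => //.
  by apply: measurable_funS measurable_slope => //; exact: measurable_unit_itv.
rewrite /antidiag_measure /= /density01 (setIidl sub).
rewrite (eq_integral (fun z : measurableTypeR R => (1 - slope z)%:E)); last first.
  move=> z /set_mem /= /[dup] /sub/unit_itvE/andP[_ z1].
  rewrite in_itv /= => /andP[_ zy]; congr EFin.
  rewrite /antidiag_density derive1_slope// max_r// subr_ge0.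
  by rewrite slope_le1// (le_trans zy).
rewrite integral_itv_obnd_cbnd//.
rewrite (@continuous_FTC2 _ _ (fun z => z - f z))//.
- apply: continuous_in_subspaceT => z /set_mem /=; rewrite in_itv /= => /andP[_ zy].
  apply: cvgB; first exact: cvg_cst.
  exact: (continuous_slope (le_trans zy y1)).
- have cont z : z <= y -> {for z, continuous (fun z : R => z - f z)}.
    move=> zy; apply: cvgB; first exact: cvg_id.
    exact: (continuous_f231 (le_trans zy y1)).
  split.
  + move=> z; rewrite in_itv /= => /andP[_ zy]; apply: derivableB.
      exact: derivable_id.
    exact: (@ex_derive _ _ _ _ _ _ _ (is_derive_f231 (le_trans (ltW zy) y1))).
  + by apply: cvg_at_right_filter; apply: cont; exact: ltW.
  + by apply: cvg_at_left_filter; exact: cont.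
- move=> z; rewrite in_itv /= => /andP[_ zy].
  have dz := is_derive_f231 (le_trans (ltW zy) y1).
  have := is_deriveB (is_derive_id z 1) dz => h.
  rewrite derive1E; exact: (@derive_val _ _ _ _ _ _ _ h).
Qed.

(** After the peak [f' >= 1]. *)
Lemma antidiag_measure_right x y : xs <= x -> y <= 1 ->
  antidiag_measure `]x, y]%classic = 0%E.
Proof.
move=> xsx y1; have x0 := le_trans (ltW (peak_gt0 beta0)) xsx.
have sub := @itv_oc_sub x y x0 y1.
rewrite /antidiag_measure /= /density01 (setIidl sub).
rewrite (eq_integral (fun _ : measurableTypeR R => 0%E)) ?integral0// => z /set_mem /= /[dup] /sub/unit_itvE/andP[_ z1].
rewrite in_itv /= => /andP[xz _]; congr EFin.
rewrite /antidiag_density derive1_slope// max_l// subr_le0.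
rewrite /slope ler_pdivlMr ?gap_gt0// mul1r /gap.
have : xs <= z by rewrite (le_trans xsx)// ltW.
by rewrite -(expR_ge_peak beta0); lra.
Qed.

Lemma antidiag_measure_itv x y : 0 <= x -> x <= y -> y <= 1 ->
  antidiag_measure `]x, y]%classic = (Phi y - Phi x)%:E.
Proof.
move=> x0 xy y1; rewrite /spine_mass.
have [yxs|xsy] := leP y xs.
  by rewrite antidiag_measure_left// min_l// (le_trans xy).
have [xxs|xsx] := leP x xs; last first.
  by rewrite antidiag_measure_right ?(ltW xsx)// subrr.
rewrite (@itv_bndbnd_setU _ _ _ (BRight xs)) ?bnd_simp ?(ltW xsy)//.
rewrite measureU//; last first.
  apply/seteqP; split => z //= []; rewrite !in_itv /= => /andP[_ h1] /andP[h2 _].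
  by have := lt_le_trans h2 h1; rewrite ltxx.
rewrite -[RHS]adde0; congr (_ + _)%E.
  exact: (antidiag_measure_left x0 xxs (lexx _)).
exact: (antidiag_measure_right (lexx _) y1).
Qed.

(** By [curve_antidiag_measure] this is the complement of [antidiag_measure_itv] in
    the length of the interval. *)
Lemma curve_measure_itv x y : 0 <= x -> x <= y -> y <= 1 ->
  curve_measure `]x, y]%classic = ((y - Phi y) - (x - Phi x))%:E.
Proof.
move=> x0 xy y1.
have := @curve_antidiag_measure `]x, y]%classic (measurable_itv _).
rewrite antidiag_measure_itv// (setIidl (itv_oc_sub x0 y1)).
have -> : leb `]x, y]%classic = (y - x)%:E.
  rewrite lebesgue_measure_itv /= lte_fin; case: ltP => // yx.
  by have -> : x = y by [apply/eqP; rewrite eq_le xy]; rewrite subrr.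
move=> E; have fin : curve_measure `]x, y]%classic \is a fin_num.
  by move: E; case: (curve_measure _).
by move: E; rewrite -(fineK fin) -EFinD => -[E]; congr EFin; lra.
Qed.

Lemma leb_null_measures (A : set (measurableTypeR R)) : measurable A ->
  leb (A `&` unit_itv) = 0%E -> curve_measure A = 0%E /\ antidiag_measure A = 0%E.
Proof.
move=> mA; rewrite -curve_antidiag_measure// => /eqP.
by rewrite padde_eq0 ?measure_ge0// => /andP[/eqP -> /eqP ->].
Qed.

Lemma point_measures x : curve_measure [set x] = 0%E /\ antidiag_measure [set x] = 0%E.
Proof.
apply: leb_null_measures => //.
apply/eqP; rewrite -measure_le0 -(lebesgue_measure_set1 x).
by apply: le_measure; rewrite ?inE//; apply: measurableI => //; exact: measurable_unit_itv.
Qed.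

Lemma measurable_f231 : measurable_fun setT (f : measurableTypeR R -> measurableTypeR R).
Proof.
apply: measurable_funB => //; apply: measurable_funM => //.
apply: (@measurableT_comp _ _ _ _ _ _ (@ln R)) => //.
by apply: measurable_funB => //; apply: measurableT_comp => //; exact: measurable_funM.
Qed.

Lemma measurable_antidiag :
  measurable_fun setT ((fun x => 1 - x) : measurableTypeR R -> measurableTypeR R).
Proof.
have : measurable_fun setT (fun x : R => 1 - x) by apply: measurable_funB.
by [].
Qed.

Lemma measurable_graph (g : R -> R) :
  measurable_fun setT (g : measurableTypeR R -> measurableTypeR R) ->
  measurable_fun setT (fun x : measurableTypeR R => (x, g x) : plane R).
Proof. by move=> mg; apply: measurable_fun_pair. Qed.

Lemma mu231E (A : set (plane R)) :
  mu231 beta A = (curve_measure ((fun x : R => (x, f x)) @^-1` A) +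
    antidiag_measure ((fun x : R => (x, 1 - x)%R) @^-1` A))%E.
Proof. by []. Qed.

(** The graph of [f] is symmetric with respect to the antidiagonal; this is why the
    second marginal of [mu231] is uniform like the first one. *)
Lemma f231_conj x : unit_itv x -> f (1 - f x) = 1 - x.
Proof.
move=> x01; have /unit_itvE/andP[x0 x1] := x01.
have /unit_itvE/andP[f0 f1] := f231_itv x01.
have e : gap beta (1 - f x) = expR (beta * x).
  by rewrite {1}/gap -(gap_f231 beta0 x1) /gap; ring.
by rewrite f231E e expRK mulrA mulVf ?mul1r// gt_eqF.
Qed.

Lemma peak_conj x : unit_itv x -> (1 - f x <= xs) = (xs <= x).
Proof.
move=> /unit_itvE/andP[x0 x1].
rewrite -(expR_le_peak beta0) -(expR_ge_peak beta0) -gap_f231// /gap.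
by apply/idP/idP; lra.
Qed.

(** The symmetry of [f231_conj] exchanges the two sides of the peak, and [x - f x]
    takes the same value at [1 - b] and at [z]. *)
Lemma spine_mass_conj b (z := 1 - f (1 - b)) : unit_itv b ->
  z - Phi z + (Phi 1 - Phi (1 - b)) = b.
Proof.
move=> /unit_itvE/andP[b0 b1].
have b01 : unit_itv (1 - b) by apply/unit_itvE; apply/andP; split; lra.
have fz : f z = b by rewrite /z f231_conj// opprB addrC subrK.
have := peak_conj b01; rewrite -/z /spine_mass.
have -> : Num.min 1 xs = xs by rewrite min_r// ltW// peak_lt1.
have [h|h] := leP xs (1 - b) => zxs.
  by rewrite (min_l (y := xs)) ?zxs// fz; lra.
rewrite (min_r (x := z)) ?zxs; last by rewrite ltW// ltNge zxs.
by rewrite /z; lra.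
Qed.

Lemma curve_measure_lt b : 0 < b -> b <= 1 ->
  curve_measure (f @^-1` `]-oo, b[) =
  (1 - f (1 - b) - Phi (1 - f (1 - b)))%:E.
Proof.
move=> b0 b1; set z := 1 - f (1 - b).
have b01 : unit_itv (1 - b) by apply/unit_itvE; apply/andP; split; lra.
have /unit_itvE/andP[c0 c1] := f231_itv b01.
have fz : f z = b by rewrite /z f231_conj// opprB addrC subrK.
have z0 : 0 <= z by rewrite /z; lra.
have z1 : z <= 1 by rewrite /z; lra.
have m1 : measurable (f @^-1` `]-oo, b[ : set (measurableTypeR R)).
  by rewrite -[X in measurable X]setTI; apply: measurable_f231.
(* both sets agree up to endpoints *)
have sub1 : f @^-1` `]-oo, b[ `&` (@unit_itv R) `<=` [set 0] `|` `]0, z].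
  move=> x [/=]; rewrite !in_itv /= => xb /unit_itvE/andP[x0 x1].
  have [->|nx0] := eqVneq x 0; [by left|right].
  rewrite lt_neqAle eq_sym nx0 x0 /= leNgt; apply/negP => zx.
  by have := f231_lt zx x1; rewrite fz ltNge (ltW xb).
have sub2 : `]0, z] `\` [set z] `<=` f @^-1` `]-oo, b[ `&` (@unit_itv R).
  move=> x [/=]; rewrite in_itv /= => /andP[x0 xz] /eqP nxz.
  have lt : x < z by rewrite lt_neqAle nxz.
  split; first by rewrite in_itv /= -fz f231_lt.
  by apply/unit_itvE; rewrite (ltW x0) (le_trans xz).
have Phi0 : Phi 0 = 0.
  by rewrite /spine_mass min_l ?(ltW (peak_gt0 beta0))// f231_0// subrr.
have Ez : curve_measure `]0, z]%classic = (z - Phi z)%:E.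
  by rewrite curve_measure_itv// Phi0 subrr subr0.
have inI (A : set (measurableTypeR R)) : curve_measure (A `&` unit_itv) = curve_measure A.
  by rewrite /curve_measure /= /density01 -setIA setIid.
have mI : measurable (f @^-1` `]-oo, b[ `&` (@unit_itv R) : set (measurableTypeR R)).
  by apply: measurableI => //; exact: measurable_unit_itv.
have mz : measurable (`]0, z]%classic : set (measurableTypeR R)) by exact: measurable_itv.
have mz' : measurable (`]0, z] `\` [set z] : set (measurableTypeR R)) by exact: measurableD.
have le_m (A B : set (measurableTypeR R)) : measurable A -> measurable B -> A `<=` B ->
    (curve_measure A <= curve_measure B)%E.
  by move=> mA mB; apply: le_measure; rewrite inE.
rewrite -inI -Ez; apply/eqP; rewrite eq_le; apply/andP; split.
  have le1 : (curve_measure (f @^-1` `]-oo, b[ `&` unit_itv) <=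
      curve_measure ([set 0%R] `|` `]0%R, z]%classic))%E.
    by apply: le_m sub1 => //; exact: measurableU.
  apply: (le_trans le1); apply: le_trans (measureU2 _ _ _) _ => //.
  by have [e _] := point_measures 0; rewrite -[leRHS]add0e -e.
have le2 : (curve_measure (`]0%R, z] `\` [set z]) <=
    curve_measure (f @^-1` `]-oo, b[ `&` unit_itv))%E.
  exact: le_m sub2.
apply: le_trans le2.
have sub : `]0, z]%classic `<=` (`]0, z] `\` [set z]) `|` [set z].
  by move=> x xz; have [->|/eqP nz] := eqVneq x z; [right|left].
have le3 : (curve_measure `]0%R, z]%classic <=
    curve_measure ((`]0%R, z] `\` [set z]) `|` [set z]))%E.
  by apply: le_m sub => //; exact: measurableU.
apply: (le_trans le3); apply: le_trans (measureU2 _ _ _) _ => //.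
by have [e _] := point_measures z; rewrite -[leRHS]adde0 -e.
Qed.

Lemma antidiag_measure_lt b : 0 < b -> b <= 1 ->
  antidiag_measure ((fun x => 1 - x) @^-1` `]-oo, b[) = (Phi 1 - Phi (1 - b))%:E.
Proof.
move=> b0 b1.
rewrite -(@antidiag_measure_itv (1 - b) 1) ?subr_ge0//; last by lra.
rewrite /antidiag_measure /= /density01; congr integral.
apply/seteqP; split => x /= [].
  rewrite !in_itv /= => h /unit_itvE/andP[x0 x1]; split.
    by rewrite x1 andbT; lra.
  by apply/unit_itvE; rewrite x0.
rewrite !in_itv /= => /andP[h1 h2] x01; split => //.
lra.
Qed.

(** The two measures agree on the half-lines [`]-oo, b[]: the part of the curve below
    the height [b] is above [`[0, 1 - f (1 - b)[] by [f231_conj], the part of the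
    antidiagonal is above [`]1 - b, 1]], and [spine_mass_conj] adds up their masses to
    [b]. *)
Lemma mu231_marginal_y (A : set (measurableTypeR R)) : measurable A ->
  mu231 beta (setT `*` A) = leb (A `&` unit_itv).
Proof.
pose m1 : {measure set (measurableTypeR R) -> \bar R} := measure_add
  (mpushforward curve_measure measurable_f231)
  (mpushforward antidiag_measure measurable_antidiag).
have m1E B : m1 B = (curve_measure (f @^-1` B) +
    antidiag_measure ((fun x : R => 1 - x)%R @^-1` B))%E.
  by rewrite /m1 /measure_add /= /msum !big_ord_recl big_ord0 adde0.
have -> : mu231 beta (setT `*` A) = m1 A.
  rewrite m1E mu231E; congr (curve_measure _ + antidiag_measure _)%E;
    by apply/seteqP; split => x /=; [case|split].
pose m2 : {measure set (measurableTypeR R) -> \bar R} := mrestr leb (@measurable_unit_itv R).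
have -> : leb (A `&` unit_itv) = m2 A by [].
have full : m1 setT = 1%E.
  rewrite m1E !preimage_setT curve_antidiag_measure// setTI lebesgue_measure_itv /=.
  by rewrite lte_fin ltr01 oppr0 adde0.
pose g (n : nat) : set (measurableTypeR R) := `]-oo, n%:R[%classic.
move=> mA.
suff : [/\ (measurable : set (set (measurableTypeR R))) = <<s (@RGenInftyO.G R) >>,
    setI_closed (@RGenInftyO.G R), (forall n, @RGenInftyO.G R (g n)),
    \bigcup_k g k = setT & (forall B, @RGenInftyO.G R B -> m1 B = m2 B) /\
    (forall k, m1 (g k) < +oo)%E].
  move=> [h1 h2 h3 h4 [h5 h6]].
  exact: (@measure_unique _ _ (measurableTypeR R) (@RGenInftyO.G R) g h1 h2 h3 h4 m1 m2 h5 h6 A mA).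
split; [| | | |split].
- exact: RGenInftyO.measurableE.
- move=> _ _ [x ->] [y ->]; exists (Num.min x y); apply/seteqP; split => z /=.
    by rewrite !in_itv /= => -[zx zy]; rewrite lt_min zx zy.
  by rewrite !in_itv /= lt_min => /andP[].
- by move=> n; exists n%:R.
- apply/seteqP; split => // x _; exists (Num.bound `|x|) => //.
  rewrite /g /= in_itv /=; apply: le_lt_trans (ler_norm x) _; exact: archi_boundP.
- move=> _ [b ->]; rewrite /m2 /= /mrestr.
  have [b0|b0] := leP b 0.
    have -> : `]-oo, b[ `&` (@unit_itv R) = set0.
      apply/seteqP; split => x //= [/=]; rewrite in_itv /= => xb /unit_itvE/andP[x0 _].
      by have := lt_le_trans xb b0; rewrite ltNge x0.
    rewrite measure0 m1E.
    have [||-> _] := @leb_null_measures (f @^-1` `]-oo, b[).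
    + by rewrite -[X in measurable X]setTI; apply: measurable_f231.
    + rewrite (_ : _ `&` _ = set0) ?measure0//; apply/seteqP; split => x //= [/=].
      rewrite in_itv /= => fb x01; have /unit_itvE/andP[f0 _] := f231_itv x01.
      by have := lt_le_trans fb b0; rewrite ltNge f0.
    have [||_ ->] := @leb_null_measures ((fun x : R => 1 - x) @^-1` `]-oo, b[).
    + by rewrite -[X in measurable X]setTI; apply: measurable_antidiag.
    + rewrite (_ : _ `&` _ = set0) ?measure0//; apply/seteqP; split => x //= [/=].
      by rewrite in_itv /= => fb /unit_itvE/andP[_ x1]; clear -b0 fb x1; lra.
    by rewrite adde0.
  have [b1|b1] := leP b 1.
    rewrite m1E curve_measure_lt// antidiag_measure_lt// -EFinD.
    rewrite spine_mass_conj; last by apply/unit_itvE; rewrite (ltW b0).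
    have -> : `]-oo, b[ `&` (@unit_itv R) = `[0, b[%classic.
      apply/seteqP; split => x /=.
        by rewrite !in_itv /= => -[xb /unit_itvE/andP[-> _]].
      rewrite !in_itv /= => /andP[x0 xb]; split => //; apply/unit_itvE.
      by rewrite x0 (le_trans (ltW xb)).
    by rewrite lebesgue_measure_itv /= lte_fin b0 oppr0 adde0.
  have -> : `]-oo, b[ `&` (@unit_itv R) = unit_itv.
    apply/setIidPr => x /unit_itvE/andP[_ x1]; rewrite /= in_itv /=.
    exact: le_lt_trans b1.
  rewrite m1E -[LHS]/(_ + _)%E.
  have -> : curve_measure (f @^-1` `]-oo, b[) = curve_measure setT.
    rewrite /curve_measure /= /density01; congr integral; apply/seteqP; split => x /= [_ x01]; split => //.
    rewrite in_itv /=; have /unit_itvE/andP[_ f1] := f231_itv x01.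
    exact: le_lt_trans b1.
  have -> : antidiag_measure ((fun x : R => 1 - x) @^-1` `]-oo, b[) = antidiag_measure setT.
    rewrite /antidiag_measure /= /density01; congr integral; apply/seteqP; split => x /= [_ x01]; split => //.
    by rewrite in_itv /=; have /unit_itvE/andP[x0 _] := x01; clear -b1 x0; lra.
  by rewrite curve_antidiag_measure// setTI.
- move=> k; apply: le_lt_trans (_ : _ <= m1 setT)%E _; last by rewrite full ltry.
  by apply: le_measure; rewrite ?inE//; exact: measurable_itv.
Qed.

Lemma mu231_marginal_x (A : set (measurableTypeR R)) : measurable A ->
  mu231 beta (A `*` setT) = leb (A `&` unit_itv).
Proof.
move=> mA; rewrite -curve_antidiag_measure// mu231E.
congr (curve_measure _ + antidiag_measure _)%E;
  by apply/seteqP; split => x /=; [case|split].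
Qed.

Lemma mu231_is_permuton : is_permuton (mu231 beta).
Proof.
split.
- transitivity (mu231 beta setT) => //.
  by rewrite -setXTT mu231_marginal_x// setTI leb_unit_itv.
- transitivity (mu231 beta (~` unit_square)) => //; rewrite mu231E.
  have mc : measurable (~` @unit_square R).
    by apply: measurableC; exact: measurable_unit_square.
  have [||-> _] := @leb_null_measures ((fun x : R => (x, f x)) @^-1` (~` unit_square)).
  + rewrite -[X in measurable X]setTI; exact: (measurable_graph measurable_f231).
  + rewrite (_ : _ `&` _ = set0) ?measure0//; apply/seteqP; split => x //= [nsq x01].
    by apply: nsq; split => //=; exact: f231_itv.
  have [||_ ->] := @leb_null_measures ((fun x : R => (x, 1 - x)) @^-1` (~` unit_square)).
  + rewrite -[X in measurable X]setTI; exact: (measurable_graph measurable_antidiag).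
  + rewrite (_ : _ `&` _ = set0) ?measure0//; apply/seteqP; split => x //= [nsq x01].
    apply: nsq; split => //=; apply/unit_itvE.
    by move: x01 => /unit_itvE/andP[? ?]; apply/andP; split; lra.
  by rewrite adde0.
- exact: mu231_marginal_x.
- exact: mu231_marginal_y.
Qed.

Lemma mu231_integral (G : R * R -> R) :
  measurable_fun unit_square (G : plane R -> measurableTypeR R) ->
  (forall z, unit_square z -> 0 <= G z) ->
  (\int[mu231 beta]_(z in unit_square) (G z)%:E =
   \int[curve_measure]_(x in unit_itv) (G (x, f x))%:E +
   \int[antidiag_measure]_(x in unit_itv) (G (x, 1 - x)%R)%:E)%E.
Proof.
move=> mG G0; have msq := @measurable_unit_square R.
have mGE : measurable_fun unit_square (EFin \o G : plane R -> \bar R) by exact/measurable_EFinP.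
rewrite (@eq_measure_integral _ _ _ _ (measure_add
  (mpushforward curve_measure (measurable_graph measurable_f231))
  (mpushforward antidiag_measure (measurable_graph measurable_antidiag)))); last first.
  move=> A _ _; transitivity (mu231 beta A) => //.
  by rewrite mu231E /measure_add /= /msum !big_ord_recl big_ord0 adde0.
rewrite ge0_integral_measure_add//.
have pre (chi : R -> R) : (forall x, unit_itv x -> unit_itv (chi x)) ->
    (fun x : R => (x, chi x)) @^-1` unit_square = @unit_itv R.
  move=> chi01; apply/seteqP; split => x /=; first by case.
  by move=> x01; split => //=; exact: chi01.
congr (_ + _)%E.
  rewrite ge0_integral_mpushforward// pre//; exact: f231_itv.
rewrite ge0_integral_mpushforward// pre//.
by move=> x /unit_itvE/andP[? ?]; apply/unit_itvE; apply/andP; split; lra.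
Qed.

End limit_measures.

(** * The diagonal permuton *)

Section diagonal.
Variable R : realType.
Local Notation leb := (@lebesgue_measure R).
Local Notation leb01 := (mrestr leb (@measurable_unit_itv R)).

Lemma measurable_diagonal :
  measurable_fun setT (fun x : measurableTypeR R => (x, x) : plane R).
Proof. by apply: measurable_fun_pair. Qed.

Lemma diag_permuton_is_permuton : is_permuton (@diag_permuton R).
Proof.
split.
- transitivity (leb (setT `&` unit_itv)) => //.
  by rewrite setTI leb_unit_itv.
- transitivity (leb ((fun x : R => (x, x)) @^-1` (~` unit_square) `&` unit_itv)) => //.
  rewrite (_ : _ `&` _ = set0) ?measure0//.
  by apply/seteqP; split => x //= [nsq x01]; apply: nsq.
- move=> A _; transitivity (leb ((fun x : R => (x, x)) @^-1` (A `*` setT) `&` unit_itv)) => //.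
  by congr (leb (_ `&` _)); apply/seteqP; split => x //= [].
- move=> A _; transitivity (leb ((fun x : R => (x, x)) @^-1` (setT `*` A) `&` unit_itv)) => //.
  by congr (leb (_ `&` _)); apply/seteqP; split => x //= [].
Qed.

Lemma diag_permuton_cvg (s : forall n, 'S_n) :
  (forall e : R, 0 < e -> exists N : nat, forall n, (N <= n)%N -> (0 < n)%N ->
    two_curves id id (fun=> 0) e (s n)) ->
  permuton_cvg s (@diag_permuton R).
Proof.
have pre : (fun x : R => (x, x)) @^-1` unit_square = @unit_itv R.
  by apply/seteqP; split => x /=; [case|split].
(* both curves are the diagonal, the second one with no mass *)
apply: (@two_curves_cvg R id id (fun=> 0) 1 leb01 mzero (@diag_permuton R)) => //.
- by move=> x y _ _; rewrite mul1r.
- by move=> x y _ _; rewrite mul1r.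
- exact: measurable_diagonal.
- exact: measurable_diagonal.
- by move=> x y _ xy _; rewrite subrr lexx subr_ge0.
- apply/eqP; rewrite -measure_le0 -(lebesgue_measure_set1 (0 : R)).
  by apply: le_measure; rewrite ?inE//; apply: measurableI => //; exact: measurable_unit_itv.
- move=> x y x0 xy y1; rewrite !subr0; transitivity (leb (`]x, y] `&` unit_itv)) => //.
  rewrite (_ : _ `&` _ = `]x, y]%classic).
    rewrite lebesgue_measure_itv /= lte_fin; case: ltP => // yx.
    by have -> : x = y; [apply/eqP; rewrite eq_le xy yx|rewrite subrr].
  apply/setIidPl => z /=; rewrite in_itv /= => /andP[xz zy]; apply/unit_itvE.
  by rewrite (le_trans x0 (ltW xz)) (le_trans zy y1).
- by move=> x y _ _ _; rewrite subrr.
- transitivity (leb ((fun x : R => (x, x)) @^-1` unit_square `&` unit_itv)) => //.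
  by rewrite pre setIid leb_unit_itv.
- move=> G mG G0; have msq := @measurable_unit_square R.
  have mGE : measurable_fun unit_square (EFin \o G : plane R -> \bar R) by exact/measurable_EFinP.
  rewrite (@eq_measure_integral _ _ _ _ (mpushforward leb01 measurable_diagonal)); last by [].
  rewrite ge0_integral_mpushforward//.
  have -> : (fun x : measurableTypeR R => (x, x)) @^-1` unit_square = @unit_itv R by exact: pre.
  by rewrite integral_measure_zero adde0.
Qed.

End diagonal.

Lemma mu231_cvg (R : realType) (beta : R) (s : forall n, 'S_n) : 0 < beta ->
  (forall e : R, 0 < e -> exists N : nat, forall n, (N <= n)%N -> (0 < n)%N ->
    two_curves (f231 beta) (fun x => 1 - x) (spine_mass beta) e (s n)) ->
  permuton_cvg s (mu231 beta).
Proof.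
move=> beta0.
have [c0 _] := point_measures beta0 0; have [_ a0] := point_measures beta0 0.
have L1 : 1 <= expR beta by rewrite -expR0 ler_expR ltW.
apply: (@two_curves_cvg R (f231 beta) (fun x => 1 - x) (spine_mass beta) (expR beta)
  (curve_measure beta0) (antidiag_measure beta0) (mu231 beta)) => //.
- exact: f231_itv.
- move=> x /unit_itvE/andP[? ?]; apply/unit_itvE; apply/andP; split; lra.
- exact: f231_lipschitz.
- move=> x y _ _; rewrite opprB addrC addrA subrK distrC.
  by rewrite -[leLHS]mul1r ler_wpM2r.
- exact: (measurable_graph (measurable_f231 beta)).
- exact: (measurable_graph (@measurable_antidiag R)).
- exact: spine_mass_incr.
- exact: curve_measure_itv.
- exact: antidiag_measure_itv.
- have [m1 m0 _ _] := mu231_is_permuton beta0.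
  have msq := @measurable_unit_square R.
  move: m1; rewrite -(setUv unit_square) measureU//; last first.
  + by rewrite setICr.
  + exact: measurableC.
  by rewrite [X in (_ + X)%E]m0 adde0.
- exact: mu231_integral.
Qed.

(** * Almost sure convergence *)

Section almost_sure.
Variables (R : realType) (d : measure_display) (T : measurableType d).
Variables (P : probability T R) (beta : R).

Lemma mallows231_event n (X : T -> 'S_n) (Q : pred 'S_n) : is_mallows231 P beta X ->
  measurable (X @^-1` [set s | Q s]) /\
  (P (X @^-1` [set s | Q s]) <= (\sum_(s | Q s) mallows231_pmf beta s)%:E)%E.
Proof.
move=> law.
have seqE (r : seq 'S_n) : measurable (X @^-1` [set s | s \in r]) /\
    (P (X @^-1` [set s | s \in r]) <= (\sum_(s <- r) mallows231_pmf beta s)%:E)%E.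
  elim: r => [|s r [mr Pr]].
    rewrite (_ : X @^-1` _ = set0); last by apply/seteqP; split.
    by rewrite measure0 big_nil.
  have [ms Ps] := law s.
  rewrite (_ : X @^-1` _ = X @^-1` [set s] `|` X @^-1` [set t | t \in r]); last first.
    apply/seteqP; split => w /=; rewrite inE; first by case/orP => [/eqP|]; [left|right].
    by case=> [->|->]; rewrite ?eqxx ?orbT.
  split; first exact: measurableU.
  rewrite big_cons EFinD -Ps; apply: le_trans (measureU2 _ ms mr) _.
  by rewrite leeD2l.
have [mE PE] := seqE (enum Q).
have -> : [set s | Q s] = [set s | s \in enum Q].
  by apply/seteqP; split => s /=; rewrite mem_enum.
by split => //; rewrite -big_enum.
Qed.

(** The first Borel-Cantelli lemma, with the bounds of [far_pmf]: it holds for any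
    coupling of the permutations. *)
Lemma ae_near_profile (tau : forall n, T -> 'S_n) (eps : R) : 0 < eps ->
  (forall n, (0 < n)%N -> is_mallows231 P beta (tau n)) ->
  {ae P, forall w, exists N : nat, forall n, (N <= n)%N -> (0 < n)%N ->
    avoids231 (tau n w) && ~~ far (depth231 beta) eps (tau n w)}.
Proof.
move=> eps0 law; have [c [c0 [N0 hN0]]] := far_pmf beta eps0.
pose bad n (s : 'S_n) := ~~ (avoids231 s && ~~ far (depth231 beta) eps s).
pose B n : set T := if (0 < n)%N then tau n @^-1` [set s | bad n s] else set0.
have mB n : measurable (B n).
  rewrite /B; case: ifP => // n0; exact: (mallows231_event (bad n) (law n n0)).1.
pose q := expR (- c); have q0 : 0 < q := expR_gt0 _.
have q1 : q < 1 by rewrite /q -expR0 ltr_expR oppr_lt0.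
pose a := expR (c * N0%:R).
have qn n : expR (- (c * n%:R)) = q ^+ n.
  by rewrite /q -expRM_natl -mulr_natl mulrN mulrC.
have PB n : (P (B n) <= (a * q ^+ n)%:E)%E.
  have [nN|Nn] := ltnP n N0.
    apply: le_trans (probability_le1 _ _) _ => //; rewrite lee_fin /a -qn -expRD.
    by rewrite -[leLHS]expR0 ler_expR -mulrBr mulr_ge0 ?(ltW c0)// subr_ge0 ler_nat ltnW.
  rewrite /B; case: ifP => n0; last by rewrite measure0 lee_fin mulr_ge0 ?expR_ge0 ?exprn_ge0 ?(ltW q0).
  apply: le_trans (mallows231_event (bad n) (law n n0)).2 _; rewrite lee_fin.
  apply: (@le_trans _ _ (\sum_(s : 'S_n | far (depth231 beta) eps s) mallows231_pmf beta s)).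
    rewrite big_mkcond [leRHS]big_mkcond; apply: ler_sum => s _.
    rewrite /bad; case: (boolP (far _ _ s)) => hf; rewrite ?andbF ?andbT//=.
    by case: ifP => // ns; rewrite /mallows231_pmf (negbTE ns).
  apply: le_trans (hN0 n Nn n0) _; rewrite qn ler_peMl ?exprn_ge0 ?(ltW q0)//.
  by rewrite /a -expR0 ler_expR mulr_ge0// ltW.
have sumB : (\sum_(n <oo) P (B n) < +oo)%E.
  apply: (@le_lt_trans _ _ (a / (1 - q))%:E); last by rewrite ltry.
  apply: lime_le; first by apply: is_cvg_nneseries => n _ _; exact: measure_ge0.
  apply: nearW => n; apply: (@le_trans _ _ (\sum_(0 <= i < n) (a * q ^+ i)%:E)%E).
    by apply: lee_sum => i _; exact: PB.
  rewrite sumEFin lee_fin -mulr_sumr ler_wpM2l ?expR_ge0//.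
  rewrite -[leRHS]mul1r ler_pdivlMr ?subr_gt0// mulrC big_mkord.
  have e1 := subrX1 q n; have qn0 : 0 <= q ^+ n by rewrite exprn_ge0 ?(ltW q0).
  rewrite -opprB mulNr -e1; lra.
have null := lim_sup_set_cvg0 mB sumB.
exists (lim_sup_set B); split => //.
  by apply: bigcap_measurable => // n _; exact: bigcup_measurable.
move=> w /= nw n _; apply: contrapT => nB; apply: nw; exists n => k nk k0.
apply: contrapT => /negP bk; apply: nB; exists k => //.
by rewrite /B k0.
Qed.

End almost_sure.

Theorem theorem6 (R : realType) (d : measure_display) (T : measurableType d)
    (P : probability T R) (beta : R) (tau : forall n : nat, T -> 'S_n)
    (tau_law : forall n : nat, (0 < n)%N -> is_mallows231 P beta (tau n)) :
  (0 < beta ->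
     is_permuton (mu231 beta) /\
     {ae P, forall w, permuton_cvg (fun n => tau n w) (mu231 beta)}) /\
  (beta <= 0 ->
     is_permuton (@diag_permuton R) /\
     {ae P, forall w, permuton_cvg (fun n => tau n w) (@diag_permuton R)}).
Proof.
have near_profile : {ae P, forall w, forall k : nat, exists N : nat,
    forall n, (N <= n)%N -> (0 < n)%N -> avoids231 (tau n w) &&
      ~~ far (depth231 beta) k.+1%:R^-1 (tau n w)}.
  by apply/ae_foralln => k; apply: ae_near_profile => //; rewrite invr_gt0.
have near w e : 0 < e -> (forall k : nat, exists N : nat,
    forall n, (N <= n)%N -> (0 < n)%N -> avoids231 (tau n w) &&
      ~~ far (depth231 beta) k.+1%:R^-1 (tau n w)) ->
    exists N : nat, forall n, (N <= n)%N -> (0 < n)%N -> avoids231 (tau n w) /\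
      ~~ far (depth231 beta) e (tau n w).
  move=> e0 h; have [N hN] := h (Num.bound e^-1).
  exists N => n Nn n0; have /andP[-> nf] := hN n Nn n0; split => //.
  apply: contra nf => /existsP[i hi]; apply/existsP; exists i.
  apply: le_lt_trans hi; rewrite ler_wpM2r//.
  rewrite invf_ple ?posrE//; apply: ltW.
  apply: lt_trans (archi_boundP _) _; first by rewrite invr_ge0 ltW.
  by rewrite ltr_nat.
split=> beta0.
  split; first exact: mu231_is_permuton.
  apply: filterS near_profile => w hw; apply: mu231_cvg => // e e0.
  have [e' [e'0 [N1 h1]]] := two_curves_gt0 beta0 e0.
  have [N2 h2] := near w e' e'0 hw.
  exists (maxn N1 N2) => n; rewrite geq_max => /andP[n1 n2] n0.
  by have [av nf] := h2 n n2 n0; exact: h1.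
split; first exact: diag_permuton_is_permuton.
apply: filterS near_profile => w hw; apply: diag_permuton_cvg => e e0.
have [e' [e'0 h1]] := two_curves_flat e0.
have [N h2] := near w e' e'0 hw.
exists N => n Nn n0; have [av nf] := h2 n Nn n0; apply: h1 => //.
move: nf; rewrite (_ : depth231 beta = fun=> 0)//.
by apply/funext => x; rewrite /depth231 ltNge beta0.
Qed.
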